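(* Let $s\in(0,1)$, $0<\lambda\le\Lambda$, and $\mathcal I\in\mathcal J_s(\lambda,\Lambda)$, i.e. $\mathcal Iu=\inf_{\gamma\in\Gamma}\{L_\gamma u-c_\gamma\}$ for some index set $\Gamma$, operators $L_\gamma\in\mathcal L_s(\lambda,\Lambda;2)$ and functions $c_\gamma\in C^{1,1}(B_1)$ with $\sup_{\gamma\in\Gamma}\|c_\gamma\|_{C^{1,1}(B_1)}\le\Lambda$. Let $u\in C(B_1)\cap L^\infty(\mathbb R^n)$ be a viscosity solution of $$\mathcal Iu=0\quad\text{in }B_1.$$ Then, for all $e\in\mathbb S^{n-1}$, in the convexity sense, $$\inf_{B_{1/8}}\partial^2_{ee}u\ge-C\left(\sup_{\gamma\in\Gamma}\|c_\gamma\|_{C^{1,1}(B_1)}+\|u\|_{L^\infty(\mathbb R^n)}\right),$$ where $C$ depends only on $n,s,\lambda,\Lambda$.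
   Context: $B_r$ is the open ball of radius $r$ centered at $0$ in $\mathbb R^n$. Operators: $Lu(x)=\mathrm{p.v.}\int_{\mathbb R^n}(u(x)-u(y))K(x-y)\,dy$ with $K:\mathbb R^n\to[0,\infty]$ symmetric, $K(y)=K(-y)$. One writes $L\in\mathcal L_s(\lambda,\Lambda;2)$ if for all $y\neq0$: $\lambda|y|^{-n-2s}\le K(y)\le\Lambda|y|^{-n-2s}$, $|\nabla K(y)|\le\Lambda|y|^{-1}K(y)$, and $|D^2K(y)|\le\Lambda|y|^{-2}K(y)$. Convexity sense: ''$\partial^2_{ee}u\ge -C$ in a ball (in the convexity sense)'' means that $x\mapsto u(x)+\frac{C}{2n}|x|^2$ is convex there. Viscosity solution of $\mathcal Iu=0$ in $B_1$: whenever $x_0\in B_1$, $N\subset B_1$ is a neighborhood of $x_0$, $\varphi\in C^2(N)$, $\varphi(x_0)=u(x_0)$, and $w:=\varphi$ in $N$, $w:=u$ in $\mathbb R^n\setminus N$, one has $\mathcal Iw(x_0)\le0$ if $\varphi\ge u$ in $N$, and $\mathcal Iw(x_0)\ge0$ if $\varphi\le u$ in $N$. *)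

(* Defs.v *)
From HB Require Import structures.
From mathcomp Require Import all_boot all_order all_algebra.
From mathcomp Require Import all_classical all_reals all_analysis.

Set Implicit Arguments.
Unset Strict Implicit.
Unset Printing Implicit Defensive.

Import Order.TTheory GRing.Theory Num.Theory.
Import numFieldNormedType.Exports.

Local Open Scope classical_set_scope.
Local Open Scope ring_scope.

(* The norm of the normed module 'rV[R]_n is the maximum norm.  On matrices,
   enorm is the Frobenius norm. *)
Definition enorm (R : realType) (m n : nat) (A : 'M[R]_(m, n)) : R :=
  Num.sqrt (\sum_i \sum_j A i j ^+ 2).

Definition eball (R : realType) (n : nat) (r : R) : set 'rV[R]_n :=
  [set x | enorm x < r].

Section lebesgue.
Context (R : realType).

Definition consr (n : nat) (p : n.-tuple (measurableTypeR R) * measurableTypeR R) :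
    n.+1.-tuple (measurableTypeR R) :=
  [the n.+1.-tuple (measurableTypeR R) of p.2 :: p.1].

Lemma measurable_consr n : measurable_fun setT (@consr n).
Proof.
apply: (@measurable_cons _ _ _ _ snd n fst); first exact: measurable_snd.
exact: measurable_fst.
Qed.

Definition lebesgue_consr (n : nat)
    (mu : {measure set (n.-tuple (measurableTypeR R)) -> \bar R}) :
  {measure set (n.+1.-tuple (measurableTypeR R)) -> \bar R}.
Proof.
unshelve refine (pushforward (mu \x lebesgue_measure)%E (@consr n)).
exact: measurable_consr.
Defined.

Fixpoint lebesgue_tuple (n : nat) :
    {measure set (n.-tuple (measurableTypeR R)) -> \bar R} :=
  match n with
  | 0 => \d_([tuple] : 0.-tuple (measurableTypeR R))
  | m.+1 => lebesgue_consr (lebesgue_tuple m)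
  end.

Definition row_of_tuple (n : nat) (t : n.-tuple (measurableTypeR R)) :
  'rV[R]_n := \row_i tnth t i.

Definition lebesgue_outer (n : nat) (A : set 'rV[R]_n) : \bar R :=
  (lebesgue_tuple n)^*%mu (@row_of_tuple n @^-1` A).

Section lebesgue_outer.
Variable n : nat.

Let lebesgue_outer0 : @lebesgue_outer n set0 = 0%E.
Proof. by rewrite /lebesgue_outer preimage_set0 outer_measure0. Qed.

Let lebesgue_outer_ge0 (A : set 'rV[R]_n) : (0 <= lebesgue_outer A)%E.
Proof. exact: outer_measure_ge0. Qed.

Let le_lebesgue_outer :
  {homo @lebesgue_outer n : A B / A `<=` B >-> (A <= B)%E}.
Proof.
by move=> A B AB; apply: le_outer_measure; exact: preimage_subset.
Qed.

Let lebesgue_outer_sigma_subadditive : sigma_subadditive (@lebesgue_outer n).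
Proof.
move=> F; rewrite /lebesgue_outer preimage_bigcup.
exact: outer_measure_sigma_subadditive.
Qed.

HB.instance Definition _ := isOuterMeasure.Build R 'rV[R]_n (@lebesgue_outer n)
  lebesgue_outer0 lebesgue_outer_ge0 le_lebesgue_outer
  lebesgue_outer_sigma_subadditive.

End lebesgue_outer.
End lebesgue.

(* 'rV[R]_n with the sigma-algebra of its Lebesgue measurable sets. *)
Notation lebesgueRn R n := (caratheodory_type (@lebesgue_outer R n)).

Definition lebesgue_measureRn (R : realType) (n : nat) :
  {measure set (lebesgueRn R n) -> \bar R} :=
  [the {outer_measure set 'rV[R]_n -> \bar R} of @lebesgue_outer R n].

Section derivatives.
Context (R : realType) (n : nat).
Implicit Types (f : 'rV[R]_n -> R) (x : 'rV[R]_n) (D : set 'rV[R]_n).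

Definition grad f x : 'rV[R]_n := \row_i 'D_(delta_mx 0 i) f x.

Definition hess f x : 'M[R]_n := 'J (grad f) x.

Definition twice_differentiable f x : Prop :=
  (\forall y \near x, differentiable f y) /\ differentiable (grad f) x.

Definition C2_on D f : Prop :=
  forall x, D x -> twice_differentiable f x /\ {for x, continuous (hess f)}.

Definition C11_norm D f : \bar R :=
  (ereal_sup [set `|f x|%:E | x in D] +
   ereal_sup [set (enorm (grad f x))%:E | x in D] +
   ereal_sup [set (enorm (grad f z.1 - grad f z.2) / enorm (z.1 - z.2))%:E
             | z in [set z | D z.1 /\ D z.2 /\ z.1 != z.2]])%E.

Definition C11_on D f : Prop :=
  (forall x, D x -> differentiable f x) /\ (C11_norm D f < +oo)%E.

End derivatives.

Section operators.
Context (R : realType) (n : nat).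
Implicit Types (K : 'rV[R]_n -> \bar R) (u : 'rV[R]_n -> R).

(* The two-sided bound makes K finite off the origin, so that fine \o K is K
   there. *)
Definition kernel_Ls2 (s lam Lam : R) K : Prop :=
  [/\ forall y, (0 <= K y)%E,
      forall y, K (- y) = K y,
      forall y, y != 0 ->
        ((lam * enorm y `^ (- n%:R - 2 * s))%:E <= K y
           <= (Lam * enorm y `^ (- n%:R - 2 * s))%:E)%E,
      forall y, y != 0 -> twice_differentiable (fine \o K) y &
      forall y, y != 0 ->
        enorm (grad (fine \o K) y) <= Lam * (enorm y)^-1 * fine (K y) /\
        enorm (hess (fine \o K) y) <= Lam * (enorm y) ^- 2 * fine (K y)].

(* The integrals are extended real valued: a test function may be unbounded
   near the boundary of its domain, and then the value may be infinite. *)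
Definition Lop K u (x : 'rV[R]_n) : \bar R :=
  lim ((fun e : R =>
    (\int[lebesgue_measureRn R n]_(y in [set y : 'rV[R]_n | e <= enorm (x - y)]%R)
      ((u x - u y)%:E * K (x - y)%R))%E) @ 0^'+).

Definition Iop (Gam : Type) (K : Gam -> 'rV[R]_n -> \bar R)
    (c : Gam -> 'rV[R]_n -> R) u (x : 'rV[R]_n) : \bar R :=
  ereal_inf [set (Lop (K g) u x - (c g x)%:E)%E | g in [set: Gam]].

Definition Js (s lam Lam : R) (Gam : Type) (K : Gam -> 'rV[R]_n -> \bar R)
    (c : Gam -> 'rV[R]_n -> R) : Prop :=
  [/\ forall g, kernel_Ls2 s lam Lam (K g),
      forall g, C11_on (eball 1) (c g) &
      (ereal_sup [set C11_norm (eball 1) (c g) | g in [set: Gam]] <= Lam%:E)%E].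

Definition viscosity_solution (I : ('rV[R]_n -> R) -> 'rV[R]_n -> \bar R)
    (D : set 'rV[R]_n) u : Prop :=
  forall (x0 : 'rV[R]_n) (N : set 'rV[R]_n) (phi : 'rV[R]_n -> R),
    D x0 -> open N -> N x0 -> N `<=` D -> C2_on N phi -> phi x0 = u x0 ->
    ((forall x, N x -> u x <= phi x) -> (I (patch u N phi) x0 <= 0)%E) /\
    ((forall x, N x -> phi x <= u x) -> (0 <= I (patch u N phi) x0)%E).

(* "The second derivative of u in direction e is at least - C in D", in the
   convexity sense; this sense is the same for all unit vectors e. *)
Definition dee_ge_opp (e : 'rV[R]_n) u (D : set 'rV[R]_n) (C : R) : Prop :=
  @convex_function R 'rV[R]_n D
    (fun x : 'rV[R]_n => u x + C / (2 * n%:R) * enorm x ^+ 2).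

End operators.

(* Main.v *)
(* Write D(x) = 2 u(x) - u(x+h) - u(x-h) and weight it with the squared distance
   to the sphere |x| = 1/2; suppose that at its maximum point x0 the weighted
   difference is large compared with |h|^2.  Doubling of variables, i.e.
   maximizing 2 u(x) - u(x+h+a) - u(x-h+b) minus quadratic penalties in x - x0,
   a and b, yields points x, x+p, x+q at which u is touched by paraboloids, from
   above at x and from below at x+p and x+q.  The subsolution property at x
   selects one operator L_g of the infimum, and the supersolution property at
   the other two points holds for every operator, hence for L_g.  Subtracting,
   the integral of (D(0) - D(w)) K_g(w), with
   D(w) = 2 u(x+w) - u(x+p+w) - u(x+q+w), is bounded by a second difference of
   c_g, of order |h|^2.  Let kappa be K_g truncated, in a C^{1,1} way, at its
   size at distance rho, rho being proportional to 1/2 - |x0|.  Maximality of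
   the penalized function bounds the integral against K_g - kappa from below by
   a small multiple of D(0).  Moving the translations from u to kappa, the
   integral of D(w) kappa(w) becomes that of u times a second difference of
   kappa, of order |h|^2 / rho^2 times the mass of kappa, while the integral of
   D(0) kappa(w) is D(0) times that mass.  For large D(0) / |h|^2 this is a
   contradiction, so D(x) <= C |h|^2 near 0, and a continuous function with such
   a midpoint inequality is semiconvex. *)

From HB Require Import structures.
Require Import Defs.
From mathcomp Require Import all_boot all_order all_algebra.
From mathcomp Require Import all_classical all_reals all_analysis.
From mathcomp Require Import ring lra measurable_realfun ess_sup_inf.

Import Order.TTheory GRing.Theory Num.Theory.
Import numFieldNormedType.Exports.

Local Open Scope classical_set_scope.
Local Open Scope ring_scope.

Set Implicit Arguments.
Unset Strict Implicit.
Unset Printing Implicit Defensive.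

(** * Lebesgue measure on 'rV[R]_n *)

(** Since u is only continuous, the equation cannot be evaluated at a maximum point of the second
    difference; doubling provides points where it can. The price is the curvature 1/eps of the
    paraboloids, over which there is no control. It enters only through integrals over balls of
    radius d, multiplied by d^(2-2s), and d tends to 0 with eps fixed. The curvature that survives
    is A, that of the penalty in x - x0: translating the three points together leaves a and b alone.
    The truncation is forced by the singularity of K, which has infinite mass and whose translates
    cannot be integrated against u. The remainder K - kappa is nonnegative, even, and zero from
    distance rho on, so that only A is felt there. The shifts p = h + a and q = - h + b are not
    opposite. First-order terms of size |p + q| = |a + b| remain, and a, b are therefore kept below
    |h|^2. The weight keeps x0 away from the sphere |x| = 1/2 and nearly constant at the scale rho,
    where D is then almost at most D(x0). The configuration needs |h| small compared with rho; this
    follows from D <= 4 sup |u| once the weighted difference is large. *)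

Section tuple_measure.
Context (R : realType).
Local Notation leb := (@lebesgue_measure R).

(** The translated measure gives intervals their length, and only Lebesgue measure does. *)
Lemma lebesgue_measureD (b : R) (A : set R) :
  measurable A -> leb ((fun t => t + b) @^-1` A) = leb A.
Proof.
move=> mA; have mT : measurable_fun [set: measurableTypeR R] (fun t : R => t + b : measurableTypeR R).
  by apply: measurable_funD => //; exact: measurable_id.
apply/esym.
have := @lebesgue_measure_unique R (pushforward leb (fun t : R => t + b : measurableTypeR R)).
rewrite /pushforward => -> //= _ [[x y]] _ <-.
rewrite lebesgue_measure_itv /pushforward/=.
rewrite (_ : _ @^-1` _ = [set` `]x - b, y - b]]); last first.
  by apply/seteqP; split=> t /=; rewrite !in_itv/= ltrBlDr lerBrDr.
by rewrite lebesgue_measure_itv/= !lte_fin ltrD2r; case: ifP => // _; rewrite -!EFinB opprB addrA subrK.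
Qed.

(* Translations and the reflection of 'rV[R]_n act coordinatewise, so that their
   effect on lebesgue_tuple is computed by induction on the dimension. *)
Definition coordmap n (g : nat -> measurableTypeR R -> measurableTypeR R) (t : n.-tuple (measurableTypeR R)) :
  n.-tuple (measurableTypeR R) := [tuple g i (tnth t i) | i < n].

Lemma measurable_coordmap n g : (forall i, measurable_fun setT (g i)) ->
  measurable_fun setT (@coordmap n g).
Proof.
move=> mg; apply/measurable_fun_tnthP => i.
rewrite (_ : _ \o _ = g i \o (@tnth n (measurableTypeR R) ^~ i)); last first.
  by apply/funext => t /=; rewrite tnth_mktuple.
by apply: (measurableT_comp (mg i)); exact: measurable_tnth.
Qed.

Lemma coordmap_consr n g p :
  coordmap g (@consr R n p) = consr (coordmap (g \o S) p.1, g 0%N p.2).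
Proof.
apply: eq_from_tnth => i; rewrite tnth_mktuple.
have [->|i0] := eqVneq i ord0; first by rewrite !(tnth_nth (g 0%N p.2)).
have [j ->] : exists j, i = lift ord0 j.
  by case: (unliftP ord0 i) i0 => [j ->|->]; [exists j|rewrite eqxx].
by rewrite /consr /= !tnthS tnth_mktuple.
Qed.

(** A section of the preimage is the preimage under [g 0] of a section. Its length is therefore
    unchanged, and the induction hypothesis handles the outer integral, seen as an integral against
    the pushforward by the other coordinates. *)
Lemma lebesgue_tuple_coordmap n g :
  (forall i, measurable_fun setT (g i)) ->
  (forall i A, measurable A -> leb (g i @^-1` A) = leb A) ->
  forall A, measurable A -> lebesgue_tuple R n (coordmap g @^-1` A) = lebesgue_tuple R n A.
Proof.
move=> + + A; elim: n g A => [|n IH] g A mg ig mA.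
  congr (_ _); apply/seteqP.
  by split=> t /=; rewrite (tuple0 t) (tuple0 (coordmap _ _)).
rewrite /= /pushforward /product_measure1.
under eq_integral => x _.
  rewrite /= (_ : xsection _ x =
      g 0%N @^-1` (xsection (@consr R n @^-1` A) (coordmap (g \o S) x))); last first.
    by apply/seteqP; split=> y; rewrite /xsection/= !inE/= coordmap_consr.
  rewrite ig; last first.
    apply: measurable_xsection; rewrite -[X in measurable X]setTI.
    exact: measurable_consr.
  over.
have mB : measurable (@consr R n @^-1` A).
  by rewrite -[X in measurable X]setTI; exact: measurable_consr.
have mg' i : measurable_fun setT ((g \o S) i) by exact: mg.
rewrite -(ge0_integral_pushforward (measurable_coordmap mg') _ (D := setT)
   (f := fun x => leb (xsection (@consr R n @^-1` A) x)))//.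
- apply: eq_measure_integral => [|Hg B mB' _]; [exact: measurable_coordmap|].
  exact: (IH (g \o S) B mg' (fun i => ig i.+1) mB').
- exact: measurable_fun_xsection.
Qed.

Lemma lebesgue_tuple_box n (I : nat -> interval R) (b : R) : 0 <= b ->
  (forall i, leb [set` I i] = b%:E) ->
  lebesgue_tuple R n [set t | forall i : 'I_n, tnth t i \in I i] = (b ^+ n)%:E.
Proof.
move=> b0; elim: n I => [|n IH] I Ib.
  rewrite (_ : mkset _ = setT); last by apply/seteqP; split => t _ //= [].
  by rewrite /= diracT.
rewrite /= /pushforward.
have mI (J : interval R) : measurable ([set` J] : set (measurableTypeR R)) by exact: measurable_itv.
rewrite (_ : _ @^-1` _ = [set t : n.-tuple (measurableTypeR R) | forall i : 'I_n, tnth t i \in I i.+1] `*` [set` I 0%N]); last first.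
  apply/seteqP; split=> [[t y]/= H|[t y]/= [H1 H2] i].
    split=> [i|]; last by have := H ord0; rewrite (tnth_nth 0).
    by have := H (lift ord0 i); rewrite tnthS.
  have [->|i0] := eqVneq i ord0; first by rewrite (tnth_nth 0).
  have [j ->] : exists j, i = lift ord0 j.
    by case: (unliftP ord0 i) i0 => [j ->|->]; [exists j|rewrite eqxx].
  by rewrite tnthS; exact: H1.
rewrite product_measure1E//; last first.
  rewrite (_ : mkset _ = \bigcap_(i in [set: 'I_n]) ((@tnth n (measurableTypeR R) ^~ i) @^-1` [set` I i.+1])); last first.
    by apply/seteqP; split=> [t H i _|t H i]; exact: H.
  apply: fin_bigcap_measurable => // i _; rewrite -[X in measurable X]setTI.
  exact: measurable_tnth.
by rewrite (IH (I \o S) (fun i => Ib i.+1)) exprSr EFinM; congr (_ * _)%E; exact: Ib.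
Qed.

End tuple_measure.

Section lebesgueRn_measure.
Context (R : realType) (n : nat).
Local Notation mu := (lebesgue_measureRn R n).
Local Notation T := (lebesgueRn R n).

Definition tuple_of_row (x : 'rV[R]_n) : n.-tuple (measurableTypeR R) :=
  [tuple x 0 i | i < n].

Lemma tuple_of_rowK : cancel tuple_of_row (@row_of_tuple R n).
Proof. by move=> x; apply/rowP => i; rewrite mxE tnth_mktuple. Qed.

(** The access to the Carathéodory sigma-algebra: measurability for the product sigma-algebra of
    tuples can be checked coordinatewise. *)
Lemma measurable_row_of_tuple (A : set 'rV[R]_n) :
  measurable (@row_of_tuple R n @^-1` A) -> measurable (A : set T).
Proof.
move=> mA.
have /(_ _ _) h := @sub_caratheodory _ _ R (lebesgue_tuple R n).
have : ((lebesgue_tuple R n)^*%mu).-cara.-measurable (@row_of_tuple R n @^-1` A).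
  by apply: h; apply: sub_sigma_algebra.
move=> {}h; change ((@lebesgue_outer R n).-caratheodory A) => X; have := h (@row_of_tuple R n @^-1` X).
by rewrite /lebesgue_outer !preimage_setI preimage_setC.
Qed.

Lemma lebesgue_measureRnE (A : set 'rV[R]_n) :
  measurable (@row_of_tuple R n @^-1` A) ->
  mu A = lebesgue_tuple R n (@row_of_tuple R n @^-1` A).
Proof. by move=> mA; rewrite /lebesgue_measureRn/= /lebesgue_outer measurable_mu_extE. Qed.

Lemma measurable_box (I : nat -> interval R) :
  measurable [set t : n.-tuple (measurableTypeR R) | forall i : 'I_n, tnth t i \in I i].
Proof.
rewrite (_ : mkset _ = \bigcap_(i in [set: 'I_n]) ((@tnth n (measurableTypeR R) ^~ i) @^-1` [set` I i])); last first.
  by apply/seteqP; split=> [t H i _|t H i]; exact: H.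
apply: fin_bigcap_measurable => // i _; rewrite -[X in measurable X]setTI.
apply: measurable_tnth => //; exact: measurable_itv.
Qed.

Definition box (I : nat -> interval R) : set 'rV[R]_n :=
  [set x | forall i : 'I_n, x 0 i \in I i].

Lemma preimage_box I : @row_of_tuple R n @^-1` (box I) =
  [set t : n.-tuple (measurableTypeR R) | forall i : 'I_n, tnth t i \in I i].
Proof. by apply/seteqP; split=> t /= H i; have := H i; rewrite mxE. Qed.

Lemma measurable_boxRn I : measurable (box I : set T).
Proof. by apply: measurable_row_of_tuple; rewrite preimage_box; exact: measurable_box. Qed.

Lemma lebesgue_measureRn_box I (b : R) : 0 <= b ->
  (forall i, lebesgue_measure [set` I i] = b%:E) -> mu (box I) = (b ^+ n)%:E.
Proof.
move=> b0 Ib; rewrite lebesgue_measureRnE preimage_box; last exact: measurable_box.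
exact: lebesgue_tuple_box.
Qed.

(** Coordinates are extended by 0 to all natural indices, because [box] and [coordmap] take families
    indexed by [nat], which the induction on the dimension only has to shift. *)
Definition nat_coord (b : 'rV[R]_n) (i : nat) : R :=
  if insub i is Some j then b 0 j else 0.

Lemma nat_coordE b (i : 'I_n) : nat_coord b i = b 0 i.
Proof. by rewrite /nat_coord insubT//= => ?; congr (b _ _); apply/val_inj. Qed.

(** An open set is the union of the countably many cubes with rational centre and half-side 1/(k+1)
    that it contains. *)
Lemma open_measurableRn (A : set 'rV[R]_n) : open A -> measurable (A : set T).
Proof.
move=> oA.
pose cube (p : 'rV[rat]_n * nat) : set 'rV[R]_n :=
  box (fun i => `]nat_coord (map_mx ratr p.1) i - p.2.+1%:R^-1, nat_coord (map_mx ratr p.1) i + p.2.+1%:R^-1[%R).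
have -> : A = \bigcup_(p in [set p | cube p `<=` A]) cube p.
  apply/seteqP; split; last by move=> x [p /= pA px]; exact: pA.
  move=> x Ax.
  have /nbhs_ballP[e /= e0 xeA] : nbhs x A by exact: open_nbhs_nbhs.
  (* Half of e, since both x and an arbitrary point of the cube are at distance up to 1/(k+1) from
     its centre. *)
  have [k _ /(_ k (leqnn _))] := near_infty_natSinv_lt (PosNum (divr_gt0 e0 (ltr0n R 2))).
  rewrite /= => ke.
  have Hq i : exists q : rat, `|x 0 i - ratr q| < k.+1%:R^-1 :> R.
    have : x 0 i - k.+1%:R^-1 < x 0 i + k.+1%:R^-1 :> R.
      by rewrite ltrBlDr -addrA ltrDl addr_gt0// invr_gt0 ltr0n.
    move=> /rat_in_itvoo[q]; rewrite in_itv/= => /andP[q1 q2].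
    by exists q; rewrite ltr_distlC q1 q2.
  have [q qE] := choice Hq.
  exists (\row_i q i, k) => /=; last first.
    move=> i /=; rewrite nat_coordE !mxE in_itv/=.
    by have := qE i; rewrite ltr_distl.
  move=> y /= H; apply: xeA; split=> // i j; rewrite ord1 /ball/=.
  have := H j; rewrite nat_coordE !mxE in_itv/= -ltr_distl distrC => H1.
  rewrite (splitr e) (le_lt_trans (ler_distD (ratr (q j)) _ _))// ltrD//.
    exact: lt_trans (qE j) ke.
  exact: lt_trans H1 ke.
rewrite bigcup_mkcond; apply: countable_bigcupT_measurable => // p.
by case: ifP => // _; exact: measurable_boxRn.
Qed.

(** Translations and point reflections in one family, closed under inversion, so that each change of
    variables is proved once. *)
Definition sigma_map (a : bool) (b x : 'rV[R]_n) : 'rV[R]_n := (-1) ^+ a *: x + b.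

Lemma sigma_mapK a b : cancel (sigma_map a b) (sigma_map a (- ((-1) ^+ a *: b))).
Proof.
by move=> x; rewrite /sigma_map scalerDr scalerA -expr2 sqrr_sign scale1r addrK.
Qed.

Lemma sigma_mapVK a b : cancel (sigma_map a (- ((-1) ^+ a *: b))) (sigma_map a b).
Proof.
by move=> x; rewrite /sigma_map scalerBr !scalerA -expr2 sqrr_sign !scale1r subrK.
Qed.

Lemma lebesgue_tuple_sigma (a : bool) (b : 'rV[R]_n) A : measurable A ->
  lebesgue_tuple R n ((fun t => tuple_of_row (sigma_map a b (row_of_tuple t))) @^-1` A) =
  lebesgue_tuple R n A /\
  measurable ((fun t => tuple_of_row (sigma_map a b (row_of_tuple t))) @^-1` A).
Proof.
move=> mA.
pose g i (t : measurableTypeR R) : measurableTypeR R := (-1) ^+ a * t + nat_coord b i.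
have -> : (fun t => tuple_of_row (sigma_map a b (row_of_tuple t))) = @coordmap R n g.
  apply/funext => t; apply: eq_from_tnth => i.
  by rewrite !tnth_mktuple /g !mxE nat_coordE.
have mg i : measurable_fun setT (g i).
  by apply: measurable_funD => //; apply: measurable_funM => //.
split; last by rewrite -[X in measurable X]setTI; exact: measurable_coordmap.
apply: lebesgue_tuple_coordmap => // i B mB.
rewrite /g; case: a {g mg} => /=.
  rewrite -[RHS]lebesgue_measureN//.
  rewrite -[RHS](@lebesgue_measureD _ (- nat_coord b i)).
    rewrite /pushforward; congr (lebesgue_measure _); apply/seteqP.
    by split=> t /=; rewrite expr1 mulN1r opprD opprK.
  rewrite -[X in measurable X]setTI; exact: oppr_measurable.
by rewrite -[RHS](@lebesgue_measureD _ (nat_coord b i)) //; under [in LHS]eq_fun do rewrite expr0 mul1r.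
Qed.

(** Pulling back a measurable cover of A gives a cover of the preimage with the same total measure.
    The inverse map, of the same form, yields the opposite inequality. *)
Lemma le_lebesgue_outer_sigma a b (A : set 'rV[R]_n) :
  (lebesgue_outer (sigma_map a b @^-1` A) <= lebesgue_outer A)%E.
Proof.
apply: le_ereal_inf_tmp => _ [F [mF AF] <-].
pose g (t : n.-tuple (measurableTypeR R)) := tuple_of_row (sigma_map a b (row_of_tuple t)).
apply: ereal_inf_lbound; exists (fun k => g @^-1` F k).
  split=> [k|t /= At]; first by have [] := lebesgue_tuple_sigma a b (mF k).
  have /AF[k _ Fk] : (@row_of_tuple R n @^-1` A) (g t) by rewrite /= /g tuple_of_rowK.
  by exists k.
by apply: eq_eseriesr => k _; have [] := lebesgue_tuple_sigma a b (mF k).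
Qed.

Lemma lebesgue_outer_sigma a b (A : set 'rV[R]_n) :
  lebesgue_outer (sigma_map a b @^-1` A) = lebesgue_outer A.
Proof.
apply/eqP; rewrite eq_le le_lebesgue_outer_sigma/=.
have := le_lebesgue_outer_sigma a (- ((-1) ^+ a *: b)) (sigma_map a b @^-1` A).
rewrite -comp_preimage (_ : _ \o _ = id)//.
by apply/funext => x /=; rewrite sigma_mapVK.
Qed.

(** Carathéodory's condition for the preimage of A, tested on X, is the condition for A tested on
    the image of X. *)
Lemma measurable_sigma_map a b : measurable_fun setT (sigma_map a b : T -> T).
Proof.
move=> _ A mA; rewrite setTI.
change ((@lebesgue_outer R n).-caratheodory (sigma_map a b @^-1` A)) => X.
have E : sigma_map a b @^-1` (sigma_map a (- ((-1) ^+ a *: b)) @^-1` X) = X.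
  by apply/seteqP; split=> x /=; rewrite sigma_mapK.
have := mA (sigma_map a (- ((-1) ^+ a *: b)) @^-1` X); rewrite /=.
rewrite -(lebesgue_outer_sigma a b) E => ->.
by congr (_ + _)%E; rewrite -(lebesgue_outer_sigma a b) preimage_setI E.
Qed.

Lemma measurable_sigma_preimage a b (A : set 'rV[R]_n) :
  measurable (A : set T) -> measurable (sigma_map a b @^-1` A : set T).
Proof.
by move=> mA; have := measurable_sigma_map a b measurableT mA; rewrite setTI.
Qed.

Lemma measurable_fun_sigma a b (D : set 'rV[R]_n) d' (V : measurableType d') (f : 'rV[R]_n -> V) :
  measurable (D : set T) ->
  measurable_fun (D : set T) f ->
  measurable_fun (sigma_map a b @^-1` D : set T) (fun x => f (sigma_map a b x)).
Proof.
move=> mD mf _ B mB.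
rewrite (_ : _ `&` _ = sigma_map a b @^-1` (D `&` f @^-1` B)); last by [].
by apply: measurable_sigma_preimage; exact: mf.
Qed.

Lemma ge0_integral_sigma a b (D : set 'rV[R]_n) (f : 'rV[R]_n -> \bar R) :
  measurable (D : set T) -> measurable_fun (D : set T) f ->
  (forall y, D y -> (0 <= f y)%E) ->
  (\int[mu]_(y in D) f y = \int[mu]_(x in sigma_map a b @^-1` D) f (sigma_map a b x))%E.
Proof.
move=> mD mf f0.
have mg := measurable_sigma_map a b.
have f0' : {in D, forall y, (0 <= (f : T -> \bar R) y)%E} by move=> y; rewrite inE => /f0.
have <- := @ge0_integral_pushforward _ _ T T R _ mg mu D f mD mf f0'.
pose nu : {measure set T -> \bar R} := measure_function_pushforward__canonical__measure_function_Measure mu mg.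
apply: (@eq_measure_integral _ T R D nu mu f) => A mA _.
by change (lebesgue_outer A = lebesgue_outer (sigma_map a b @^-1` A)); rewrite lebesgue_outer_sigma.
Qed.
Lemma integral_sigma a b (D : set 'rV[R]_n) (f : 'rV[R]_n -> \bar R) :
  measurable (D : set T) -> measurable_fun (D : set T) f ->
  (\int[mu]_(y in D) f y = \int[mu]_(x in sigma_map a b @^-1` D) f (sigma_map a b x))%E.
Proof.
move=> mD mf; rewrite integralE [RHS]integralE.
have H := @ge0_integral_sigma a b D (fun x : T => funepos (f : T -> \bar R) x) mD (measurable_funepos mf) (fun y _ => funepos_ge0 f y).
rewrite H.
have H' := @ge0_integral_sigma a b D (fun x : T => funeneg (f : T -> \bar R) x) mD (measurable_funeneg mf) (fun y _ => funeneg_ge0 f y).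
rewrite H'.
congr (_ - _)%E; apply: eq_integral => x _.
  by rewrite [LHS]funeposE [RHS]funeposE.
by rewrite [LHS]funenegE [RHS]funenegE.
Qed.
End lebesgueRn_measure.

(** * The Euclidean norm *)

Section euclidean_norm.
Context (R : realType).

Lemma enorm_sqr m n (A : 'M[R]_(m, n)) : enorm A ^+ 2 = \sum_i \sum_j A i j ^+ 2.
Proof. by rewrite /enorm sqr_sqrtr// sumr_ge0// => i _; rewrite sumr_ge0// => j _; exact: sqr_ge0. Qed.

Lemma enorm_ge0 m n (A : 'M[R]_(m, n)) : 0 <= enorm A.
Proof. exact: sqrtr_ge0. Qed.
Hint Resolve enorm_ge0 : core.

Lemma coord_le_enorm m n (A : 'M[R]_(m, n)) i j : `|A i j| <= enorm A.
Proof.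
rewrite -(@ler_pXn2r _ 2)// ?nnegrE// enorm_sqr real_normK ?num_real//.
rewrite (bigD1 i)//= (bigD1 j)//= -addrA lerDl addr_ge0//.
  by rewrite sumr_ge0// => k _; exact: sqr_ge0.
by rewrite sumr_ge0// => k _; rewrite sumr_ge0// => l _; exact: sqr_ge0.
Qed.

Context (n : nat).
Implicit Types (x y : 'rV[R]_n).

Definition dot x y : R := \sum_i x 0 i * y 0 i.

Lemma enorm_rowE x : enorm x ^+ 2 = \sum_i x 0 i ^+ 2.
Proof. by rewrite enorm_sqr big_ord1. Qed.

Lemma dotxx x : dot x x = enorm x ^+ 2.
Proof. by rewrite enorm_rowE. Qed.

Lemma dotC x y : dot x y = dot y x.
Proof. by apply: eq_bigr => i _; rewrite mulrC. Qed.

Lemma dotDl x y z : dot (x + y) z = dot x z + dot y z.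
Proof. by rewrite -big_split; apply: eq_bigr => i _; rewrite mxE mulrDl. Qed.

Lemma dotZl a x y : dot (a *: x) y = a * dot x y.
Proof. by rewrite mulr_sumr; apply: eq_bigr => i _; rewrite mxE mulrA. Qed.

Lemma dotDr x y z : dot x (y + z) = dot x y + dot x z.
Proof. by rewrite dotC dotDl !(dotC x). Qed.

Lemma dotZr a x y : dot x (a *: y) = a * dot x y.
Proof. by rewrite dotC dotZl dotC. Qed.

Lemma dotNl x y : dot (- x) y = - dot x y.
Proof. by rewrite -scaleN1r dotZl mulN1r. Qed.

Lemma dotNr x y : dot x (- y) = - dot x y.
Proof. by rewrite dotC dotNl dotC. Qed.

Lemma enormD_sqr x y : enorm (x + y) ^+ 2 = enorm x ^+ 2 + 2 * dot x y + enorm y ^+ 2.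
Proof. by rewrite -!dotxx dotDl !dotDr (dotC y x); ring. Qed.

Lemma enormZ a x : enorm (a *: x) = `|a| * enorm x.
Proof.
apply/eqP; rewrite -(@eqrXn2 _ 2)// ?mulr_ge0//.
by rewrite exprMn -!dotxx dotZl dotZr mulrA -expr2 real_normK ?num_real.
Qed.

Lemma enormN x : enorm (- x) = enorm x.
Proof. by rewrite -scaleN1r enormZ normrN1 mul1r. Qed.

Lemma enorm0 : enorm (0 : 'rV[R]_n) = 0.
Proof. by rewrite -(scale0r (0 : 'rV[R]_n)) enormZ normr0 mul0r. Qed.

Lemma enormBC x y : enorm (x - y) = enorm (y - x).
Proof. by rewrite -enormN opprB. Qed.

Lemma enorm_eq0 x : (enorm x == 0) = (x == 0).
Proof.
apply/eqP/eqP => [x0|->]; last exact: enorm0.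
apply/rowP => i; rewrite mxE; apply/eqP; rewrite -normr_le0.
by rewrite -x0 coord_le_enorm.
Qed.

Lemma enorm_gt0 x : (0 < enorm x) = (x != 0).
Proof. by rewrite lt_def enorm_eq0 enorm_ge0 andbT. Qed.

Lemma dot_le x y : `|dot x y| <= enorm x * enorm y.
Proof.
rewrite -(@ler_pXn2r _ 2)// ?nnegrE ?mulr_ge0// real_normK ?num_real// exprMn.
have [->|y0] := eqVneq y 0.
  by rewrite -(scale0r (0 : 'rV[R]_n)) dotZr mul0r expr0n/= mulr_ge0// exprn_even_ge0.
(* The component of x orthogonal to y, multiplied by |y|^2 to avoid a division. *)
have : 0 <= enorm (enorm y ^+ 2 *: x - dot x y *: y) ^+ 2 by exact: sqr_ge0.
have yp : 0 < enorm y ^+ 2 by rewrite exprn_gt0// enorm_gt0.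
rewrite enormD_sqr enormN !enormZ !exprMn !real_normK ?num_real//.
rewrite dotNr dotZl dotZr -subr_ge0.
rewrite (_ : _ + _ = enorm y ^+ 2 * (enorm x ^+ 2 * enorm y ^+ 2 - dot x y ^+ 2)); last by ring.
by rewrite pmulr_rge0.
Qed.

Lemma ler_enormD x y : enorm (x + y) <= enorm x + enorm y.
Proof.
rewrite -(@ler_pXn2r _ 2)// ?nnegrE ?addr_ge0// enormD_sqr.
have := le_trans (ler_norm _) (dot_le x y); nra.
Qed.

Lemma ler_enormB x y : enorm (x - y) <= enorm x + enorm y.
Proof. by rewrite (le_trans (ler_enormD _ _))// enormN. Qed.

Lemma lerB_enormD x y : enorm x - enorm y <= enorm (x + y).
Proof.
by rewrite lerBlDr (le_trans _ (ler_enormB _ _))// addrK.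
Qed.

End euclidean_norm.
#[global] Hint Extern 0 (is_true (0 <= enorm _)) => solve [exact: enorm_ge0] : core.

Section euclidean_norm_topology.
Context (R : realType) (n : nat).
Implicit Types (x y : 'rV[R]_n).

(** Cauchy-Schwarz in each column of A. *)
Lemma enorm_mulmx m (A : 'M[R]_(m, n)) (p : 'rV[R]_m) :
  enorm (p *m A) <= enorm p * enorm A.
Proof.
rewrite -(@ler_pXn2r _ 2)// ?nnegrE ?mulr_ge0// enorm_rowE exprMn.
rewrite [X in _ <= _ * X]enorm_sqr exchange_big/= mulr_sumr ler_sum// => j _.
rewrite mxE (_ : \sum_(_ < _) _ = dot p (\row_i A i j)); last first.
  by apply: eq_bigr => k _; rewrite !mxE.
rewrite -[leLHS]real_normK ?num_real//.
apply: (@le_trans _ _ ((enorm p * enorm (\row_i A i j)) ^+ 2)).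
  by rewrite ler_pXn2r ?nnegrE ?mulr_ge0//; exact: dot_le.
rewrite exprMn ler_wpM2l ?sqr_ge0// enorm_rowE ler_sum// => k _.
by rewrite !mxE.
Qed.

Lemma enorm_le_coord x (d : R) : (forall i, `|x 0 i| <= d) -> 0 <= d -> enorm x <= n%:R * d.
Proof.
move=> xd d0; rewrite -(@ler_pXn2r _ 2)// ?nnegrE ?mulr_ge0// enorm_rowE.
apply: (@le_trans _ _ (\sum_(i < n) d ^+ 2)).
  by apply: ler_sum => i _; rewrite -[leLHS]real_normK ?num_real// ler_pXn2r ?nnegrE.
rewrite sumr_const card_ord -[leLHS]mulr_natl exprMn ler_wpM2r ?sqr_ge0//.
by rewrite -natrX ler_nat; case: n => // k; rewrite expnS expn1 leq_pmulr.
Qed.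

Lemma enormB_continuous z : continuous (fun x => enorm (x - z)).
Proof.
move=> x s /= /(nbhs_ballP (enorm (x - z))) [e /= e0 es]; apply/nbhs_ballP.
(* The topology is that of the maximum norm, which [enorm] exceeds at most by the factor n; n + 1
   makes the inequality strict and the quotient meaningful for n = 0. *)
exists (e / n.+1%:R) => /=; first by rewrite divr_gt0.
move=> y [_ /= yx]; apply: es; rewrite /ball/=.
have h1 : enorm (x - y) <= n%:R * (e / n.+1%:R).
  apply: enorm_le_coord => [i|]; last by rewrite ltW// divr_gt0.
  by rewrite !mxE ltW//; have := yx 0 i.
have h2 : n%:R * (e / n.+1%:R) < e.
  by rewrite mulrCA gtr_pMr// ltr_pdivrMr ?ltr0n// mul1r ltr_nat.
have := ler_enormD (y - x) (x - z); have := ler_enormD (x - y) (y - z).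
rewrite !addrA !subrK (enormBC y x) => h3 h4.
have h5 : enorm (x - y) < e := le_lt_trans h1 h2.
rewrite ltr_distl ltrBlDr; apply/andP; split.
  by apply: (le_lt_trans h4); rewrite [ltRHS]addrC ltrD2r.
by apply: (le_lt_trans h3); rewrite addrC ltrD2l.
Qed.

Lemma enorm_continuous : continuous (fun x => enorm x).
Proof.
rewrite (_ : (fun x : 'rV[R]_n => enorm x) = fun x => enorm (x - 0)).
  exact: enormB_continuous.
by apply/funext => x; rewrite subr0.
Qed.

Lemma open_enorm_lt (x : 'rV[R]_n) (r : R) : open [set y | enorm (y - x) < r].
Proof.
rewrite (_ : mkset _ = (fun y => enorm (y - x)) @^-1` [set t | t < r]) //.
by apply: open_comp; [move=> y _; exact: enormB_continuous|exact: open_lt].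
Qed.

Lemma closed_enorm_le (x : 'rV[R]_n) (r : R) : closed [set y | enorm (y - x) <= r].
Proof.
rewrite (_ : mkset _ = (fun y => enorm (y - x)) @^-1` [set t | t <= r]) //.
by apply: closed_comp; [move=> y _; exact: enormB_continuous|exact: closed_le].
Qed.

Lemma compact_enorm_le (x : 'rV[R]_n) (r : R) : compact [set y | enorm (y - x) <= r].
Proof.
apply: bounded_closed_compact; last exact: closed_enorm_le.
exists (enorm x + r); split; first exact: num_real.
move=> M rM y /= yr; rewrite /Num.norm/= mx_normrE; apply: bigmax_le.
  rewrite ltW// (le_lt_trans _ rM)// addr_ge0// (le_trans _ yr)//.
move=> [i j] _ /=; rewrite (le_trans (coord_le_enorm _ _ _))// ltW// (le_lt_trans _ rM)//.
by have := ler_enormD (y - x) x; rewrite subrK => h; apply: (le_trans h); rewrite addrC lerD2l.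
Qed.

Local Notation T := (lebesgueRn R n).
Local Notation mu := (lebesgue_measureRn R n).

Lemma measurable_fun_continuousRn (U : set 'rV[R]_n) (f : 'rV[R]_n -> R) :
  open U -> (forall x, U x -> {for x, continuous f}) -> measurable_fun (U : set T) f.
Proof.
move=> oU cf; apply: (measurability _ (RGenOInfty.measurableE R)).
move=> _ [_ [a ->] <-]; apply: open_measurableRn.
rewrite openE => x [Ux fx]; apply: filterI; first exact: open_nbhs_nbhs.
apply: (cf x Ux); apply: open_nbhs_nbhs; split => //.
Qed.

Lemma measurable_enorm (D : set 'rV[R]_n) : measurable_fun (D : set T) (fun x => enorm x).
Proof.
apply: measurable_funTS; apply: measurable_fun_continuousRn; first exact: openT.
by move=> x _; exact: enorm_continuous.
Qed.

Lemma measurable_enorm_lt r : measurable ([set x | enorm x < r] : set T).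
Proof. by apply: open_measurableRn; rewrite (_ : mkset _ = [set y | enorm (y - 0) < r]); [exact: open_enorm_lt|under [RHS]eq_set do rewrite subr0]. Qed.

Lemma measurable_enorm_ge r : measurable ([set x | r <= enorm x] : set T).
Proof.
rewrite (_ : mkset _ = ~` [set x : 'rV[R]_n | enorm x < r]).
  by apply: measurableC; exact: measurable_enorm_lt.
by apply/seteqP; split=> x /=; rewrite leNgt => /negP.
Qed.

Lemma lebesgue_measureRn_ball_le r : 0 <= r -> (mu [set x | (enorm x < r)%R] <= ((2 * r) ^+ n)%:E)%E.
Proof.
move=> r0; rewrite -(@lebesgue_measureRn_box R n (fun=> `[-r, r]%R)) ?mulr_ge0//; last first.
  move=> i; rewrite lebesgue_measure_itv/= lte_fin; case: ifPn => [_|].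
    by rewrite -EFinB opprK; congr EFin; ring.
  by rewrite -leNgt => r1; congr EFin; lra.
apply: le_measure; rewrite ?inE; [exact: measurable_enorm_lt|exact: measurable_boxRn|].
move=> x /= xr i; rewrite in_itv/= -ler_norml (le_trans (coord_le_enorm _ _ _))// ltW//.
Qed.

End euclidean_norm_topology.

(** * Power-type integrals *)

Section dyadic.
Context (R : realType) (n : nat).
Local Notation T := (lebesgueRn R n).
Local Notation mu := (lebesgue_measureRn R n).

Lemma sum_geometric_le (q : R) m : 0 <= q -> q < 1 ->
  \sum_(0 <= k < m) q ^+ k <= (1 - q)^-1.
Proof.
move=> q0 q1; have q1' : 0 < 1 - q by rewrite subr_gt0.
rewrite -(ler_pM2r q1') mulVf ?gt_eqF// mulrC big_mkord.
by rewrite -opprB mulNr -subrX1 opprB lerBlDr lerDl exprn_ge0.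
Qed.

(* Both the tail and the core integrals of |w|^(-n-2s) are split into dyadic
   layers, covered by the balls of radii r k: the series is then geometric. *)
Lemma integral_layers_le (D : set 'rV[R]_n) (f : 'rV[R]_n -> R) (c r : nat -> R) (a q : R) :
  measurable (D : set T) -> measurable_fun (D : set T) f ->
  (forall w, D w -> 0 <= f w) -> (forall k, 0 <= c k) -> (forall k, 0 <= r k) ->
  (forall w, D w -> exists2 k, enorm w < r k & f w <= c k) ->
  0 <= q -> q < 1 -> (forall k, c k * (2 * r k) ^+ n <= a * q ^+ k) ->
  (\int[mu]_(w in D) (f w)%:E <= (a / (1 - q))%:E)%E.
Proof.
move=> mD mf f0 c0 r0 Dfc q0 q1 cr.
have a0 : 0 <= a.
  have := cr 0%N; rewrite expr0 mulr1; apply: le_trans.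
  by rewrite mulr_ge0// exprn_ge0// mulr_ge0.
pose F k (w : T) : \bar R := (c k * \1_[set w : 'rV[R]_n | enorm w < r k] w)%:E.
have mF k : measurable_fun (D : set T) (F k).
  apply/measurable_EFinP; apply: measurable_funM => //.
  by apply: measurable_indic; exact: measurable_enorm_lt.
have F0 k w : (0 <= F k w)%E by rewrite lee_fin mulr_ge0.
apply: (@le_trans _ _ (\int[mu]_(w in D) (\sum_(k <oo) F k w))%E).
  apply: (@ge0_le_integral _ T R mu D mD (fun w => (f w)%:E) (fun w => \sum_(k <oo) F k w)%E).
  - by move=> w Dw; rewrite lee_fin; exact: f0.
  - exact/measurable_EFinP.
  - apply: ge0_emeasurable_sum; last by move=> k _; exact: mF.
    by move=> k w _ _; exact: F0.
  - move=> w Dw; have [k wk fk] := Dfc w Dw.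
    have := @nneseries_lim_ge R (F ^~ w) xpredT 0 k.+1 (fun n _ _ => F0 n w).
    apply: le_trans; rewrite big_mkord big_ord_recr/=.
    rewrite -[leLHS]add0e leeD ?sume_ge0//.
    by rewrite lee_fin indicE mem_set//= mulr1.
rewrite integral_nneseries//.
apply: lime_le; first by apply: is_cvg_nneseries => k _ _; exact: integral_ge0.
apply: nearW => m.
apply: (@le_trans _ _ (\sum_(0 <= k < m) (a * q ^+ k)%:E)%E).
  apply: lee_sum => k _.
  rewrite /F; under eq_integral do rewrite EFinM.
  rewrite (@ge0_integralZl_EFin _ T R mu D mD (fun w => (\1_[set w : 'rV[R]_n | enorm w < r k] w)%:E)); last 3 first.
    by move=> w _; rewrite lee_fin.
    by apply/measurable_EFinP; apply: measurable_indic; exact: measurable_enorm_lt.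
    exact: c0.
  rewrite integral_indic//; last exact: measurable_enorm_lt.
  apply: (@le_trans _ _ ((c k)%:E * ((2 * r k) ^+ n)%:E)%E); last by rewrite -EFinM lee_fin.
  rewrite lee_wpmul2l ?lee_fin//; apply: le_trans (lebesgue_measureRn_ball_le n (r0 k)).
  apply: le_measure; rewrite ?inE//; [|exact: measurable_enorm_lt].
  by apply: measurableI => //; exact: measurable_enorm_lt.
rewrite sumEFin lee_fin -mulr_sumr ler_wpM2l//.
exact: sum_geometric_le.
Qed.
End dyadic.

Definition kpow (R : realType) (n : nat) (s t : R) : R := t `^ (- n%:R - 2 * s).

Section kernel_power.
Context (R : realType) (n : nat) (s : R).
Hypotheses (n0 : (0 < n)%N) (s0 : 0 < s) (s1 : s < 1).
Local Notation T := (lebesgueRn R n).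
Local Notation mu := (lebesgue_measureRn R n).
Local Notation P := (kpow n s).

Lemma kpowM a b : 0 <= a -> 0 <= b -> P (a * b) = P a * P b.
Proof. exact: powRM. Qed.

Lemma kpow_gt0 a : 0 < a -> 0 < P a.
Proof. exact: powR_gt0. Qed.

Lemma kpow_ge0 a : 0 <= P a.
Proof. exact: powR_ge0. Qed.

Lemma kpowX a k : 0 <= a -> P (a ^+ k) = P a ^+ k.
Proof.
move=> a0; elim: k => [|k IH]; first by rewrite !expr0 /kpow powR1.
by rewrite !exprS kpowM ?exprn_ge0// IH.
Qed.

Lemma kpow_le a b : 0 < a -> a <= b -> P b <= P a.
Proof.
move=> a0 ab; rewrite /kpow -opprD !powRN lef_pV2 ?posrE ?powR_gt0//; last exact: lt_le_trans ab.
by rewrite ge0_ler_powR ?nnegrE ?addr_ge0 ?mulr_ge0 ?(ltW s0) ?(ltW a0)// (le_trans (ltW a0)).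
Qed.

(** The volume factor cancels the dimension in the exponent of the kernel. *)
Lemma expr_kpow (a : R) : 0 < a -> a ^+ n * P a = a `^ (- 2 * s).
Proof.
move=> a0; rewrite -powR_mulrn ?ltW// /kpow -powRD; last by rewrite (gt_eqF a0) implybT.
by congr (_ `^ _); ring.
Qed.

Lemma powR_gt1 (a r : R) : 1 < a -> 0 < r -> 1 < a `^ r.
Proof.
move=> a1 r0; have := @gt0_ltr_powR _ r r0 1 a; rewrite powR1; apply => //.
  by rewrite nnegrE.
by rewrite nnegrE (le_trans ler01)// ltW.
Qed.

Lemma powR_lt1 (a r : R) : 0 < a -> a < 1 -> 0 < r -> a `^ r < 1.
Proof.
move=> a0 a1 r0; have := @gt0_ltr_powR _ r r0 a 1; rewrite powR1; apply => //.
  by rewrite nnegrE ltW.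
by rewrite nnegrE.
Qed.

(** At scales below 1 the mass of the truncated kernel is bounded below; this lets the term coming
    from the functions c, which carries no such factor, be absorbed. *)
Lemma kpow_scale_ge1 (a : R) : 0 < a -> a <= 1 -> 1 <= a ^+ n * P a.
Proof.
move=> a0 a1; rewrite expr_kpow// mulNr powRN.
have := @ger_powR _ a; rewrite a0 a1 => /(_ isT 0 (2 * s)) /=.
rewrite powRr0 mulr_ge0 ?(ltW s0)// => /(_ isT) h.
by rewrite invf_ge1 ?powR_gt0.
Qed.

(** The ratio is 2^(-2s): convergence at infinity comes from s > 0. *)
Lemma tail_ratio : 0 <= 2 ^+ n * P 2 < 1.
Proof.
rewrite mulr_ge0 ?kpow_ge0 ?exprn_ge0//= expr_kpow// mulNr powRN invf_lt1 ?powR_gt0//.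
by rewrite powR_gt1 ?ltr1n ?mulr_gt0.
Qed.

(** The ratio is 2^(2s-2): integrability of |w|^2 times the kernel at 0 comes from s < 1. *)
Lemma core_ratio : 0 <= 2^-1 ^+ n.+2 * P 2^-1 < 1.
Proof.
have h0 : 0 < 2^-1 :> R by rewrite invr_gt0.
rewrite mulr_ge0 ?kpow_ge0 ?exprn_ge0//= -[n.+2]addn2 exprD mulrAC expr_kpow//.
rewrite -[2^-1 ^+ 2]powR_mulrn// -powRD; last by rewrite (gt_eqF h0) implybT.
rewrite powR_lt1 ?invf_lt1 ?ltr1n//; have := s1; lra.
Qed.

Lemma kpow_measurable (D : set 'rV[R]_n) : measurable_fun (D : set T) (fun w => P (enorm w)).
Proof.
apply: (@measurableT_comp _ _ _ _ _ _ (fun t : R => P t)); first exact: measurable_powR.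
exact: measurable_enorm.
Qed.

Lemma dyadic_shell (t rho : R) : 0 < rho -> rho <= t ->
  exists k, 2 ^+ k * rho <= t < 2 ^+ k.+1 * rho.
Proof.
move=> rho0 rt.
have ex : exists k, t < 2 ^+ k * rho.
  have [k] : exists k : nat, t / rho < k%:R.
    by exists (Num.bound (t / rho)); rewrite archi_boundP// divr_ge0// ?ltW// (lt_le_trans rho0).
  rewrite ltr_pdivrMr// => tk; exists k; apply: (lt_le_trans tk).
  by rewrite ler_pM2r// -natrX ler_nat ltnW// ltn_expl.
case: (ex_minnP ex) => -[|k] tk kmin.
  by move: tk; rewrite expr0 mul1r ltNge rt.
exists k; rewrite tk andbT leNgt; apply/negP => /kmin.
by rewrite ltnn.
Qed.

(** Sums of the two geometric series. A layer lies in a cube whose side is 4 times its scale; in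
    [Ccore] the factor P 2^-1 comes from evaluating the kernel at half the scale, the inner radius
    of the layer. *)
Definition Ctail : R := 4 ^+ n / (1 - 2 ^+ n * P 2).
Definition Ccore : R := 4 ^+ n * P 2^-1 / (1 - 2^-1 ^+ n.+2 * P 2^-1).

Lemma Ctail_gt0 : 0 < Ctail.
Proof.
have /andP[_ q1] := tail_ratio.
by rewrite divr_gt0// ?exprn_gt0// subr_gt0.
Qed.

Lemma Ccore_gt0 : 0 < Ccore.
Proof.
have /andP[_ q1] := core_ratio.
by rewrite divr_gt0// ?subr_gt0// mulr_gt0 ?exprn_gt0// kpow_gt0// invr_gt0.
Qed.

Lemma integral_tail_le (rho : R) : 0 < rho ->
  (\int[mu]_(w in [set w : 'rV[R]_n | (rho <= enorm w)%R]) (P (enorm w))%:E <=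
   (Ctail * (rho ^+ n * P rho))%:E)%E.
Proof.
move=> r0; have /andP[q0 q1] := tail_ratio.
have -> : Ctail * (rho ^+ n * P rho) = 4 ^+ n * (rho ^+ n * P rho) / (1 - 2 ^+ n * P 2).
  by rewrite /Ctail mulrAC.
apply: (@integral_layers_le _ _ _ _ (fun k => P (2 ^+ k * rho)) (fun k => 2 ^+ k.+1 * rho)).
- exact: measurable_enorm_ge.
- exact: kpow_measurable.
- by move=> w _; exact: kpow_ge0.
- by move=> k; exact: kpow_ge0.
- by move=> k; rewrite mulr_ge0 ?exprn_ge0// ltW.
- move=> w /= /(dyadic_shell r0)[k /andP[k1 k2]]; exists k => //.
  by apply: kpow_le => //; rewrite mulr_gt0 ?exprn_gt0.
- exact: q0.
- exact: q1.
- move=> k; rewrite kpowM ?exprn_ge0 ?(ltW r0)// kpowX// (_ : 2 * (2 ^+ k.+1 * rho) = 4 * (2 ^+ k * rho)); last by rewrite exprS; ring.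
  by rewrite [leLHS](_ : _ = 4 ^+ n * (rho ^+ n * P rho) * (2 ^+ n * P 2) ^+ k)// !exprMn exprAC; ring.
Qed.

Lemma measurable_enorm_shell (e rho : R) : measurable ([set w : 'rV[R]_n | e <= enorm w < rho] : set T).
Proof.
rewrite (_ : mkset _ = [set w : 'rV[R]_n | e <= enorm w] `&` [set w | enorm w < rho]).
  by apply: measurableI; [exact: measurable_enorm_ge|exact: measurable_enorm_lt].
by apply/seteqP; split=> w /= /andP.
Qed.

Lemma core_ratioE (h rho p q : R) k :
  (h ^+ k * rho) ^+ 2 * (p ^+ k.+1 * q) * (2 * (2 * (h ^+ k * rho))) ^+ n =
  4 ^+ n * p * (rho ^+ n.+2 * q) * (h ^+ n.+2 * p) ^+ k.
Proof.
rewrite (_ : 2 * (2 * (h ^+ k * rho)) = 4 * (h ^+ k * rho)); last by ring.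
have E x : x ^+ n.+2 = x ^+ n * x ^+ 2 :> R by rewrite -exprD addn2.
rewrite !E !exprMn (exprS p k) (exprAC h k n).
move: (4 ^+ n) (h ^+ n ^+ k) (h ^+ k) (rho ^+ n) (p ^+ k) => a b c d e.
ring.
Qed.

Lemma integral_core_le (e rho : R) : 0 < e -> 0 < rho ->
  (\int[mu]_(w in [set w : 'rV[R]_n | (e <= enorm w < rho)%R]) (enorm w ^+ 2 * P (enorm w))%:E <=
   (Ccore * (rho ^+ n.+2 * P rho))%:E)%E.
Proof.
move=> e0 r0; have /andP[q0 q1] := core_ratio.
have -> : Ccore * (rho ^+ n.+2 * P rho) = 4 ^+ n * P 2^-1 * (rho ^+ n.+2 * P rho) / (1 - 2^-1 ^+ n.+2 * P 2^-1).
  by rewrite /Ccore mulrAC.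
have h0 : 0 < 2^-1 :> R by rewrite invr_gt0.
apply: (@integral_layers_le _ _ _ _ (fun k => (2^-1 ^+ k * rho) ^+ 2 * P (2^-1 ^+ k.+1 * rho)) (fun k => 2 * (2^-1 ^+ k * rho))).
- exact: measurable_enorm_shell.
- apply: measurable_funM; last exact: kpow_measurable.
  by apply: measurable_funX; exact: measurable_enorm.
- by move=> w _; rewrite mulr_ge0 ?sqr_ge0// kpow_ge0.
- by move=> k; rewrite mulr_ge0 ?sqr_ge0// kpow_ge0.
- by move=> k; rewrite mulr_ge0// mulr_ge0 ?exprn_ge0// ltW.
- move=> w /= /andP[ew wr].
  have w0 : 0 < enorm w := lt_le_trans e0 ew.
  (* Here |w| is the unit and rho the number to locate, so that the layers are counted inwards. They
     are closed on the outside, hence the factor 2 in the radii of the open balls. *)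
  have [k /andP[k1 k2]] := dyadic_shell w0 (ltW wr).
  have p0 m : 0 < 2 ^+ m :> R by rewrite exprn_gt0.
  have k1' : enorm w <= 2^-1 ^+ k * rho by rewrite exprVn mulrC ler_pdivlMr// mulrC.
  have k2' : 2^-1 ^+ k.+1 * rho <= enorm w.
    by rewrite exprVn mulrC ler_pdivrMr// mulrC ltW.
  exists k; first by apply: (le_lt_trans k1'); rewrite ltr_pMl ?ltr1n// mulr_gt0 ?exprn_gt0.
  rewrite ler_pM ?sqr_ge0 ?kpow_ge0//; last by apply: kpow_le => //; rewrite mulr_gt0 ?exprn_gt0.
  by rewrite ler_pXn2r ?nnegrE// mulr_ge0 ?exprn_ge0 ?ltW.
- exact: q0.
- exact: q1.
- by move=> k; rewrite kpowM ?exprn_ge0 ?(ltW r0)// kpowX ?(ltW h0)// core_ratioE.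
Qed.

Lemma lebesgue_measureRn_cube (rho : R) : 0 < rho ->
  mu (box (fun=> `[rho, 2 * rho]%R)) = (rho ^+ n)%:E.
Proof.
move=> r0; apply: lebesgue_measureRn_box => [|i]; first exact: ltW.
rewrite lebesgue_measure_itv/= lte_fin ltr_pMl// ltr1n/=.
by rewrite -EFinB; congr EFin; ring.
Qed.

Lemma cube_enorm (rho : R) (w : 'rV[R]_n) : 0 < rho ->
  box (fun=> `[rho, 2 * rho]%R) w -> rho <= enorm w <= n%:R * (2 * rho).
Proof.
move=> r0 wQ; have hi i : rho <= w 0 i <= 2 * rho by have := wQ i; rewrite in_itv.
apply/andP; split.
  have /andP[h _] := hi (Ordinal n0).
  by rewrite (le_trans h)// (le_trans (ler_norm _))// coord_le_enorm.
apply: enorm_le_coord => [i|]; last by rewrite mulr_ge0// ltW.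
have /andP[h1 h2] := hi i.
by rewrite ger0_norm// (le_trans (ltW r0)).
Qed.

End kernel_power.

(** * Taylor expansion along segments *)

Section line_calculus.
Context (R : realType) (n : nat).
Implicit Types (f : 'rV[R]_n -> R) (a p v : 'rV[R]_n).

Lemma diff_dot_grad f a p : differentiable f a -> 'd f a p = dot (grad f a) p.
Proof.
move=> df.
rewrite {1}(row_sum_delta p) linear_sum /dot; apply: eq_bigr => i _.
by rewrite linearZ /= -deriveE// mxE mulrC.
Qed.

Lemma is_derive_line f a p t : differentiable f (a + t *: p) ->
  is_derive t 1 (fun t => f (a + t *: p)) (dot (grad f (a + t *: p)) p).
Proof.
move=> df.
have E : (fun h : R => h^-1 *: (((fun t => f (a + t *: p)) \o shift t) (h *: (1 : R)) - f (a + t *: p))) =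
         (fun h : R => h^-1 *: ((f \o shift (a + t *: p)) (h *: p) - f (a + t *: p))).
  apply/funext => h /=; congr (_ *: (f _ - _)).
  by rewrite scalerDl addrCA /GRing.scale/= mulr1.
have := @diff_derivable _ _ _ _ _ p df.
split; first by rewrite /derivable E.
by rewrite /derive E -diff_dot_grad// -deriveE.
Qed.

Lemma mvt_line f a p : (forall t : R, 0 <= t <= 1 -> differentiable f (a + t *: p)) ->
  exists2 t : R, 0 <= t <= 1 & f (a + p) - f a = dot (grad f (a + t *: p)) p.
Proof.
move=> df.
have dl (t : R) : 0 <= t <= 1 -> is_derive t 1 (fun t => f (a + t *: p)) (dot (grad f (a + t *: p)) p).
  by move=> /df; exact: is_derive_line.
have [| |t] := @MVT_segment R (fun t => f (a + t *: p)) (fun t => dot (grad f (a + t *: p)) p) 0 1 ler01.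
- by move=> x; rewrite in_itv/= => /andP[x0 x1]; apply: dl; rewrite !ltW.
- apply: derivable_within_continuous => x; rewrite in_itv/= => /dl[]//.
rewrite in_itv/= scale1r scale0r addr0 subr0 mulr1 => t01 E.
by exists t.
Qed.

Lemma lip_line f a p G : (forall t : R, 0 <= t <= 1 -> differentiable f (a + t *: p)) ->
  (forall t : R, 0 <= t <= 1 -> enorm (grad f (a + t *: p)) <= G) ->
  `|f (a + p) - f a| <= G * enorm p.
Proof.
move=> df gG; have [t t01 ->] := mvt_line df.
by rewrite (le_trans (dot_le _ _))// ler_wpM2r// gG.
Qed.

Lemma taylor_line f a p L : (forall t : R, 0 <= t <= 1 -> differentiable f (a + t *: p)) ->
  (forall t : R, 0 <= t <= 1 -> enorm (grad f (a + t *: p) - grad f a) <= L * enorm p) ->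
  `|f (a + p) - f a - dot (grad f a) p| <= L * enorm p ^+ 2.
Proof.
move=> df gL; have [t t01 ->] := mvt_line df.
rewrite -dotNl -dotDl (le_trans (dot_le _ _))// expr2 mulrA ler_wpM2r// gL//.
Qed.

Definition dotr v y : R := dot y v.

Lemma dotr_linear v : linear (dotr v).
Proof. by move=> c x y; rewrite /dotr dotDl dotZl. Qed.

HB.instance Definition _ v := GRing.isLinear.Build R 'rV[R]_n R _ (dotr v) (dotr_linear v).

Lemma dotr_continuous v : continuous (dotr v).
Proof.
move=> x s /= /(nbhs_ballP (dot x v)) [e /= e0 es].
pose d := e / (enorm v + 1).
have v0 : 0 < enorm v + 1 by rewrite ltr_wpDl.
have d0 : 0 < d by rewrite divr_gt0.
have : nbhs x [set y | enorm (y - x) < d].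
  by apply: open_nbhs_nbhs; split; [exact: open_enorm_lt|rewrite /= subrr enorm0].
apply: filterS => y /= yx; apply: es; rewrite /ball/= /dotr.
rewrite -dotNl -dotDl (le_lt_trans (dot_le _ _))// enormBC.
apply: (@le_lt_trans _ _ (d * enorm v)); first by rewrite ler_wpM2r// ltW.
by rewrite /d mulrAC ltr_pdivrMr// ltr_pM2l// ltrDl.
Qed.

(** The scalar mean value theorem for the inner product of F with its own increment v gives |v|^2 <=
    H |p| |v|. *)
Lemma lip_line_vec (F : 'rV[R]_n -> 'rV[R]_n) a p H :
  (forall t : R, 0 <= t <= 1 -> differentiable F (a + t *: p)) ->
  (forall t : R, 0 <= t <= 1 -> enorm ('J F (a + t *: p)) <= H) ->
  enorm (F (a + p) - F a) <= H * enorm p.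
Proof.
move=> dF HF.
set v := F (a + p) - F a.
pose g := dotr v \o F.
have dg (t : R) : 0 <= t <= 1 -> differentiable g (a + t *: p).
  move=> t01; apply: differentiable_comp; first exact: dF.
  by apply: linear_differentiable; exact: dotr_continuous.
have [t t01] := mvt_line dg.
rewrite -diff_dot_grad; last exact: dg.
rewrite diff_comp; [|exact: dF|by apply: linear_differentiable; exact: dotr_continuous].
rewrite diff_lin/= /dotr; last exact: dotr_continuous.
rewrite -dotNl -dotDl -/v dotxx.
have -> : 'd F (a + t *: p) p = p *m 'J F (a + t *: p).
  by rewrite /jacobian mul_rV_lin1.
move=> E.
have : enorm v ^+ 2 <= enorm p * H * enorm v.
  rewrite E (le_trans (ler_norm _))// (le_trans (dot_le _ _))// ler_wpM2r//.
  by rewrite (le_trans (enorm_mulmx _ _))// ler_wpM2l// HF.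
have [->|v0] := eqVneq v 0; first by rewrite enorm0 mulr_ge0// (le_trans _ (HF _ t01)).
by rewrite expr2 ler_pM2r ?enorm_gt0// mulrC.
Qed.

End line_calculus.

(** * Paraboloids as test functions *)

Section quadratic_function.
Context (R : realType) (n : nat) (p x0 : 'rV[R]_n) (c b : R).

Definition quadratic (y : 'rV[R]_n) : R :=
  c + dot p (y - x0) + b * enorm (y - x0) ^+ 2.

Lemma quadraticD y w :
  quadratic (y + w) = quadratic y + dot (p + (2 * b) *: (y - x0)) w + b * enorm w ^+ 2.
Proof.
rewrite /quadratic (addrAC y w (- x0)); set z := y - x0.
by rewrite enormD_sqr dotDr dotDl dotZl; ring.
Qed.

Lemma differentiable_quadratic y : differentiable quadratic y.
Proof.
have -> : quadratic = (fun=> c) + (fun y => dotr (p - (2 * b) *: x0) y) + (fun=> b * enorm x0 ^+ 2 - dot p x0) + (b *: \sum_i (fun y : 'rV[R]_n => y 0 i * y 0 i)).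
  apply/funext => z; rewrite /quadratic !fctE /dotr/= fct_sumE/=.
  rewrite -[\sum_(_ < _) _]/(dot z z) dotxx enormD_sqr enormN !dotDr !dotNr dotZr !(dotC z).
  by rewrite /GRing.scale/=; ring.
apply: differentiableD.
  apply: differentiableD; last exact: differentiable_cst.
  apply: differentiableD; first exact: differentiable_cst.
  by apply: linear_differentiable; exact: dotr_continuous.
apply: differentiableZ; apply: differentiable_sum => i.
by apply: differentiableM; exact: differentiable_coord.
Qed.

Lemma grad_quadratic : grad quadratic = fun y => p + (2 * b) *: (y - x0).
Proof.
apply/funext => y; apply/rowP => i; rewrite mxE.
rewrite /derive.
have -> : (p + (2 * b) *: (y - x0)) 0 i = dot (p + (2 * b) *: (y - x0)) (delta_mx 0 i).
  rewrite /dot (bigD1 i)//= big1 ?addr0; last by move=> j ji; rewrite !mxE eqxx/= (negbTE ji) mulr0.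
  by rewrite [delta_mx _ _ _ _]mxE !eqxx mulr1.
set v := delta_mx 0 i; set L := dot _ v.
apply/cvg_lim => //.
apply: (@cvg_trans _ ((fun h : R => L + h * (b * enorm v ^+ 2)) @ 0^')).
  apply: near_eq_cvg; near=> h => /=.
  have h0 : h != 0 by near: h; exact: nbhs_dnbhs_neq.
  have -> : quadratic (h *: v + y) - quadratic y = h * L + b * (h ^+ 2 * enorm v ^+ 2).
    by rewrite (addrC (h *: v)) quadraticD dotZr enormZ exprMn real_normK ?num_real// -/L; ring.
  by rewrite /GRing.scale/=; field.
have : L + h * (b * enorm v ^+ 2) @[h --> 0^'] --> L + 0 * (b * enorm v ^+ 2).
  by apply: cvgD; [exact: cvg_cst|apply: cvgMl; exact: nbhs_dnbhs].
by rewrite mul0r addr0.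
Unshelve. all: by end_near. Qed.

Lemma C2_on_quadratic N : C2_on N quadratic.
Proof.
have E : grad quadratic = cst (p - (2 * b) *: x0) + ( *:%R (2 * b)).
  by rewrite grad_quadratic; apply/funext => y; rewrite !fctE scalerBr addrA addrAC.
have ds (y : 'rV[R]_n) : differentiable ( *:%R (2 * b)) y.
  exact/linear_differentiable/scaler_continuous.
have dE y : differentiable (grad quadratic) y.
  by rewrite E; apply: differentiableD; [exact: differentiable_cst|exact: ds].
have JE : hess quadratic = fun=> lin1_mx (fun y : 'rV[R]_n => (2 * b) *: y).
  apply/funext => y; rewrite /hess /jacobian; congr lin1_mx.
  rewrite E diffD; [|exact: differentiable_cst|exact: ds].
  have h1 := @diff_cst R 'rV[R]_n 'rV[R]_n (p - (2 * b) *: x0) y.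
  have h2 : 'd ( *:%R (2 * b)) y = *:%R (2 * b) :> ('rV[R]_n -> 'rV[R]_n).
    by apply: diff_lin; exact: scaler_continuous.
  apply/funext => z.
  have h1z : 'd (cst (p - (2 * b) *: x0)) y z = 0 := congr1 (fun g => g z) h1.
  have h2z : 'd ( *:%R (2 * b)) y z = (2 * b) *: z := congr1 (fun g => g z) h2.
  exact: (etrans (congr2 +%R h1z h2z) (add0r _)).

move=> x _; split; last by rewrite JE; exact: cst_continuous.
split; last exact: dE.
have : nbhs x [set: 'rV[R]_n] by exact: filterT.
by apply: filterS => y _; exact: differentiable_quadratic.
Qed.

End quadratic_function.

(** * Truncated kernels *)

Section truncation.
Context (R : realType) (T : R).
Hypothesis T0 : 0 < T.

(* The C^{1,1} interpolation between t on [0, T] and the constant 2 T on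
   [3 T, +oo); dtrunc is its derivative. *)
Definition trunc (t : R) : R :=
  if t <= T then t else if t <= 3 * T then t - (t - T) ^+ 2 / (4 * T) else 2 * T.

Definition dtrunc (t : R) : R :=
  if t <= T then 1 else if t <= 3 * T then 1 - (t - T) / (2 * T) else 0.

Lemma trunc_bounds (t : R) : 0 <= t ->
  [/\ 0 <= trunc t, trunc t <= t, trunc t <= 2 * T & Num.min t T <= trunc t].
Proof.
move=> t0; have T00 := T0; rewrite /trunc; case: ifPn => [tT|]; first by split=> //; [lra|rewrite ge_min lexx].
rewrite -ltNge => Tt; case: ifPn => [t3|].
  have h : (t - T) ^+ 2 / (4 * T) <= t - T.
    by rewrite ler_pdivrMr ?mulr_gt0//; nra.
  have h0 : 0 <= (t - T) ^+ 2 / (4 * T) by rewrite divr_ge0 ?sqr_ge0// mulr_ge0// ltW.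
  have h2 : t - 2 * T <= (t - T) ^+ 2 / (4 * T).
    by rewrite ler_pdivlMr ?mulr_gt0//; nra.
  by split; rewrite ?ge_min; [lra|lra|lra|apply/orP; right; lra].
by rewrite -ltNge => t3; split; rewrite ?ge_min; [lra|lra|lra|apply/orP; right; lra].
Qed.

Lemma dtrunc_bounds (t : R) : 0 <= t -> 0 <= dtrunc t <= 1.
Proof.
move=> t0; rewrite /dtrunc; case: ifPn => [_|]; first by rewrite ler01 lexx.
rewrite -ltNge => Tt; case: ifPn => [t3|]; last by rewrite lexx ler01.
have h : (t - T) / (2 * T) <= 1 by rewrite ler_pdivrMr ?mulr_gt0//; lra.
have h0 : 0 <= (t - T) / (2 * T) by rewrite divr_ge0//; lra.
by apply/andP; split; lra.
Qed.

(** The derivative [dtrunc] is Lipschitz with constant 1/(2T), half of which bounds the remainder.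
    After multiplication by 4T both sides are polynomials on each piece. *)
Lemma trunc_taylor (a b : R) : 0 <= a -> 0 <= b ->
  `|trunc b - trunc a - dtrunc a * (b - a)| <= (b - a) ^+ 2 / (4 * T).
Proof.
move=> a0 b0; rewrite ler_pdivlMr ?mulr_gt0//.
have T4 : 0 < 4 * T by rewrite mulr_gt0.
rewrite -{1}(gtr0_norm T4) -normrM.
pose G t := if t <= T then 4 * T * t else if t <= 3 * T then 4 * T * t - (t - T) ^+ 2 else 8 * T ^+ 2.
pose G1 t := if t <= T then 4 * T else if t <= 3 * T then 6 * T - 2 * t else 0.
have EG t : trunc t * (4 * T) = G t.
  rewrite /trunc /G; case: ifP => _; first by rewrite mulrC.
  case: ifP => _; last by ring.
  by rewrite mulrBl mulfVK ?gt_eqF//; ring.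
have EG1 t : dtrunc t * (4 * T) = G1 t.
  rewrite /dtrunc /G1; case: ifP => _; first by rewrite mul1r.
  case: ifP => _; last by rewrite mul0r.
  by field; rewrite gt_eqF.
rewrite mulrBl mulrBl EG EG mulrAC EG1.
rewrite ler_norml /G /G1; have T00 := T0; clear EG EG1 G G1.
(* Squared distances to the break points, from which the polynomial inequalities follow case by
   case. *)
have := sqr_ge0 (b - 3 * T); have := sqr_ge0 (a - 3 * T); have := sqr_ge0 (a - T); have := sqr_ge0 (b - T); have := sqr_ge0 (b - a) => q1 q2 q3 q4 q5.
case: (leP a T) => [aT|Ta]; case: (leP b T) => [bT|Tb];
  case: (leP a (3 * T)) => [a3|a3]; case: (leP b (3 * T)) => [b3|b3];
  apply/andP; split; nra.
Qed.

Lemma trunc_big (t : R) : 3 * T <= t -> trunc t = 2 * T.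
Proof.
move=> t3; have T00 := T0; rewrite /trunc; case: ifPn => [tT|_]; first by exfalso; lra.
case: ifPn => // t3'; have -> : t = 3 * T by lra.
by field; rewrite gt_eqF.
Qed.

End truncation.

(** * Pointwise estimates of kernels and of their truncations *)

Section kernel_estimates.
Context (R : realType) (n : nat) (s lam Lam : R) (K : 'rV[R]_n -> \bar R).
Hypotheses (n0 : (0 < n)%N) (s0 : 0 < s) (s1 : s < 1) (lam0 : 0 < lam) (lamLam : lam <= Lam).
Hypothesis hK : kernel_Ls2 s lam Lam K.
Local Notation T := (lebesgueRn R n).
Local Notation mu := (lebesgue_measureRn R n).
Local Notation P := (kpow n s).

Definition kfun (w : 'rV[R]_n) : R := fine (K w).

Let Lam0 : 0 < Lam. Proof. exact: lt_le_trans lam0 lamLam. Qed.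

Lemma kfun_ge0 w : 0 <= kfun w.
Proof. by have [h _ _ _ _] := hK; exact: fine_ge0. Qed.

Lemma kfunN w : kfun (- w) = kfun w.
Proof. by rewrite /kfun; have [_ -> _ _ _] := hK. Qed.

Lemma kernel_EFin w : w != 0 -> K w = (kfun w)%:E.
Proof.
move=> w0; have [h _ /(_ w w0) /andP[_ h2] _ _] := hK.
by rewrite /kfun fineK// ge0_fin_numE// (le_lt_trans h2)// ltry.
Qed.

Lemma kfun_bounds w : w != 0 -> lam * P (enorm w) <= kfun w <= Lam * P (enorm w).
Proof.
move=> w0; have [h _ /(_ w w0) /andP[h1 h2] _ _] := hK.
by move: h1 h2; rewrite kernel_EFin// !lee_fin => -> ->.
Qed.

Lemma differentiable_kfun w : w != 0 -> differentiable kfun w.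
Proof. by move=> w0; have [_ _ _ /(_ w w0)[/nbhs_singleton]] := hK. Qed.

Lemma differentiable_grad_kfun w : w != 0 -> differentiable (grad kfun) w.
Proof. by move=> w0; have [_ _ _ /(_ w w0)[_]] := hK. Qed.

Lemma grad_kfun_le w : w != 0 -> enorm (grad kfun w) <= Lam ^+ 2 * (enorm w)^-1 * P (enorm w).
Proof.
move=> w0; have [_ _ _ _ /(_ w w0)[h _]] := hK; apply: (le_trans h).
have /andP[_ h2] := kfun_bounds w0.
rewrite (_ : Lam ^+ 2 * _ * _ = Lam * (enorm w)^-1 * (Lam * P (enorm w))); last by ring.
by rewrite ler_wpM2l// mulr_ge0 ?invr_ge0// ltW.
Qed.

Lemma hess_kfun_le w : w != 0 -> enorm ('J (grad kfun) w) <= Lam ^+ 2 * enorm w ^- 2 * P (enorm w).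
Proof.
move=> w0; have [_ _ _ _ /(_ w w0)[_ h]] := hK; apply: (le_trans h).
have /andP[_ h2] := kfun_bounds w0.
rewrite (_ : Lam ^+ 2 * _ * _ = Lam * enorm w ^- 2 * (Lam * P (enorm w))); last by ring.
by rewrite ler_wpM2l// mulr_ge0 ?invr_ge0 ?sqr_ge0// ltW.
Qed.

(** Valid for both derivatives on a segment from a of length at most |a|/2, where |w| >= |a|/2: then
    |w|^-2 <= 4 |a|^-2 and P |w| <= P 2^-1 P |a|. One factor Lam comes from the bound on the
    derivatives, the other from the upper bound on K. *)
Definition Cker : R := 4 * Lam ^+ 2 * P 2^-1.

Lemma Cker_gt0 : 0 < Cker.
Proof. by rewrite !mulr_gt0 ?exprn_gt0// kpow_gt0 // invr_gt0. Qed.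

Lemma segment_far (a p : 'rV[R]_n) (t : R) : a != 0 -> enorm p <= enorm a / 2 ->
  0 <= t <= 1 -> enorm a / 2 <= enorm (a + t *: p).
Proof.
move=> a0 pa /andP[t0 t1].
have h : enorm (t *: p) <= enorm p by rewrite enormZ ger0_norm// ler_piMl.
have := lerB_enormD a (t *: p); have h2 := enorm_ge0 a; lra.
Qed.

Lemma segment_neq0 (a p : 'rV[R]_n) (t : R) : a != 0 -> enorm p <= enorm a / 2 ->
  0 <= t <= 1 -> a + t *: p != 0.
Proof.
move=> a0 pa t01; rewrite -enorm_gt0 (lt_le_trans _ (segment_far a0 pa t01))//.
by rewrite divr_gt0// enorm_gt0.
Qed.

Lemma segment_kpow (a p : 'rV[R]_n) (t : R) : a != 0 -> enorm p <= enorm a / 2 ->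
  0 <= t <= 1 -> P (enorm (a + t *: p)) <= P 2^-1 * P (enorm a).
Proof.
move=> a0 pa t01; rewrite -kpowM ?invr_ge0// kpow_le// ?mulr_gt0 ?invr_gt0 ?enorm_gt0//.
by rewrite mulrC segment_far.
Qed.

Lemma segment_inv (a p : 'rV[R]_n) (t : R) : a != 0 -> enorm p <= enorm a / 2 ->
  0 <= t <= 1 -> (enorm (a + t *: p))^-1 <= 2 * (enorm a)^-1.
Proof.
move=> a0 pa t01; rewrite -[leRHS]invrK invfM invrK lef_pV2 ?posrE ?enorm_gt0 ?segment_neq0//.
  by rewrite mulrC segment_far.
by rewrite mulr_gt0 ?invr_gt0 ?enorm_gt0.
Qed.

Lemma grad_kfun_segment a p (t : R) : a != 0 -> enorm p <= enorm a / 2 -> 0 <= t <= 1 ->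
  enorm (grad kfun (a + t *: p)) <= Cker * (enorm a)^-1 * P (enorm a).
Proof.
move=> a0 pa t01; apply: (le_trans (grad_kfun_le (segment_neq0 a0 pa t01))).
apply: (@le_trans _ _ (Lam ^+ 2 * (2 * (enorm a)^-1) * (P 2^-1 * P (enorm a)))).
  apply: ler_pM; [by rewrite mulr_ge0 ?sqr_ge0 ?invr_ge0|exact: kpow_ge0| |exact: segment_kpow].
  by rewrite ler_wpM2l ?sqr_ge0// segment_inv.
rewrite /Cker (_ : _ * (_ * P _) = (2 * Lam ^+ 2 * P 2^-1) * ((enorm a)^-1 * P (enorm a))); last by ring.
rewrite -[leRHS]mulrA ler_wpM2r ?mulr_ge0 ?invr_ge0 ?kpow_ge0//.
by rewrite ler_wpM2r ?kpow_ge0// ler_wpM2r ?sqr_ge0// ler_nat.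
Qed.

Lemma hess_kfun_segment a p (t : R) : a != 0 -> enorm p <= enorm a / 2 -> 0 <= t <= 1 ->
  enorm ('J (grad kfun) (a + t *: p)) <= Cker * (enorm a) ^- 2 * P (enorm a).
Proof.
move=> a0 pa t01; apply: (le_trans (hess_kfun_le (segment_neq0 a0 pa t01))).
apply: (@le_trans _ _ (Lam ^+ 2 * (2 * (enorm a)^-1) ^+ 2 * (P 2^-1 * P (enorm a)))).
  apply: ler_pM; [by rewrite mulr_ge0 ?sqr_ge0 ?invr_ge0 ?sqr_ge0|exact: kpow_ge0| |exact: segment_kpow].
  by rewrite ler_wpM2l ?sqr_ge0// -exprVn ler_pXn2r ?nnegrE ?mulr_ge0 ?invr_ge0// segment_inv.
rewrite le_eqVlt; apply/orP; left; apply/eqP; rewrite /Cker exprMn exprVn; ring.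
Qed.

Lemma kfun_lip a p : a != 0 -> enorm p <= enorm a / 2 ->
  `|kfun (a + p) - kfun a| <= Cker * (enorm a)^-1 * P (enorm a) * enorm p.
Proof.
move=> a0 pa; apply: lip_line => t t01; last exact: grad_kfun_segment.
exact/differentiable_kfun/segment_neq0.
Qed.

Lemma kfun_taylor a p : a != 0 -> enorm p <= enorm a / 2 ->
  `|kfun (a + p) - kfun a - dot (grad kfun a) p| <=
  Cker * (enorm a) ^- 2 * P (enorm a) * enorm p ^+ 2.
Proof.
move=> a0 pa; apply: taylor_line => t t01; first exact/differentiable_kfun/segment_neq0.
have /andP[t0 t1] := t01.
have tp : enorm (t *: p) <= enorm p by rewrite enormZ ger0_norm// ler_piMl.
apply: (@le_trans _ _ (Cker * enorm a ^- 2 * P (enorm a) * enorm (t *: p))); last first.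
  by rewrite ler_wpM2l// !mulr_ge0 ?kpow_ge0 ?invr_ge0 ?sqr_ge0// ltW// Cker_gt0.
apply: lip_line_vec => r r01.
  by apply: differentiable_grad_kfun; apply: segment_neq0 => //; exact: le_trans pa.
by apply: hess_kfun_segment => //; exact: le_trans pa.
Qed.

Lemma open_neq0 : open [set w : 'rV[R]_n | w != 0].
Proof.
rewrite (_ : mkset _ = ~` [set y | enorm (y - 0) <= 0]).
  by apply: closed_openC; exact: closed_enorm_le.
by apply/seteqP; split=> w /=; rewrite subr0 -enorm_gt0 ltNge => /negP.
Qed.

Lemma measurable_kfun : measurable_fun ([set w | w != 0] : set T) kfun.
Proof.
apply: measurable_fun_continuousRn; first exact: open_neq0.
by move=> w w0; apply: differentiable_continuous; exact: differentiable_kfun.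
Qed.

Lemma measurable_kfun_ge r : 0 < r -> measurable_fun ([set w | r <= enorm w] : set T) kfun.
Proof.
move=> r0; apply: (measurable_funS _ _ measurable_kfun).
  exact: open_measurableRn open_neq0.
by move=> w /= rw; rewrite -enorm_gt0 (lt_le_trans r0).
Qed.

Section truncated_kernel.
Variable (t r1 B : R).
Hypotheses (t0 : 0 < t) (r10 : 0 < r1).

(* The value at 0 is the one forced by continuity, since K is unbounded near 0;
   K 0 itself is arbitrary. *)
Definition tker (w : 'rV[R]_n) : R := if w == 0 then 2 * t else trunc t (kfun w).

Lemma tkerN w : tker (- w) = tker w.
Proof. by rewrite /tker oppr_eq0 kfunN. Qed.

Lemma tker_bounds w : 0 <= tker w <= 2 * t.
Proof.
rewrite /tker; case: ifP => _; first by rewrite lexx andbT mulr_ge0// ltW.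
by have [-> _ -> _] := trunc_bounds t0 (kfun_ge0 w).
Qed.

Lemma tker_le w : w != 0 -> tker w <= kfun w.
Proof.
by move=> w0; rewrite /tker (negbTE w0); have [_ -> _ _] := trunc_bounds t0 (kfun_ge0 w).
Qed.

Lemma tker_far w : w != 0 -> kfun w <= t -> tker w = kfun w.
Proof. by move=> w0 wt; rewrite /tker (negbTE w0) /trunc wt. Qed.

Lemma measurable_trunc : measurable_fun [set: R] (trunc t).
Proof.
have mid : measurable_fun [set: R] (fun x : R => x) by exact: measurable_id.
have mc (c : R) : measurable_fun [set: R] (fun=> c) by exact: measurable_cst.
apply: measurable_fun_ifT; [exact: measurable_fun_ler|exact: mid|].
apply: measurable_fun_ifT; [exact: measurable_fun_ler| |exact: mc].
apply: measurable_funB; first exact: mid.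
apply: measurable_funM; last exact: mc.
by apply: measurable_funX; apply: measurable_funB; [exact: mid|exact: mc].
Qed.

Lemma measurable_tker : measurable_fun [set: T] tker.
Proof.
have mn0 : measurable ([set w | w != 0] : set T) by exact: open_measurableRn open_neq0.
have E : [set: T] `&` (fun w : 'rV[R]_n => w == 0) @^-1` [set false] = [set w | w != 0].
  by rewrite setTI; apply/seteqP; split=> w /=; case: (w == 0).
apply: measurable_fun_if.
- exact: measurableT.
- by apply: (@measurable_fun_bool _ _ _ _ false); rewrite E.
- exact: measurable_cst.
- rewrite E; apply: (@measurableT_comp _ _ _ _ _ _ (trunc t)); first exact: measurable_trunc.
  exact: measurable_kfun.
Qed.

(** The first summand is the curvature of the truncation, of order 1/t, against the squared gradient
    of K, with B bounding P r1 / t; the second is the Hessian of K. The 4 turns |a|^-2 into r1^-2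
    for |a| >= r1/2. *)
Definition CD2 : R := 4 * (Cker ^+ 2 * P 2^-1 * B / 4 + Cker).

(** In the ball of radius r1 the kernel is at least 3t, so its truncation is constant there, and the
    shifts do not lead out of that ball. *)
Lemma tker_D2_near a p q : 3 * t <= lam * P r1 -> enorm a < r1 / 2 ->
  enorm p <= r1 / 4 -> enorm q <= r1 / 4 ->
  tker (a + p) + tker (a + q) - 2 * tker a = 0.
Proof.
move=> tr ar pr qr.
have near w : enorm w < r1 -> tker w = 2 * t.
  rewrite /tker; case: ifPn => // w0 wr; apply: trunc_big => //.
  have /andP[h _] := kfun_bounds w0; apply: le_trans h; apply: (le_trans tr).
  by rewrite ler_pM2l// kpow_le ?enorm_gt0// ltW.
have r10' := r10.
have h1 := ler_enormD a p; have h2 := ler_enormD a q.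
by rewrite !near; [ring|lra|lra|lra].
Qed.

(** Chain rule with remainder: the Taylor error of [trunc], quadratic in the increment of K, plus
    [dtrunc] times the Taylor error of K. *)
Lemma tker_expand a p : P r1 <= B * t -> r1 / 2 <= enorm a -> enorm p <= r1 / 4 ->
  `|tker (a + p) - tker a - dtrunc t (kfun a) * dot (grad kfun a) p| <=
  (Cker ^+ 2 * P 2^-1 * B / 4 + Cker) * enorm a ^- 2 * P (enorm a) * enorm p ^+ 2.
Proof.
move=> rB ar pr.
have a0 : a != 0 by rewrite -enorm_gt0 (lt_le_trans _ ar)// divr_gt0.
have pa : enorm p <= enorm a / 2 by have := ar; have := pr; lra.
have ap0 : a + p != 0.
  by have := segment_neq0 a0 pa (t := 1); rewrite scale1r; apply; rewrite ler01 lexx.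
have /andP[d0 d1] := dtrunc_bounds t0 (kfun_ge0 a).
rewrite /tker (negbTE a0) (negbTE ap0).
have e1 := trunc_taylor t0 (kfun_ge0 a) (kfun_ge0 (a + p)).
have e2 := kfun_taylor a0 pa.
have e3 := kfun_lip a0 pa.
set d := dtrunc t (kfun a) in d0 d1 e1 *.
set g := dot _ p in e2 *.
set D := kfun (a + p) - kfun a in e1 e2 e3 *.
rewrite (_ : _ - d * g = (trunc t (kfun (a + p)) - trunc t (kfun a) - d * D) + d * (D - g)); last by ring.
apply: (le_trans (ler_normD _ _)); rewrite normrM (ger0_norm d0).
rewrite [leRHS](_ : _ = Cker ^+ 2 * P 2^-1 * B / 4 * enorm a ^- 2 * P (enorm a) * enorm p ^+ 2 +
   Cker * enorm a ^- 2 * P (enorm a) * enorm p ^+ 2); last by ring.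
apply: lerD; last by apply: (le_trans _ e2); rewrite ler_piMl.
apply: (le_trans e1); rewrite ler_pdivrMr ?mulr_gt0//.
have P0 : 0 < P (enorm a) by rewrite kpow_gt0// enorm_gt0.
(* One of the two factors P |a| in the squared increment of K is traded for t, which cancels the 1/t
   from the curvature of [trunc]. *)
have PB : P (enorm a) <= P 2^-1 * (B * t).
  apply: (@le_trans _ _ (P 2^-1 * P r1)); last by rewrite ler_pM2l// kpow_gt0// invr_gt0.
  by rewrite -kpowM ?invr_ge0 ?(ltW r10)// kpow_le// ?mulr_gt0 ?invr_gt0// mulrC.
rewrite -[leLHS]real_normK ?num_real//.
apply: (@le_trans _ _ ((Cker * (enorm a)^-1 * P (enorm a) * enorm p) ^+ 2)).
  by rewrite ler_pXn2r ?nnegrE// (le_trans _ e3).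
rewrite [leLHS](_ : _ = Cker ^+ 2 * enorm a ^- 2 * P (enorm a) * enorm p ^+ 2 * P (enorm a)); last by rewrite !exprMn exprVn; ring.
rewrite [leRHS](_ : _ = Cker ^+ 2 * enorm a ^- 2 * P (enorm a) * enorm p ^+ 2 * (P 2^-1 * (B * t))); last first.
  by field; rewrite enorm_eq0.
have C2 : 0 <= Cker ^+ 2 := sqr_ge0 _.
by rewrite ler_wpM2l// mulr_ge0 ?sqr_ge0// mulr_ge0 ?(ltW P0)// mulr_ge0 ?C2// invr_ge0 sqr_ge0.
Qed.

(* The first-order terms of the two expansions add up to a multiple of p + q,
   which is why the bound is only linear in enorm (p + q). *)
Lemma tker_D2_far a p q : 0 <= B -> P r1 <= B * t -> r1 / 2 <= enorm a ->
  enorm p <= r1 / 4 -> enorm q <= r1 / 4 ->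
  `|tker (a + p) + tker (a + q) - 2 * tker a| <=
  CD2 * (enorm (p + q) / r1 + (enorm p ^+ 2 + enorm q ^+ 2) / r1 ^+ 2) * P (enorm a).
Proof.
move=> B0 rB ar pr qr.
have a0 : 0 < enorm a by rewrite (lt_le_trans _ ar)// divr_gt0.
have a0' : a != 0 by rewrite -enorm_gt0.
have ep := tker_expand rB ar pr; have eq' := tker_expand rB ar qr.
have /andP[d0 d1] := dtrunc_bounds t0 (kfun_ge0 a).
set d := dtrunc t (kfun a) in d0 d1 ep eq'.
rewrite (_ : _ - _ = (tker (a + p) - tker a - d * dot (grad kfun a) p) +
  ((tker (a + q) - tker a - d * dot (grad kfun a) q) + d * dot (grad kfun a) (p + q))); last first.
  by rewrite dotDr; ring.
have P0 : 0 < P (enorm a) by rewrite kpow_gt0.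
have P2 : 0 < P 2^-1 by rewrite kpow_gt0// invr_gt0.
have C0 := Cker_gt0.
set E := Cker ^+ 2 * P 2^-1 * B / 4 + Cker in ep eq'.
have CE : Cker <= E by rewrite lerDr divr_ge0// !mulr_ge0 ?sqr_ge0// ltW.
have E0 : 0 < E := lt_le_trans C0 CE.
have i1 : (enorm a)^-1 <= 2 / r1.
  by rewrite -[leRHS]invrK invfM invrK lef_pV2 ?posrE// ?mulr_gt0 ?invr_gt0// mulrC.
have i2 : enorm a ^- 2 <= 4 / r1 ^+ 2.
  rewrite -exprVn (_ : 4 / r1 ^+ 2 = (2 / r1) ^+ 2); last by rewrite exprMn exprVn; congr (_ * _); ring.
  by rewrite ler_pXn2r ?nnegrE ?invr_ge0 ?divr_ge0 ?(ltW r10).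
have h3 : `|d * dot (grad kfun a) (p + q)| <= E * (2 / r1) * P (enorm a) * enorm (p + q).
  rewrite normrM (ger0_norm d0); apply: (@le_trans _ _ `|dot (grad kfun a) (p + q)|).
    by rewrite ler_piMl.
  apply: (le_trans (dot_le _ _)); rewrite ler_wpM2r//.
  have := @grad_kfun_segment a p 0 a0'; rewrite scale0r addr0 lexx ler01 => h.
  apply: (le_trans (h _ isT)); first by have := ar; have := pr; lra.
  rewrite ler_pM2r// ler_pM ?invr_ge0//; exact: ltW.
have hx (x : 'rV[R]_n) : E * enorm a ^- 2 * P (enorm a) * enorm x ^+ 2 <= E * (4 / r1 ^+ 2) * P (enorm a) * enorm x ^+ 2.
  by rewrite ler_wpM2r ?sqr_ge0// ler_wpM2r ?(ltW P0)// ler_wpM2l// ltW.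
apply: (le_trans (ler_normD _ _)).
apply: (@le_trans _ _ (E * (4 / r1 ^+ 2) * P (enorm a) * enorm p ^+ 2 +
  (E * (4 / r1 ^+ 2) * P (enorm a) * enorm q ^+ 2 + E * (2 / r1) * P (enorm a) * enorm (p + q)))).
  apply: lerD; first exact: le_trans (hx p).
  apply: (le_trans (ler_normD _ _)); apply: lerD; first exact: le_trans (hx q).
  exact: h3.
rewrite -subr_ge0 /CD2 -/E [X in 0 <= X](_ : _ = 2 * E * P (enorm a) * enorm (p + q) / r1); last by ring.
by rewrite divr_ge0 ?(ltW r10)// !mulr_ge0// ltW.
Qed.

End truncated_kernel.
End kernel_estimates.

(** * Nonlocal operators on quadratic patches *)

Section integral_Rn.
Context (R : realType) (n : nat).
Local Notation T := (lebesgueRn R n).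
Local Notation mu := (lebesgue_measureRn R n).
Implicit Types (D : set 'rV[R]_n) (f g : 'rV[R]_n -> R).

(** These wrappers fix the Lebesgue sigma-algebra on row vectors, so that statements can be made
    about plain sets and functions. *)
Definition mfunRn D f : Prop := measurable_fun (D : set T) f.
Definition intgRn D f : Prop := mu.-integrable (D : set T) (EFin \o f : T -> \bar R).
Definition intRn D f : R := Rintegral mu (D : set T) f.

Lemma intgRn_mfun D f : intgRn D f -> mfunRn D f.
Proof. by move=> /measurable_int/measurable_EFinP. Qed.

Lemma intgRn_le D f g : measurable (D : set T) -> mfunRn D f ->
  (forall x, D x -> `|f x| <= g x) -> intgRn D g -> intgRn D f.
Proof.
move=> mD mf fg ig; apply: (le_integrable mD _ _ ig); first exact/measurable_EFinP.
by move=> x Dx; rewrite lee_fin (le_trans (fg x Dx))// ler_norm.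
Qed.

Lemma intgRnS D E f : measurable (E : set T) -> measurable (D : set T) -> D `<=` E ->
  intgRn E f -> intgRn D f.
Proof. by move=> mE mD DE; exact: integrableS. Qed.

Lemma intgRn_ge0 D f (c : R) : measurable (D : set T) -> mfunRn D f -> (forall x, D x -> 0 <= f x) ->
  (\int[mu]_(x in D) (f x)%:E <= c%:E)%E -> intgRn D f /\ 0 <= intRn D f <= c.
Proof.
move=> mD mf f0 fc; have i0 : (0 <= \int[mu]_(x in D) (f x)%:E)%E.
  by apply: integral_ge0 => x Dx; rewrite lee_fin f0.
have ify : (\int[mu]_(x in D) (f x)%:E)%E \is a fin_num.
  by rewrite ge0_fin_numE// (le_lt_trans fc)// ltry.
split.
  apply/integrableP; split; first exact/measurable_EFinP.
  rewrite (eq_integral (fun x : T => (f x)%:E)); first by rewrite (le_lt_trans fc)// ltry.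
  by move=> x; rewrite inE => Dx /=; rewrite ger0_norm// f0.
by rewrite /intRn /Rintegral -!lee_fin fineK// i0 fc.
Qed.

Lemma intRn_ge0 D f : (forall x, D x -> 0 <= f x) -> 0 <= intRn D f.
Proof. by move=> f0; apply: Rintegral_ge0. Qed.

Lemma intgRnD D f g : measurable (D : set T) -> intgRn D f -> intgRn D g -> intgRn D (fun x => f x + g x).
Proof. by move=> mD if' ig; apply: (integrableD mD if' ig). Qed.

Lemma intgRnZ D f c : measurable (D : set T) -> intgRn D f -> intgRn D (fun x => c * f x).
Proof. by move=> mD if'; have := integrableZl mD c if'. Qed.

Lemma intgRnB D f g : measurable (D : set T) -> intgRn D f -> intgRn D g -> intgRn D (fun x => f x - g x).
Proof. by move=> mD if' ig; apply: (integrableB mD if' ig). Qed.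

Lemma intRnD D f g : measurable (D : set T) -> intgRn D f -> intgRn D g ->
  intRn D (fun x => f x + g x) = intRn D f + intRn D g.
Proof. by move=> mD if' ig; exact: (RintegralD mD if' ig). Qed.

Lemma intRnB D f g : measurable (D : set T) -> intgRn D f -> intgRn D g ->
  intRn D (fun x => f x - g x) = intRn D f - intRn D g.
Proof. by move=> mD if' ig; exact: (RintegralB mD if' ig). Qed.

Lemma intRnZ D f c : measurable (D : set T) -> intgRn D f ->
  intRn D (fun x => c * f x) = c * intRn D f.
Proof. by move=> mD if'; exact: (RintegralZl c mD if'). Qed.

Lemma eq_intRn D f g : (forall x, D x -> f x = g x) -> intRn D f = intRn D g.
Proof. by move=> fg; apply: eq_Rintegral => x; rewrite inE => /fg. Qed.

Lemma le_intRn D f g : measurable (D : set T) -> intgRn D f -> intgRn D g ->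
  (forall x, D x -> f x <= g x) -> intRn D f <= intRn D g.
Proof. by move=> mD if' ig; exact: (le_Rintegral mD if' ig). Qed.

Lemma intRn_setU D E f : measurable (D : set T) -> measurable (E : set T) ->
  intgRn (D `|` E) f -> (forall x, D x -> ~ E x) ->
  intRn (D `|` E) f = intRn D f + intRn E f.
Proof.
move=> mD mE if' dDE; apply: (Rintegral_setU mD mE if').
by apply/disj_setPS => x [/= /dDE].
Qed.

Lemma intgRn_setU D E f : measurable (D : set T) -> measurable (E : set T) ->
  intgRn D f -> intgRn E f -> (forall x, D x -> ~ E x) -> intgRn (D `|` E) f.
Proof.
move=> mD mE if' ig dDE; have mf : measurable_fun (D `|` E : set T) (EFin \o f : T -> \bar R).
  by apply/measurable_funU => //; split; apply/measurable_EFinP; exact: intgRn_mfun.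
apply/integrableP; split; first exact: mf.
rewrite (@ge0_integral_setU _ T R mu D E mD mE (fun x => `|(f x)%:E|%E)).
- move/integrableP : if' => [_ h1]; move/integrableP : ig => [_ h2].
  exact: lte_add_pinfty.
- by apply: measurableT_comp => //; exact: mf.
- by [].
- by apply/disj_setPS => x [/= /dDE].
Qed.

Lemma sigma_intgRn a b D f : measurable (D : set T) -> intgRn D f ->
  intgRn (sigma_map a b @^-1` D) (fun x => f (sigma_map a b x)).
Proof.
move=> mD /integrableP[/measurable_EFinP mf ify]; apply/integrableP; split.
  by apply/measurable_EFinP; exact: measurable_fun_sigma.
have mg : measurable_fun (D : set T) (fun x : T => `|(f x)%:E|%E).
  by apply/measurable_EFinP; exact: measurableT_comp.
by rewrite (esym (@ge0_integral_sigma _ _ a b D _ mD mg (fun y _ => abse_ge0 (f y)%:E))).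
Qed.

Lemma sigma_intRn a b D f : measurable (D : set T) -> mfunRn D f ->
  intRn D f = intRn (sigma_map a b @^-1` D) (fun x => f (sigma_map a b x)).
Proof.
move=> mD /measurable_EFinP mf; congr fine.
exact: (@integral_sigma _ _ a b D (fun x => (f x)%:E) mD mf).
Qed.

Lemma intRn_translation (b : 'rV[R]_n) f : mfunRn setT f ->
  intRn setT f = intRn setT (fun x => f (x + b)).
Proof.
move=> mf; rewrite (sigma_intRn false b measurableT mf) preimage_setT.
by apply: eq_intRn => x _; rewrite /sigma_map expr0 scale1r.
Qed.

Lemma mfunRn_translation (b : 'rV[R]_n) f D : mfunRn setT f -> mfunRn D (fun x => f (x + b)).
Proof.
move=> mf; apply: (@measurable_funTS _ _ T).
have := @measurable_fun_sigma R n false b setT _ _ f measurableT mf.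
rewrite preimage_setT; congr measurable_fun; apply/funext => w.
by rewrite /sigma_map expr0 scale1r.
Qed.

End integral_Rn.

(** * Integrals against a kernel, away from the origin and near it *)

Section kernel_integrals.
Context (R : realType) (n : nat) (s lam Lam : R) (K : 'rV[R]_n -> \bar R).
Hypotheses (n0 : (0 < n)%N) (s0 : 0 < s) (s1 : s < 1) (lam0 : 0 < lam) (lamLam : lam <= Lam).
Hypothesis hK : kernel_Ls2 s lam Lam K.
Local Notation T := (lebesgueRn R n).
Local Notation mu := (lebesgue_measureRn R n).
Local Notation P := (kpow n s).
Local Notation k := (kfun K).

Definition ext (d : R) : set 'rV[R]_n := [set w | d <= enorm w].
Definition shell (e d : R) : set 'rV[R]_n := [set w | e <= enorm w < d].

Lemma measurable_ext d : measurable (ext d : set T).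
Proof. exact: measurable_enorm_ge. Qed.

Lemma measurable_shell e d : measurable (shell e d : set T).
Proof. exact: measurable_enorm_shell. Qed.

Lemma ext_neq0 d w : 0 < d -> ext d w -> w != 0.
Proof. by move=> d0 /= dw; rewrite -enorm_gt0 (lt_le_trans d0). Qed.

Lemma shell_ext e d : shell e d `<=` ext e.
Proof. by move=> w /= /andP[]. Qed.

Lemma extU e d : e <= d -> ext e = shell e d `|` ext d.
Proof.
move=> ed; apply/seteqP; split=> w /=; last by move=> [/andP[]//|]; exact: le_trans.
by move=> ew; case: (ltP (enorm w) d) => wd; [left; apply/andP|right].
Qed.

Lemma shell_ext_disj e d w : shell e d w -> ~ ext d w.
Proof. by move=> /= /andP[_ wd] dw; move: wd; rewrite ltNge dw. Qed.

Let Lam0 : 0 < Lam. Proof. exact: lt_le_trans lam0 lamLam. Qed.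

Lemma mfun_kfun d : 0 < d -> mfunRn (ext d) k.
Proof. by move=> d0; exact: (measurable_kfun_ge hK d0). Qed.

Lemma kpow_tail d : 0 < d ->
  intgRn (ext d) (fun w => P (enorm w)) /\
  0 <= intRn (ext d) (fun w => P (enorm w)) <= Ctail n s * (d ^+ n * P d).
Proof.
move=> d0; apply: intgRn_ge0; [exact: measurable_ext|exact: kpow_measurable| |].
  by move=> w _; exact: kpow_ge0.
exact: integral_tail_le.
Qed.

Lemma kfun_tail d : 0 < d -> intgRn (ext d) k.
Proof.
move=> d0; have [ip _] := kpow_tail d0; have md := measurable_ext d.
apply: (intgRn_le md (mfun_kfun d0) _ (intgRnZ Lam md ip)) => w dw.
rewrite ger0_norm ?(kfun_ge0 hK)//.
by have /andP[_] := kfun_bounds hK (ext_neq0 d0 dw).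
Qed.

Lemma bounded_kfun g d (M : R) : 0 < d -> mfunRn (ext d) g ->
  (forall w, ext d w -> `|g w| <= M) -> intgRn (ext d) (fun w => g w * k w).
Proof.
move=> d0 mg gM; have md := measurable_ext d.
apply: (intgRn_le md _ _ (intgRnZ M md (kfun_tail d0))).
  by apply: measurable_funM; [exact: mg|exact: mfun_kfun].
move=> w dw; rewrite normrM (ger0_norm (kfun_ge0 hK w)) ler_wpM2r ?(kfun_ge0 hK)//.
exact: gM.
Qed.

Definition Cc : R := Lam * Ccore n s.

Lemma Cc_gt0 : 0 < Cc.
Proof. by rewrite mulr_gt0// Ccore_gt0. Qed.

Lemma kfun_core (e d : R) : 0 < e -> 0 < d ->
  intgRn (shell e d) (fun w => enorm w ^+ 2 * k w) /\
  0 <= intRn (shell e d) (fun w => enorm w ^+ 2 * k w) <= Cc * (d ^+ n.+2 * P d).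
Proof.
move=> e0 d0; have md := measurable_shell e d.
have [ip /andP[_ hp]] : intgRn (shell e d) (fun w => enorm w ^+ 2 * P (enorm w)) /\
  0 <= intRn (shell e d) (fun w => enorm w ^+ 2 * P (enorm w)) <= Ccore n s * (d ^+ n.+2 * P d).
  apply: intgRn_ge0; [exact: md| | |exact: (integral_core_le n s0 s1 e0 d0)].
    apply: measurable_funM; last exact: kpow_measurable.
    by apply: measurable_funX; exact: measurable_enorm.
  by move=> w _; rewrite mulr_ge0 ?sqr_ge0 ?kpow_ge0.
have b w : shell e d w -> `|enorm w ^+ 2 * k w| <= Lam * (enorm w ^+ 2 * P (enorm w)).
  move=> /shell_ext ew; rewrite ger0_norm ?mulr_ge0 ?sqr_ge0 ?(kfun_ge0 hK)//.
  rewrite mulrCA ler_wpM2l ?sqr_ge0//.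
  by have /andP[_] := kfun_bounds hK (ext_neq0 e0 ew).
have ik : intgRn (shell e d) (fun w => enorm w ^+ 2 * k w).
  apply: (intgRn_le md _ b (intgRnZ Lam md ip)).
  apply: measurable_funM; first by apply: measurable_funX; exact: measurable_enorm.
  apply: (measurable_funS (measurable_ext e) _ (mfun_kfun e0)); exact: shell_ext.
split=> //; apply/andP; split.
  by apply: intRn_ge0 => w _; rewrite mulr_ge0 ?sqr_ge0 ?(kfun_ge0 hK).
apply: (@le_trans _ _ (Lam * intRn (shell e d) (fun w => enorm w ^+ 2 * P (enorm w)))).
  rewrite -(intRnZ _ md ip); apply: le_intRn => //; first exact: intgRnZ.
  by move=> w /b; apply: le_trans; exact: ler_norm.
by rewrite /Cc -mulrA ler_pM2l.
Qed.

Lemma mfun_dot (D : set 'rV[R]_n) p : mfunRn D (fun w => dot p w).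
Proof.
apply: (@measurable_funTS _ _ T); apply: measurable_fun_continuousRn; first exact: openT.
move=> x _; rewrite (_ : (fun w => dot p w) = dotr p); first exact: dotr_continuous.
by apply/funext => w; rewrite /dotr dotC.
Qed.

(** The reflection w -> - w preserves the shell and reverses the sign of the integrand. It serves
    both for K and for K minus its truncation. *)
Lemma shell_odd (f : 'rV[R]_n -> R) (e d : R) p : 0 < d -> (forall w, f (- w) = f w) ->
  intgRn (shell e d) f ->
  intgRn (shell e d) (fun w => dot p w * f w) /\ intRn (shell e d) (fun w => dot p w * f w) = 0.
Proof.
move=> d0 fN if'; have md := @measurable_shell e d.
have mf : mfunRn (shell e d) (fun w => dot p w * f w).
  by apply: measurable_funM; [exact: mfun_dot|exact: intgRn_mfun].
have iaf : intgRn (shell e d) (fun w => `|f w|).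
  by have := integrable_abse if'.
have ig : intgRn (shell e d) (fun w => dot p w * f w).
  apply: (intgRn_le md mf _ (intgRnZ (enorm p * d) md iaf)) => w /= /andP[_ wd].
  rewrite normrM ler_wpM2r//.
  by rewrite (le_trans (dot_le _ _))// ler_wpM2l// ltW.
have sN (w : 'rV[R]_n) : sigma_map true 0 w = - w by rewrite /sigma_map addr0 expr1 scaleN1r.
split=> //.
have := sigma_intRn true 0 md mf.
have -> : sigma_map true 0 @^-1` (shell e d : set 'rV[R]_n) = shell e d.
  by apply/seteqP; split=> w; rewrite /preimage/shell/= sN enormN.
have -> : intRn (shell e d) (fun x => dot p (sigma_map true 0 x) * f (sigma_map true 0 x)) =
    - intRn (shell e d) (fun w => dot p w * f w).
  rewrite -mulN1r -(intRnZ _ md ig); apply: eq_intRn => w _.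
  by rewrite sN dotNr fN mulN1r mulNr.
move=> h; lra.
Qed.

Lemma kfun_odd (e d : R) p : 0 < e -> 0 < d ->
  intgRn (shell e d) (fun w => dot p w * k w) /\ intRn (shell e d) (fun w => dot p w * k w) = 0.
Proof.
move=> e0 d0; apply: shell_odd => //; first exact: kfunN hK.
apply: (intgRnS (@measurable_ext e) (@measurable_shell e d) _ (kfun_tail e0)); exact: shell_ext.
Qed.

(** The integrals grow as e decreases to 0 and stay below the core bound. The principal value on a
    paraboloid reduces to this limit. *)
Lemma kfun_core_lim (d : R) : 0 < d -> exists2 S : R, 0 <= S <= Cc * (d ^+ n.+2 * P d) &
  (fun e => intRn (shell e d) (fun w => enorm w ^+ 2 * k w)) @ 0^'+ --> S.
Proof.
move=> d0; pose f (e : R) := intRn (shell e d) (fun w => enorm w ^+ 2 * k w).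
rewrite -/f; have bf (e : R) : 0 < e -> 0 <= f e <= Cc * (d ^+ n.+2 * P d).
  by move=> e0; have [] := kfun_core e0 d0.
have nf : {in Interval (BRight 0) (BLeft d) &, nonincreasing_fun f}.
  move=> e1 e2; rewrite !in_itv/= => /andP[e10 _] /andP[e20 _] e12.
  have [i1 _] := kfun_core e10 d0; have [i2 _] := kfun_core e20 d0.
  case: (leP d e2) => de2.
    have -> : f e2 = 0.
      rewrite /f (_ : shell e2 d = set0); first exact: Rintegral_set0.
      by apply/seteqP; split=> w //= /andP[h1 h2]; move: (le_lt_trans h1 h2); rewrite ltNge de2.
    by have /andP[] := bf _ e10.
  have E : shell e1 d = shell e1 e2 `|` shell e2 d.
    apply/seteqP; split=> w /=.
      move=> /andP[h1 h2]; case: (ltP (enorm w) e2) => h3; [left|right]; exact/andP.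
    by move=> [/andP[h1 h2]|/andP[h1 h2]]; apply/andP; split=> //; [exact: lt_trans de2|exact: le_trans h1].
  rewrite /f E intRn_setU; [|exact: measurable_shell|exact: measurable_shell|by rewrite -E|]; last first.
    by move=> w /= /andP[_ h] /andP[h' _]; move: h; rewrite ltNge h'.
  rewrite lerDr; apply: intRn_ge0 => w _.
  by rewrite mulr_ge0 ?sqr_ge0 ?(kfun_ge0 hK).
have ub : has_ubound (f @` [set` Interval (BRight 0) (BLeft d)]).
  exists (Cc * (d ^+ n.+2 * P d)) => y [e ein <-]; move: ein; rewrite /= in_itv/= => /andP[e0 _].
  by have /andP[] := bf _ e0.
have := @nonincreasing_at_right_cvgr _ f 0 (BLeft d) _ nf ub; rewrite bnd_simp => /(_ d0) h.
eexists; last exact: h.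
have fd2 : 0 <= f (d / 2) <= Cc * (d ^+ n.+2 * P d) by apply: bf; rewrite divr_gt0.
have in2 : (f @` [set` Interval (BRight 0) (BLeft d)]) (f (d / 2)).
  by exists (d / 2) => //=; rewrite in_itv/= divr_gt0//= ltr_pdivrMr// ltr_pMr// ltr1n.
apply/andP; split.
  have /andP[f0 _] := fd2; apply: (le_trans f0); exact: ub_le_sup.
apply: ge_sup; first by exists (f (d / 2)).
move=> y [e ein <-]; move: ein; rewrite /= in_itv/= => /andP[e0 _].
by have /andP[] := bf _ e0.
Qed.

End kernel_integrals.

Section quadratic_patches.
Context (R : realType) (n : nat).

Definition eball_at (x : 'rV[R]_n) (r : R) : set 'rV[R]_n := [set y | enorm (y - x) < r].

Lemma mfun_quadratic q x c e : mfunRn setT (@quadratic R n q x c e).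
Proof.
apply: measurable_fun_continuousRn; first exact: openT.
by move=> y _; apply: differentiable_continuous; exact: differentiable_quadratic.
Qed.

Lemma mfun_patch (u : 'rV[R]_n -> R) x0 (d : R) q x b c : mfunRn setT u ->
  mfunRn setT (patch u (eball_at x0 d) (quadratic q x c b)).
Proof.
move=> mu_; apply: measurable_fun_ifT; [|exact: mfun_quadratic|exact: mu_].
apply: (@measurable_fun_bool _ _ _ _ true); rewrite setTI.
rewrite (_ : _ @^-1` _ = eball_at x0 d); first by apply: open_measurableRn; exact: open_enorm_lt.
by apply/seteqP; split=> y /= => [/set_mem|/mem_set].
Qed.

End quadratic_patches.

Section operator_on_quadratics.
Context (R : realType) (n : nat) (s lam Lam : R) (K : 'rV[R]_n -> \bar R).
Hypotheses (n0 : (0 < n)%N) (s0 : 0 < s) (s1 : s < 1) (lam0 : 0 < lam) (lamLam : lam <= Lam).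
Hypothesis hK : kernel_Ls2 s lam Lam K.
Local Notation T := (lebesgueRn R n).
Local Notation mu := (lebesgue_measureRn R n).
Local Notation P := (kpow n s).
Local Notation k := (kfun K).
Variables (u : 'rV[R]_n -> R) (M : R).
Hypotheses (mu_ : mfunRn setT u) (uM : forall x, `|u x| <= M).
Variables (x0 p : 'rV[R]_n) (b d : R).
Hypothesis d0 : 0 < d.

Let W := patch u (eball_at x0 d) (quadratic p x0 (u x0) b).

Let W_in w : enorm w < d -> W (w + x0) = u x0 + dot p w + b * enorm w ^+ 2.
Proof.
move=> wd; rewrite /W /patch mem_set; last by rewrite /eball_at /= addrK.
by rewrite /quadratic addrK.
Qed.

Let W_out w : ext d w -> W (w + x0) = u (w + x0).
Proof.
move=> wd; rewrite /W /patch memNset//; rewrite /eball_at /= addrK => h.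
by move: h; rewrite ltNge wd.
Qed.

Let W0 : W x0 = u x0.
Proof. by have := @W_in 0; rewrite add0r enorm0 => ->//; rewrite -(scale0r p) dotZr mul0r expr0n/= mulr0 !addr0. Qed.

Let mW : mfunRn setT W.
Proof. exact: mfun_patch. Qed.

Let G w := (u x0 - W (w + x0)) * k w.

Let intgG (e : R) : 0 < e -> intgRn (ext e) G.
Proof.
move=> e0; apply: (bounded_kfun s0 hK (M := 2 * M + enorm p * d + `|b| * d ^+ 2) e0).
  apply: measurable_funB; first exact: measurable_cst.
  exact: mfunRn_translation mW.
move=> w _; have ux := uM x0; have pd : 0 <= enorm p * d by rewrite mulr_ge0// ltW.
have bd : 0 <= `|b| * d ^+ 2 by rewrite mulr_ge0 ?sqr_ge0.
case: (ltP (enorm w) d) => wd; last first.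
  rewrite W_out// (le_trans (ler_normB _ _))//; have := uM (w + x0); lra.
rewrite W_in// opprD opprD addrA addrA subrr sub0r -opprD normrN (le_trans (ler_normD _ _))//.
have M0 : 0 <= M := le_trans (normr_ge0 _) ux.
have h1 : `|dot p w| <= enorm p * d by rewrite (le_trans (dot_le _ _))// ler_wpM2l// ltW.
have h2 : `|b * enorm w ^+ 2| <= `|b| * d ^+ 2.
  by rewrite normrM ler_wpM2l// ger0_norm ?sqr_ge0// ler_pXn2r ?nnegrE// ltW.
lra.
Qed.

Let Lop_trunc (e : R) : 0 < e ->
  (\int[mu]_(y in [set y : 'rV[R]_n | (e <= enorm (x0 - y))%R]) ((W x0 - W y)%:E * K (x0 - y)%R))%E =
  (intRn (ext e) G)%:E.
Proof.
move=> e0; have ig := intgG e0; have me := @measurable_ext R n e.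
have fG := @integrable_fin_num _ T R mu (ext e) me (EFin \o (G : T -> R)) ig.
rewrite /intRn /Rintegral fineK; last exact: fG.
have mG : measurable_fun (ext e : set T) (EFin \o G : T -> \bar R).
  exact: measurable_int ig.
(* Substitution w = y - x0; the evenness of K accounts for K (x0 - y) in the definition of the
   operator. *)
rewrite (@integral_sigma _ _ false (- x0) (ext e) (EFin \o G) me mG).
have E y : sigma_map false (- x0) y = y - x0 by rewrite /sigma_map expr0 scale1r.
rewrite (_ : _ @^-1` _ = [set y : 'rV[R]_n | (e <= enorm (x0 - y))%R]); last first.
  by apply/seteqP; split=> y; rewrite /preimage/ext/= E enormBC.
apply: eq_integral => y; rewrite inE /= => ey.
rewrite E /G subrK W0 -opprB (kernel_EFin hK); last first.
  by rewrite -enorm_gt0 (lt_le_trans e0).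
have -> : k (y - x0) = k (x0 - y) by rewrite -(kfunN hK (x0 - y)) opprB.
by rewrite EFinM.
Qed.

(* S is the integral of |w|^2 K over the ball of radius d: the linear part of the
   patch cancels by symmetry of K. *)
Lemma Lop_quadratic : exists2 S, 0 <= S <= Cc n s Lam * (d ^+ n.+2 * P d) &
  Lop K W x0 = (intRn (ext d) (fun w => (u x0 - u (w + x0)) * k w) - b * S)%:E.
Proof.
have [S S01 Slim] := kfun_core_lim s0 s1 lam0 lamLam hK d0.
exists S => //.
set A := intRn _ _; set f := (fun e => _) in Slim.
have Gd : intRn (ext d) G = A.
  by apply: eq_intRn => w dw; rewrite /G W_out.
have Ge (e : R) : 0 < e -> e < d -> intRn (ext e) G = A - b * f e.
  move=> e0 ed; rewrite (extU n (ltW ed)).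
  have ms := @measurable_shell R n e d; have me := @measurable_ext R n d.
  rewrite intRn_setU//; [|by rewrite -(extU n (ltW ed)); exact: intgG|exact: shell_ext_disj].
  rewrite Gd addrC; congr (_ + _).
  have [i1 z1] := kfun_odd s0 hK p e0 d0.
  have [i2 _] := kfun_core s0 s1 lam0 lamLam hK e0 d0.
  rewrite (@eq_intRn _ _ _ _ (fun w => -1 * (dot p w * k w) + (- b) * (enorm w ^+ 2 * k w))); last first.
    by move=> w /= /andP[_ wd]; rewrite /G W_in//; ring.
  rewrite intRnD//; [|exact: intgRnZ|exact: intgRnZ].
  by rewrite !intRnZ// z1 mulr0 add0r mulNr.
rewrite /Lop; apply/cvg_lim => //.
apply: (@cvg_trans _ ((fun e => (A - b * f e)%:E) @ 0^'+)).
  apply: near_eq_cvg; near=> e.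
  have e0 : 0 < e by near: e; exact: nbhs_right_gt.
  have ed : e < d by near: e; exact: nbhs_right_lt.
  by rewrite Lop_trunc// Ge.
apply: cvg_EFin; first by apply: nearW => e.
rewrite (_ : fine \o _ = fun e => A - b * f e); last by [].
apply: cvgB; first exact: cvg_cst.
by apply: cvgMr.
Unshelve. all: by end_near. Qed.

End operator_on_quadratics.

(** * Integral inequalities for viscosity solutions *)

Section ae_invariance.
Context (R : realType) (n : nat) (s lam Lam : R) (K : 'rV[R]_n -> \bar R).
Hypothesis hK : kernel_Ls2 s lam Lam K.
Local Notation T := (lebesgueRn R n).
Local Notation mu := (lebesgue_measureRn R n).

(** Lets u be replaced by a version bounded everywhere: the operator only sees the class of the
    function and its value at x. *)
Lemma Lop_ae (W V : 'rV[R]_n -> R) x : mfunRn setT W -> mfunRn setT V ->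
  {ae mu, forall y, W y = V y} -> W x = V x -> Lop K W x = Lop K V x.
Proof.
move=> mW mV WV Wx.
pose F (U : 'rV[R]_n -> R) (e : R) :=
  (\int[mu]_(y in [set y : 'rV[R]_n | (e <= enorm (x - y))%R]) ((U x - U y)%:E * K (x - y)%R))%E.
have key (e : R) : 0 < e -> F W e = F V e.
  move=> e0; pose D : set 'rV[R]_n := [set y | e <= enorm (x - y)].
  have Dpre : sigma_map true x @^-1` ext e = D.
    apply/seteqP; split=> y; rewrite /preimage/ext/D/= /sigma_map expr1 scaleN1r (addrC (- y)) //.
  have mD : measurable (D : set T) by rewrite -Dpre; apply: measurable_sigma_preimage; exact: measurable_ext.
  have mk : mfunRn D (fun y => kfun K (x - y)).
    have := @measurable_fun_sigma R n true x (ext e) _ _ (kfun K) (@measurable_ext R n e) (mfun_kfun hK e0).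
    rewrite Dpre; congr measurable_fun; apply/funext => y.
    by rewrite /sigma_map expr1 scaleN1r (addrC (- y)).
  have step (U : 'rV[R]_n -> R) : F U e = (\int[mu]_(y in D) ((U x - U y) * kfun K (x - y))%:E)%E.
    apply: eq_integral => y; rewrite inE => Dy; rewrite (kernel_EFin hK) ?EFinM//.
    by rewrite -enorm_gt0 (lt_le_trans e0).
  have mf (U : 'rV[R]_n -> R) : mfunRn setT U ->
      measurable_fun (D : set T) (fun y : T => ((U x - U y) * kfun K (x - y))%:E : \bar R).
    move=> mU; apply/measurable_EFinP; apply: measurable_funM; last exact: mk.
    apply: measurable_funB; first exact: measurable_cst.
    exact: (@measurable_funTS _ _ T).
  rewrite !step; apply: (@ae_eq_integral _ T R mu D _ _ mD (mf W mW) (mf V mV)).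
  by apply: (negligibleS _ WV) => y /= h yWV; apply: h => _; rewrite yWV Wx.
have nearF : \forall e \near (0:R)^'+, F W e = F V e.
  by near=> e; apply: key; near: e; exact: nbhs_right_gt.
rewrite /Lop -/(F W) -/(F V); congr (lim _); apply/seteqP; split; apply: near_eq_cvg.
  exact: nearF.
by apply: filterS nearF => e ->.
Unshelve. all: by end_near. Qed.

End ae_invariance.

Section viscosity.
Context (R : realType) (n : nat) (s lam Lam : R).
Context (Gam : Type) (K : Gam -> 'rV[R]_n -> \bar R) (c : Gam -> 'rV[R]_n -> R).
Hypotheses (n0 : (0 < n)%N) (s0 : 0 < s) (s1 : s < 1) (lam0 : 0 < lam) (lamLam : lam <= Lam).
Hypothesis hK : forall g, kernel_Ls2 s lam Lam (K g).
Local Notation T := (lebesgueRn R n).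
Local Notation mu := (lebesgue_measureRn R n).
Local Notation P := (kpow n s).
Variables (u v : 'rV[R]_n -> R) (M : R).
Hypotheses (mu_ : mfunRn setT u) (mv : mfunRn setT v) (vM : forall x, `|v x| <= M).
Hypotheses (uv : {ae mu, forall x, u x = v x}) (uvB : forall x, eball 1 x -> u x = v x).
Hypothesis visc : viscosity_solution (Iop K c) (eball 1) u.

Let Lop_uv g x0 p (b d : R) : eball 1 x0 -> 0 < d ->
  Lop (K g) (patch u (eball_at x0 d) (quadratic p x0 (u x0) b)) x0 =
  Lop (K g) (patch v (eball_at x0 d) (quadratic p x0 (v x0) b)) x0.
Proof.
move=> x1 d0; rewrite (uvB x1); apply: (Lop_ae (hK g)).
- exact: mfun_patch.
- exact: mfun_patch.
- by apply: (negligibleS _ uv) => y /= h yuv; apply: h; rewrite /patch; case: ifP.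
- have x0d : x0 \in eball_at x0 d by apply: mem_set; rewrite /eball_at /= subrr enorm0.
  by rewrite /patch x0d.
Qed.

Let touch x0 p (b d : R) : eball 1 x0 -> 0 < d -> eball_at x0 d `<=` eball 1 ->
  ((forall w, enorm w < d -> v (w + x0) <= v x0 + dot p w + b * enorm w ^+ 2) ->
    (Iop K c (patch u (eball_at x0 d) (quadratic p x0 (u x0) b)) x0 <= 0)%E) /\
  ((forall w, enorm w < d -> v x0 + dot p w + b * enorm w ^+ 2 <= v (w + x0)) ->
    (0 <= Iop K c (patch u (eball_at x0 d) (quadratic p x0 (u x0) b)) x0)%E).
Proof.
move=> x1 d0 dB.
have [||h1 h2] := @visc x0 (eball_at x0 d) _ x1 (@open_enorm_lt R n x0 d) _ dB (@C2_on_quadratic R n p x0 (u x0) b (eball_at x0 d)).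
- by rewrite /eball_at /= subrr enorm0.
- by rewrite /quadratic subrr enorm0 -(scale0r p) dotZr mul0r expr0n/= mulr0 !addr0.
split=> H; [apply: h1|apply: h2] => x xd; have xB := dB _ xd.
  by have := H _ xd; rewrite subrK (uvB xB) /quadratic (uvB x1).
by have := H _ xd; rewrite subrK (uvB xB) /quadratic (uvB x1).
Qed.

(** An infimum below e has a member below e: this selects the operator, at the cost e. The last term
    bounds the contribution of the paraboloid, of order |b| d^(2-2s). *)
Lemma visc_sub x0 p (b d e : R) : eball 1 x0 -> 0 < d -> eball_at x0 d `<=` eball 1 -> 0 < e ->
  (forall w, enorm w < d -> v (w + x0) <= v x0 + dot p w + b * enorm w ^+ 2) ->
  exists g, intRn (ext d) (fun w => (v x0 - v (w + x0)) * kfun (K g) w) <=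
    c g x0 + e + `|b| * (Cc n s Lam * (d ^+ n.+2 * P d)).
Proof.
move=> x1 d0 dB e0 H; have [/(_ H) + _] := touch p b x1 d0 dB.
rewrite /Iop => Ile; set A := (X in ereal_inf X) in Ile.
have : (ereal_inf A < e%:E)%E by rewrite (le_lt_trans Ile)// lte_fin.
move=> /ereal_inf_lt[_ [g _ <-]]; rewrite (Lop_uv g p b x1 d0).
have [S /andP[S0 S1] ->] := Lop_quadratic s0 s1 lam0 lamLam (hK g) mv vM x0 p b d0.
rewrite -EFinB lte_fin => h; exists g.
have bS : b * S <= `|b| * (Cc n s Lam * (d ^+ n.+2 * P d)).
  by rewrite (le_trans (ler_norm _))// normrM (ger0_norm S0) ler_wpM2l.
lra.
Qed.

(** A nonnegative infimum has nonnegative members only, so that g can be prescribed. *)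
Lemma visc_super x0 p (b d : R) g : eball 1 x0 -> 0 < d -> eball_at x0 d `<=` eball 1 ->
  (forall w, enorm w < d -> v x0 + dot p w + b * enorm w ^+ 2 <= v (w + x0)) ->
  c g x0 - `|b| * (Cc n s Lam * (d ^+ n.+2 * P d)) <=
  intRn (ext d) (fun w => (v x0 - v (w + x0)) * kfun (K g) w).
Proof.
move=> x1 d0 dB H; have [_ /(_ H) Ige] := touch p b x1 d0 dB.
have := le_trans Ige (ereal_inf_lbound (ex_intro2 _ _ g I erefl)).
rewrite (Lop_uv g p b x1 d0).
have [S /andP[S0 S1] ->] := Lop_quadratic s0 s1 lam0 lamLam (hK g) mv vM x0 p b d0.
rewrite -EFinB lee_fin => h.
have bS : - (b * S) <= `|b| * (Cc n s Lam * (d ^+ n.+2 * P d)).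
  by rewrite (le_trans (ler_norm _))// normrN normrM (ger0_norm S0) ler_wpM2l.
lra.
Qed.

End viscosity.

(** * From essential to pointwise bounds *)

Section essential_bound.
Context (R : realType) (n : nat).
Local Notation T := (lebesgueRn R n).
Local Notation mu := (lebesgue_measureRn R n).

Lemma open_gt0_measureRn (A : set 'rV[R]_n) x : open A -> A x -> ~ mu.-negligible (A : set T).
Proof.
move=> oA Ax; have mA : measurable (A : set T) := open_measurableRn oA.
move=> /(negligibleP mu mA) A0.
have /nbhs_ballP[e /= e0 xeA] : nbhs x A by exact: open_nbhs_nbhs.
pose I i := `]nat_coord x i - e / 2, nat_coord x i + e / 2[%R.
have IA : box I `<=` A.
  move=> y yI; apply: xeA; split=> // i j; rewrite ord1 /ball/=.
  have := yI j; rewrite /I nat_coordE in_itv/= -ltr_distl distrC => H.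
  by rewrite (lt_trans H)// ltr_pdivrMr// ltr_pMr// ltr1n.
have muI : mu (box I) = (e ^+ n)%:E.
  apply: lebesgue_measureRn_box => [|i]; first exact: ltW.
  rewrite lebesgue_measure_itv/= lte_fin ltrD2l gtrN ?divr_gt0//.
  by rewrite -EFinB; congr EFin; field.
have : (mu (box I) <= mu (A : set T))%E by apply: le_measure; rewrite ?inE//; exact: measurable_boxRn.
by rewrite muI A0 lee_fin leNgt exprn_gt0.
Qed.

Lemma ess_bound (u : 'rV[R]_n -> R) :
  (u : lebesgueRn R n -> R) \in Lfun (lebesgue_measureRn R n) +oo%E ->
  let M := fine ('N[lebesgue_measureRn R n]_(+oo%E)[EFin \o u])%E in
  [/\ 0 <= M, mfunRn setT u & {ae mu, forall x, `|u x| <= M}].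
Proof.
move=> /andP[/set_mem mu_ /set_mem uf] M.
(* The norm at exponent +oo is defined as the essential supremum provided that the whole space has
   positive measure. *)
have mu0 : (0 < mu [set: T])%E.
  rewrite lt0e measure_ge0 andbT; apply/eqP => mu0.
  by apply: (@open_gt0_measureRn setT 0 openT I); apply/negligibleP.
have ess : {ae mu, forall x, (`|u x|%:E <= 'N[mu]_(+oo%E)[EFin \o u])%E}.
  rewrite unlock mu0; exact: (ess_sup_ge mu (abse \o (EFin \o u))).
have Nge0 := Lnorm_ge0 mu +oo%E (EFin \o (u : T -> R)).
have Nfin : ('N[mu]_(+oo%E)[EFin \o u])%E \is a fin_num by rewrite ge0_fin_numE.
split=> //; first by rewrite /M fine_ge0.
by apply: (negligibleS _ ess) => x /= h H; apply: h; rewrite -lee_fin /M fineK.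
Qed.

(** By continuity a violation at one point persists on a neighbourhood, which is not negligible. *)
Lemma ae_le_open (u : 'rV[R]_n -> R) (D : set 'rV[R]_n) (M : R) : open D ->
  (forall x, D x -> {for x, continuous u}) ->
  {ae mu, forall x, `|u x| <= M} -> forall x, D x -> `|u x| <= M.
Proof.
move=> oD cu ae x Dx; rewrite leNgt; apply/negP => Mu.
have : nbhs x [set y | M < `|u y|].
  have cx : {for x, continuous (fun y => `|u y|)}.
    by apply: (@continuous_comp _ _ _ u (fun t : R => `|t|)); [exact: cu|exact: norm_continuous].
  by apply: (cx [set t | M < t]); apply: open_nbhs_nbhs; split => //; exact: open_gt.
rewrite nbhsE => -[V [oV Vx] VM].
apply: (@open_gt0_measureRn V x oV Vx).
by apply: (negligibleS _ ae) => y /VM /= h; rewrite leNgt h.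
Qed.

(* u is only essentially bounded off the unit ball; clipping makes it bounded
   without changing it almost everywhere. *)
Definition clip (M t : R) : R := Num.max (- M) (Num.min t M).

Lemma clip_bound M t : 0 <= M -> `|clip M t| <= M.
Proof.
by move=> M0; rewrite ler_norml /clip le_max lexx/= ge_max ge_min lexx orbT andbT (le_trans _ M0)// oppr_le0.
Qed.

Lemma clip_id M t : `|t| <= M -> clip M t = t.
Proof.
by rewrite ler_norml => /andP[h1 h2]; rewrite /clip (min_idPl h2) (max_idPr h1).
Qed.

Lemma mfun_clip (u : 'rV[R]_n -> R) M : mfunRn setT u -> mfunRn setT (fun x => clip M (u x)).
Proof.
move=> mu_; apply: measurable_funTS.
apply: measurable_maxr; first exact: measurable_cst.
by apply: measurable_minr => //; exact: measurable_cst.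
Qed.

End essential_bound.

(** * Touching configurations *)

Section truncated_kernel_integrals.
Context (R : realType) (n : nat) (s lam Lam : R) (K : 'rV[R]_n -> \bar R).
Hypotheses (n0 : (0 < n)%N) (s0 : 0 < s) (s1 : s < 1) (lam0 : 0 < lam) (lamLam : lam <= Lam).
Hypothesis hK : kernel_Ls2 s lam Lam K.
Local Notation T := (lebesgueRn R n).
Local Notation mu := (lebesgue_measureRn R n).
Local Notation P := (kpow n s).
Local Notation k := (kfun K).
Variables (c1 rho : R).
Hypotheses (c10 : 0 < c1) (c1P : 3 * Lam <= lam * P c1) (r0 : 0 < rho).
Local Notation t := (Lam * P rho).
Local Notation kap := (tker K t).

Let Lam0 : 0 < Lam. Proof. exact: lt_le_trans lam0 lamLam. Qed.
Let t0 : 0 < t. Proof. by rewrite mulr_gt0// kpow_gt0. Qed.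

Lemma ext0 : ext 0 = [set: 'rV[R]_n].
Proof. by apply/seteqP; split=> w //= _; exact: enorm_ge0. Qed.

Lemma shell_cst (d m : R) : 0 < d -> 0 <= m ->
  intgRn (shell 0 d : set 'rV[R]_n) (fun=> m) /\ 0 <= intRn (shell 0 d : set 'rV[R]_n) (fun=> m) <= m * (2 * d) ^+ n.
Proof.
move=> d0 m0; have ms := @measurable_shell R n 0 d.
apply: (intgRn_ge0 ms) => //; first exact: measurable_cst.
rewrite (@integral_cst _ T R mu (shell 0 d) ms).
rewrite EFinM; apply: lee_wpmul2l; first by rewrite lee_fin.
apply: le_trans (@lebesgue_measureRn_ball_le R n d (ltW d0)).
apply: le_measure; rewrite ?inE//; last by move=> w /= /andP[].
exact: measurable_enorm_lt.
Qed.

(** The reason for the truncation level t = Lam P rho: from distance rho on, kappa coincides with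
    K. *)
Lemma far_kfun w : ext rho w -> k w <= t.
Proof.
move=> rw; have w0 := ext_neq0 r0 rw.
have /andP[_ h] := kfun_bounds hK w0; rewrite (le_trans h)//.
by rewrite ler_wpM2l ?(ltW Lam0)// kpow_le.
Qed.

Lemma mfun_tker D : mfunRn D kap.
Proof. by apply: (@measurable_funTS _ _ T); exact: (measurable_tker hK t). Qed.

Lemma intgRn_tker : intgRn setT kap.
Proof.
have ms := @measurable_shell R n 0 rho; have me := @measurable_ext R n rho.
rewrite -ext0 (extU n (ltW r0)); apply: intgRn_setU => //; last exact: shell_ext_disj.
  have t20 : 0 <= 2 * t by rewrite mulr_ge0// ltW.
  have [ic _] := shell_cst r0 t20.
  apply: (@intgRn_le R n (shell 0 rho) kap (fun=> 2 * t) ms (@mfun_tker _) _ ic) => w _.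
  by have /andP[h1 h2] := tker_bounds hK t0 w; rewrite ger0_norm.
apply: (@intgRn_le R n (ext rho) kap _ me (@mfun_tker _) _ (kfun_tail s0 hK r0)) => w rw.
have w0 := ext_neq0 r0 rw.
by have /andP[h1 _] := tker_bounds hK t0 w; rewrite ger0_norm// (tker_le hK t0 w0).
Qed.

Lemma bounded_tker g (m : R) : mfunRn setT g -> (forall w, `|g w| <= m) ->
  intgRn setT (fun w => g w * kap w).
Proof.
move=> mg gm; apply: (intgRn_le measurableT _ _ (intgRnZ m measurableT intgRn_tker)).
  by apply: measurable_funM; [exact: mg|exact: mfun_tker].
move=> w _; have /andP[h1 _] := tker_bounds hK t0 w.
by rewrite normrM (ger0_norm h1) ler_wpM2r.
Qed.

(* The mass is estimated on the cube [rho, 2 rho]^n, where kappa = K. *)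
Lemma tker_mass : lam * P (2 * n%:R) * (rho ^+ n * P rho) <= intRn setT kap.
Proof.
pose Q : set 'rV[R]_n := box (fun=> `[rho, 2 * rho]%R).
have mQ : measurable (Q : set T) := measurable_boxRn _.
have b0 : 0 <= lam * P (2 * n%:R) * P rho by rewrite !mulr_ge0 ?kpow_ge0// ltW.
have lo w : Q w -> lam * P (2 * n%:R) * P rho <= kap w.
  move=> wQ; have /andP[h1 h2] := cube_enorm n0 r0 wQ.
  have w0 := ext_neq0 r0 (h1 : ext rho w).
  rewrite (tker_far w0 (far_kfun h1)).
  have /andP[h _] := kfun_bounds hK w0; apply: le_trans h.
  rewrite -mulrA ler_wpM2l ?(ltW lam0)//.
  rewrite -kpowM ?mulr_ge0 ?(ltW r0)//.
  apply: kpow_le => //; first by rewrite (lt_le_trans r0).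
  by rewrite (le_trans h2)// le_eqVlt; apply/orP; left; apply/eqP; ring.
have icst : intRn Q (fun=> lam * P (2 * n%:R) * P rho) = lam * P (2 * n%:R) * (rho ^+ n * P rho).
  rewrite /intRn /Rintegral (@integral_cst _ T R mu Q mQ).
  by rewrite (lebesgue_measureRn_cube n r0) -EFinM /=; ring.
have igcst : intgRn Q (fun=> lam * P (2 * n%:R) * P rho).
  have [||h _] := @intgRn_ge0 R n Q (fun=> lam * P (2 * n%:R) * P rho) (lam * P (2 * n%:R) * (rho ^+ n * P rho)) mQ _ (fun _ _ => b0).
  - exact: measurable_cst.
  - rewrite (@integral_cst _ T R mu Q mQ) (lebesgue_measureRn_cube n r0) -EFinM lee_fin.
    by rewrite le_eqVlt; apply/orP; left; apply/eqP; ring.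
  - exact: h.
have ikap : intgRn Q kap by exact: intgRnS measurableT mQ (@subsetT _ _) intgRn_tker.
rewrite -icst; apply: le_trans (le_intRn mQ igcst ikap lo) _.
have mQc : measurable (~` Q : set T) by exact: measurableC.
have := @intRn_setU R n Q (~` Q) kap mQ mQc; rewrite setUv => /(_ intgRn_tker (fun _ h => (fun h' => h' h))) ->.
by rewrite lerDl; apply: intRn_ge0 => w _; have /andP[] := tker_bounds hK t0 w.
Qed.

(** The pointwise constant, with B = P c1 / Lam because P (c1 rho) = B t, times the integral of
    |w|^(-n-2s) over |w| >= c1 rho / 2, measured in units of rho^n P rho. *)
Definition CD2c : R := CD2 n s Lam (P c1 / Lam) * (Ctail n s * ((c1 / 2) ^+ n * P (c1 / 2))).

Lemma CD2_ge0 (B : R) : 0 <= B -> 0 <= CD2 n s Lam B.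
Proof.
move=> B0; have C0 : 0 <= Cker n s Lam := ltW (Cker_gt0 n s lam0 lamLam).
rewrite /CD2 mulr_ge0// addr_ge0// divr_ge0// mulr_ge0// mulr_ge0 ?kpow_ge0//.
exact: sqr_ge0.
Qed.

Lemma CD2c_ge0 : 0 <= CD2c.
Proof.
rewrite /CD2c mulr_ge0 ?CD2_ge0 ?divr_ge0 ?kpow_ge0 ?(ltW Lam0)//.
by rewrite mulr_ge0 ?(ltW (Ctail_gt0 n s0))// mulr_ge0 ?kpow_ge0 ?exprn_ge0 ?divr_ge0 ?(ltW c10).
Qed.

(* kappa is constant on the ball of radius c1 * rho, so only |w| >= c1 * rho / 2
   contributes. *)
Lemma tker_D2_int p q : enorm p <= c1 * rho / 4 -> enorm q <= c1 * rho / 4 ->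
  let E := enorm (p + q) / (c1 * rho) + (enorm p ^+ 2 + enorm q ^+ 2) / (c1 * rho) ^+ 2 in
  let g := fun w => kap (w + p) + kap (w + q) - 2 * kap w in
  exists2 h, intgRn setT h /\ (forall w, `|g w| <= h w) & intRn setT h <= CD2c * E * (rho ^+ n * P rho).
Proof.
set r1 := c1 * rho => pr qr E g.
have r10 : 0 < r1 by rewrite mulr_gt0.
have P1 : P r1 = P c1 * P rho by rewrite kpowM ?(ltW c10) ?(ltW r0).
have tr : 3 * t <= lam * P r1.
  by rewrite P1 !mulrA ler_wpM2r ?kpow_ge0.
have B0 : 0 <= P c1 / Lam by rewrite divr_ge0 ?kpow_ge0 ?(ltW Lam0).
have rB : P r1 <= P c1 / Lam * t.
  by rewrite P1 mulrA divfK ?gt_eqF.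
have E0 : 0 <= E by rewrite addr_ge0 ?divr_ge0 ?addr_ge0 ?sqr_ge0 ?(ltW r10).
set a := CD2 n s Lam (P c1 / Lam) * E.
have r120 : 0 < r1 / 2 by rewrite divr_gt0.
have [ip /andP[ip0 ip1]] := kpow_tail n s0 r120.
have me := @measurable_ext R n (r1 / 2).
pose h : 'rV[R]_n -> R := patch (fun=> 0) (ext (r1 / 2)) (fun w => a * P (enorm w)).
have ih := intgRnZ a me ip.
exists h; last first.
  rewrite /intRn /Rintegral.
  have -> : (\int[mu]_(x in setT) (h x)%:E = \int[mu]_(x in ext (r1 / 2)) (a * P (enorm x))%:E)%E.
    rewrite [RHS]integral_mkcond; apply: eq_integral => x _.
    by rewrite /h /patch; case: ifP.
  rewrite -/(Rintegral mu (ext (r1/2)) (fun w => a * P (enorm w))) -/(intRn _ _) (intRnZ a me ip).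
  have -> : CD2c * E * (rho ^+ n * P rho) = a * (Ctail n s * ((r1 / 2) ^+ n * P (r1 / 2))).
    rewrite /CD2c /a /r1 (_ : c1 * rho / 2 = c1 / 2 * rho); last by ring.
    rewrite (@kpowM R n s (c1 / 2) rho) ?divr_ge0 ?(ltW c10) ?(ltW r0)// (exprMn n (c1 / 2)); ring.
  rewrite ler_wpM2l// /a mulr_ge0//.
  exact: CD2_ge0.
split; last first.
  move=> w; rewrite /h /patch; case: ifPn => wr.
    move/set_mem : wr => wr; exact: (tker_D2_far s0 lam0 lamLam hK t0 r10).
  have {}wr : enorm w < r1 / 2.
    by rewrite ltNge; apply: contra wr => wr; apply: mem_set.
  by rewrite /g (tker_D2_near s0 lam0 hK t0 r10 tr wr pr qr) normr0.
rewrite /intgRn; have := integrable_mkcond (EFin \o (fun w : T => a * P (enorm w))) me.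
move=> /(_ mu)[+ _] => /(_ ih); congr (_.-integrable _ _); apply/funext => w.
by rewrite /h /patch /=; case: ifP.
Qed.

End truncated_kernel_integrals.

Section touching.
Context (R : realType) (n : nat) (s lam Lam : R) (K : 'rV[R]_n -> \bar R).
Hypotheses (n0 : (0 < n)%N) (s0 : 0 < s) (s1 : s < 1) (lam0 : 0 < lam) (lamLam : lam <= Lam).
Hypothesis hK : kernel_Ls2 s lam Lam K.
Local Notation T := (lebesgueRn R n).
Local Notation mu := (lebesgue_measureRn R n).
Local Notation P := (kpow n s).
Local Notation k := (kfun K).

Variables (c1 rho : R).
Hypotheses (c10 : 0 < c1) (c1P : 3 * Lam <= lam * P c1) (r0 : 0 < rho).
Local Notation t := (Lam * P rho).
Local Notation kap := (tker K t).

Let Lam0 : 0 < Lam. Proof. exact: lt_le_trans lam0 lamLam. Qed.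
Let t0 : 0 < t. Proof. by rewrite mulr_gt0// kpow_gt0. Qed.

Variables (v : 'rV[R]_n -> R) (M : R) (x p q m : 'rV[R]_n) (A d : R).
Hypotheses (mv : mfunRn setT v) (vM : forall y, `|v y| <= M).
Hypotheses (pr : enorm p <= c1 * rho / 4) (qr : enorm q <= c1 * rho / 4).
Hypotheses (A0 : 0 <= A) (d0 : 0 < d) (dr : d < rho).

Definition three_point w : R := 2 * v (w + x) - v (w + (x + p)) - v (w + (x + q)).
Hypothesis D20 : 0 <= three_point 0.
Hypothesis touchD2 : forall w, enorm w < rho -> three_point w - three_point 0 <= dot m w + A * enorm w ^+ 2.

Let M0 : 0 <= M. Proof. exact: le_trans (normr_ge0 _) (vM 0). Qed.

Let mD2 : mfunRn setT three_point.
Proof.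
apply: measurable_funB; last exact: mfunRn_translation.
apply: measurable_funB; last exact: mfunRn_translation.
by apply: measurable_funM; [exact: measurable_cst|exact: mfunRn_translation].
Qed.

Let D2M w : `|three_point w| <= 4 * M.
Proof.
have := vM (w + x); have := vM (w + (x + p)); have := vM (w + (x + q)).
rewrite /three_point !ler_norml => /andP[h1 h2] /andP[h3 h4] /andP[h5 h6].
apply/andP; split; lra.
Qed.

Let E := enorm (p + q) / (c1 * rho) + (enorm p ^+ 2 + enorm q ^+ 2) / (c1 * rho) ^+ 2.
Let X := rho ^+ n * P rho.

(** The translation by x - b leaves the factor v (w + x), the same for all three choices of b, and
    puts the shift on kappa. *)
Let itr (b : 'rV[R]_n) : intgRn setT (fun w => v (w + b) * kap w) /\
  intgRn setT (fun w => v (w + x) * kap (w + (x - b))) /\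
  intRn setT (fun w => v (w + b) * kap w) = intRn setT (fun w => v (w + x) * kap (w + (x - b))).
Proof.
have i1 : intgRn setT (fun w => v (w + b) * kap w).
  by apply: (bounded_tker s0 lam0 lamLam hK r0 (m := M)); [exact: mfunRn_translation|].
have mf := intgRn_mfun i1.
split=> //; have E' w : w + (x - b) + b = w + x by rewrite -addrA subrK.
split.
  have := sigma_intgRn false (x - b) measurableT i1.
  rewrite preimage_setT; congr intgRn; apply/funext => w.
  by rewrite /sigma_map expr0 scale1r E'.
by rewrite (intRn_translation (x - b) mf); apply: eq_intRn => w _; rewrite E'.
Qed.

Let D2_kap : intRn setT (fun w => three_point w * kap w) <= CD2c n s Lam c1 * (M * E) * X.
Proof.
have [i0 [j0 e0]] := itr x; have [i1 [j1 e1]] := itr (x + p); have [i2 [j2 e2]] := itr (x + q).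
have mT : measurable ([set: 'rV[R]_n] : set T) := measurableT.
rewrite (@eq_intRn _ _ _ _ (fun w => 2 * (v (w + x) * kap w) - v (w + (x + p)) * kap w - v (w + (x + q)) * kap w)); last first.
  by move=> w _; rewrite /three_point; ring.
have j20 := intgRnZ 2 mT j0.
rewrite intRnB//; [|exact: intgRnB mT (intgRnZ 2 mT i0) i1].
rewrite intRnB//; [|exact: intgRnZ].
rewrite intRnZ// e0 e1 e2 -intRnZ// -intRnB// -intRnB//; last exact: intgRnB.
have pr' : enorm (- p) <= c1 * rho / 4 by rewrite enormN.
have qr' : enorm (- q) <= c1 * rho / 4 by rewrite enormN.
have [h [ih gh] hle] := tker_D2_int s0 lam0 lamLam hK c10 c1P r0 pr' qr'.
move: hle; rewrite -opprD !enormN -/E => hle.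
apply: (@le_trans _ _ (intRn setT (fun w => M * h w))).
  apply: le_intRn => //.
  - by apply: intgRnB => //; exact: intgRnB.
  - exact: intgRnZ.
  have xp b : x - (x + b) = - b by rewrite opprD addrA subrr sub0r.
  move=> w _; rewrite subrr addr0 !xp.
  apply: (@le_trans _ _ (`|v (w + x)| * `|kap (w - p) + kap (w - q) - 2 * kap w|)).
    rewrite -normrM -normrN (le_trans _ (ler_norm _))// le_eqVlt; apply/orP; left; apply/eqP; ring.
  by apply: ler_pM.
rewrite intRnZ//; apply: le_trans (ler_wpM2l M0 hle) _.
by rewrite le_eqVlt /X; apply/orP; left; apply/eqP; ring.
Qed.

Let Dk w := (three_point 0 - three_point w) * k w.
Let Dkap w := (three_point 0 - three_point w) * kap w.

Let mDD : mfunRn setT (fun w => three_point 0 - three_point w).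
Proof. by apply: measurable_funB; [exact: measurable_cst|exact: mD2]. Qed.

Let DDM w : `|three_point 0 - three_point w| <= 8 * M.
Proof. by rewrite (le_trans (ler_normB _ _))//; have := D2M 0; have := D2M w; lra. Qed.

Let iDkap : intgRn setT Dkap.
Proof. exact: (bounded_tker s0 lam0 lamLam hK r0 mDD DDM). Qed.

Let iDk : intgRn (ext d) Dk.
Proof.
apply: (bounded_kfun s0 hK (M := 8 * M) d0) => //.
by apply: (@measurable_funTS _ _ T); exact: mDD.
Qed.

Let Dkap_all : three_point 0 * (lam * P (2 * n%:R)) * X - CD2c n s Lam c1 * (M * E) * X <= intRn setT Dkap.
Proof.
have mT : measurable ([set: 'rV[R]_n] : set T) := measurableT.
have ik := intgRn_tker s0 lam0 lamLam hK r0.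
have i2 := bounded_tker s0 lam0 lamLam hK r0 mD2 D2M.
rewrite (@eq_intRn _ _ _ _ (fun w => three_point 0 * kap w - three_point w * kap w)); last first.
  by move=> w _; rewrite /Dkap mulrBl.
rewrite intRnB//; last exact: intgRnZ.
rewrite intRnZ// lerB// -mulrA ler_wpM2l//.
exact: (tker_mass n0 s0 lam0 lamLam hK r0).
Qed.

(** On the small ball the difference of [three_point] values is at most 8 M, kappa at most 2 t, and
    the volume at most (2 d)^n. *)
Let Dkap_ball : intRn setT Dkap <= intRn (ext d) Dkap + 16 * M * t * (2 * d) ^+ n.
Proof.
have ms := @measurable_shell R n 0 d; have me := @measurable_ext R n d.
rewrite -(ext0 R n) (extU n (ltW d0)) intRn_setU//; [|by rewrite -(extU n (ltW d0)) ext0|exact: shell_ext_disj].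
rewrite addrC lerD2l.
have m0 : 0 <= 16 * M * t := mulr_ge0 (mulr_ge0 (ler0n _ _) M0) (ltW t0).
have [ic /andP[_ h]] := shell_cst n d0 m0.
apply: le_trans h; apply: le_intRn => //.
  by apply: intgRnS iDkap.
move=> w _; rewrite (le_trans (ler_norm _))// normrM.
have /andP[h1 h2] := tker_bounds hK t0 w.
apply: (@le_trans _ _ (8 * M * (2 * t))); last by rewrite le_eqVlt; apply/orP; left; apply/eqP; ring.
by apply: ler_pM => //; rewrite ger0_norm.
Qed.

(** Beyond rho the two kernels agree. Within rho the weight K - kappa is nonnegative and even: the
    touching bound may be inserted, its linear part integrates to zero, and its quadratic part costs
    A times the core integral of K. *)
Let Dk_core : intRn (ext d) Dkap - A * (Cc n s Lam * (rho ^+ n.+2 * P rho)) <= intRn (ext d) Dk.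
Proof.
have me := @measurable_ext R n d; have ms := @measurable_shell R n d rho.
have mr := @measurable_ext R n rho.
have iDkap' : intgRn (ext d) Dkap by exact: intgRnS iDkap.
have iB := intgRnB me iDk iDkap'.
suff : - (A * (Cc n s Lam * (rho ^+ n.+2 * P rho))) <= intRn (ext d) (fun w => Dk w - Dkap w).
  by rewrite (intRnB me iDk iDkap') => h; lra.
have iB' := iB; rewrite (extU n (ltW dr)) in iB' *.
rewrite intRn_setU//; last exact: shell_ext_disj.
have -> : intRn (ext rho) (fun w => Dk w - Dkap w) = 0.
  rewrite (@eq_intRn _ _ _ _ (fun=> 0 : R)); first by rewrite /intRn /Rintegral integral0.
  move=> w rw; rewrite /Dk /Dkap (tker_far (ext_neq0 r0 rw)) ?subrr//.
  exact: (far_kfun s0 lam0 lamLam hK).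
rewrite addr0.
have ik : intgRn (shell d rho) k.
  by apply: (intgRnS me ms _ (kfun_tail s0 hK d0)); exact: shell_ext.
have ikap : intgRn (shell d rho) kap by exact: intgRnS (intgRn_tker s0 lam0 lamLam hK r0).
pose f w := k w - kap w.
have if' : intgRn (shell d rho) f by exact: intgRnB.
have fN w : f (- w) = f w by rewrite /f (kfunN hK) (tkerN hK).
have [i1 z1] := shell_odd m r0 fN if'.
have [i2 /andP[_ h2]] := kfun_core s0 s1 lam0 lamLam hK d0 r0.
apply: (@le_trans _ _ (intRn (shell d rho) (fun w => -1 * (dot m w * f w) + (- A) * (enorm w ^+ 2 * k w)))).
  rewrite intRnD//; [|exact: intgRnZ|exact: intgRnZ].
  by rewrite !intRnZ// z1 mulr0 add0r mulNr lerN2 ler_wpM2l.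
apply: le_intRn => //.
- by apply: intgRnD => //; exact: intgRnZ.
- by apply: intgRnS iB => //; exact: shell_ext.
move=> w wdr; have w0 := ext_neq0 d0 (shell_ext wdr); have /andP[_ wr] := wdr.
have h := touchD2 wr.
have f0 : 0 <= f w by rewrite subr_ge0 (tker_le hK t0).
have fk : f w <= k w by rewrite /f gerBl; have /andP[] := tker_bounds hK t0 w.
have -> : Dk w - Dkap w = (three_point 0 - three_point w) * f w by rewrite /Dk /Dkap /f; ring.
apply: (@le_trans _ _ (- (dot m w + A * enorm w ^+ 2) * f w)); last first.
  by rewrite ler_wpM2r// -lerN2 opprK opprB.
have h5 : A * enorm w ^+ 2 * f w <= A * enorm w ^+ 2 * k w.
  by rewrite ler_wpM2l// mulr_ge0// sqr_ge0.
lra.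
Qed.

Lemma touching_ineq :
  three_point 0 * (lam * P (2 * n%:R)) * X <=
  intRn (ext d) (fun w => (three_point 0 - three_point w) * k w) + CD2c n s Lam c1 * (M * E) * X +
  A * (Cc n s Lam * (rho ^+ n.+2 * P rho)) + 16 * M * t * (2 * d) ^+ n.
Proof. have h1 := Dkap_all; have h2 := Dkap_ball; have h3 := Dk_core; rewrite /Dk in h3; lra. Qed.

End touching.

(** * Doubling of variables *)

Section doubling_variables.
Context (R : realType) (n : nat) (v : 'rV[R]_n -> R).

(** Uniform continuity in which only y has to belong to K: v is continuous at the points of K as a
    function on the whole space, so y + a may lie outside. *)
Lemma compact_uniform_shift (K : set 'rV[R]_n) (w : R) : compact K ->
  (forall y, K y -> {for y, continuous v}) -> 0 < w ->
  exists2 eta : R, 0 < eta & forall a y, enorm a <= eta -> K y -> `|v (y + a) - v y| <= w.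
Proof.
move=> cK cv w0; have := (compact_near_coveringP K).1 cK _ (nbhs (0 : 'rV[R]_n))
  (fun a y => `|v (y + a) - v y| <= w) (nbhs_filter _).
have H x : K x -> \forall x' \near x & i \near (0 : 'rV[R]_n), `|v (x' + i) - v x'| <= w.
  move=> Kx; have w20 : 0 < w / 2 by rewrite divr_gt0.
  have c1 : (fun z : 'rV[R]_n * 'rV[R]_n => v (z.1 + z.2)) z @[z --> (x, 0 : 'rV[R]_n)] --> v x.
    apply: continuous_cvg; first exact: cv.
    rewrite -[X in _ --> X](addr0 x); apply: cvgD; [exact: cvg_fst|exact: cvg_snd].
  have c2 : (fun z : 'rV[R]_n * 'rV[R]_n => v z.1) z @[z --> (x, 0 : 'rV[R]_n)] --> v x.
    by apply: continuous_cvg; [exact: cv|exact: cvg_fst].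
  have /cvgrPdist_le /(_ _ w20) h1 := c1.
  have /cvgrPdist_le /(_ _ w20) h2 := c2.
  apply: filterS2 h1 h2 => -[x' i] /= h1 h2.
  rewrite -(subrKA (v x)) (le_trans (ler_normD _ _))// (splitr w) lerD//.
  by rewrite distrC.
move=> /(_ H) /nbhs_ballP[e /= e0 he].
exists (e / 2); first by rewrite divr_gt0.
move=> a y ae Ky; apply: he => //; split=> // i j; rewrite /ball/= mxE sub0r normrN.
by rewrite (le_lt_trans (coord_le_enorm a i j))// (le_lt_trans ae)// ltr_pdivrMr// ltr_pMr// ltr1n.
Qed.

(* x + h + a and x - h + b are the doubled variables: moving a (or b) alone tests
   u at one of them, and moving x, a, b along (w, -w, -w) tests u at x. *)
Definition penalized (x0 h : 'rV[R]_n) (A eps : R) (x a b : 'rV[R]_n) : R :=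
  2 * v x - v (x + (h + a)) - v (x + (- h + b)) - A * enorm (x - x0) ^+ 2 -
  eps^-1 * (enorm a ^+ 2 + enorm b ^+ 2).

Variables (M : R) (x0 h : 'rV[R]_n) (r A D0 D1 sg w : R).
Hypotheses (cv : forall y, enorm y < 1 -> {for y, continuous v}) (vM : forall y, `|v y| <= M).
Hypotheses (r0 : 0 < r) (x0r : enorm x0 + r <= 1 / 2) (h8 : enorm h <= 1 / 8).
Hypotheses (A0 : 0 <= A) (sg0 : 0 < sg) (sg16 : sg <= 1 / 16) (w0 : 0 < w).
Hypotheses (D00 : 0 <= D0) (D0E : D0 = 2 * v x0 - v (x0 + h) - v (x0 - h)).
Hypothesis Dle : forall x, enorm (x - x0) <= r -> 2 * v x - v (x + h) - v (x - h) <= D1.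

Lemma doubling : exists (x a b : 'rV[R]_n) (eps : R), 0 < eps /\
  [/\ enorm (x - x0) <= r, A * enorm (x - x0) ^+ 2 <= D1 - D0 + 2 * w,
      enorm a <= sg /\ enorm b <= sg,
      D0 <= 2 * v x - v (x + (h + a)) - v (x + (- h + b)) &
      forall x' a' b', enorm (x' - x0) <= r -> enorm a' <= 1 / 8 -> enorm b' <= 1 / 8 ->
        penalized x0 h A eps x' a' b' <= penalized x0 h A eps x a b].
Proof.
have M0 : 0 <= M := le_trans (normr_ge0 _) (vM 0).
have X0r := x0r; have H8 := h8; have R0 := r0; have SG := sg16; have D0' := D00; have W0 := w0.
(* 5/8 = 1/2 + 1/8 bounds x + h and x - h. *)
have cK := @compact_enorm_le R n 0 (5 / 8).
have cvK y : [set y | enorm (y - 0) <= 5 / 8] y -> {for y, continuous v}.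
  by rewrite /= subr0 => y8; apply: cv; lra.
have [eta eta0 etaP] := compact_uniform_shift cK cvK w0.
(* Below sg as required of a and b, below eta so that shifting by a or b changes v by at most w. *)
pose g := Num.min sg eta; have g0 : 0 < g by rewrite lt_min sg0.
(* At the maximum the penalties are at most 4 M, which with this eps forces |a|^2 + |b|^2 <= g^2;
   the 1 avoids a division by zero when M = 0. *)
pose eps := g ^+ 2 / (4 * M + 1).
have M1 : 0 < 4 * M + 1 by lra.
have eps0 : 0 < eps by rewrite divr_gt0// exprn_gt0.
pose S : set ('rV[R]_n * 'rV[R]_n * 'rV[R]_n) :=
  ([set x | enorm (x - x0) <= r] `*` [set a | enorm (a - 0) <= 1 / 8]) `*` [set b | enorm (b - 0) <= 1 / 8].
have cS : compact S.
  by apply: compact_setX; [apply: compact_setX|]; exact: compact_enorm_le.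
have S0 : S ((x0, 0), 0).
  by rewrite /S /= !subrr enorm0; split=> //; split => //; rewrite (ltW r0).
pose G (z : 'rV[R]_n * 'rV[R]_n * 'rV[R]_n) : R := penalized x0 h A eps z.1.1 z.1.2 z.2.
have inB x a : enorm (x - x0) <= r -> enorm a <= 1 / 8 ->
    enorm (x + (h + a)) < 1 /\ enorm (x + (- h + a)) < 1 /\ enorm x < 1.
  move=> xr a8; have h1 := ler_enormD (x - x0) x0; rewrite subrK in h1.
  have h2 := ler_enormD x (h + a); have h3 := ler_enormD h a.
  have h4 := ler_enormD x (- h + a); have h5 := ler_enormD (- h) a; rewrite enormN in h5.
  by split; [|split]; lra.
have cG : {within S, continuous G}.
  apply: continuous_in_subspaceT => -[[x a] b] /set_mem[[/= xr a8] b8].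
  rewrite !subr0 in a8 b8.
  have [xa [_ x1]] := inB x a xr a8; have [_ [xb _]] := inB x b xr b8.
  have cx : (fun z : 'rV[R]_n * 'rV[R]_n * 'rV[R]_n => z.1.1) z @[z --> ((x, a), b)] --> x.
    by apply: (@cvg_comp _ _ _ fst fst); [exact: cvg_fst|exact: cvg_fst].
  have ca : (fun z : 'rV[R]_n * 'rV[R]_n * 'rV[R]_n => z.1.2) z @[z --> ((x, a), b)] --> a.
    by apply: (@cvg_comp _ _ _ fst snd); [exact: cvg_fst|exact: cvg_snd].
  have cb : (fun z : 'rV[R]_n * 'rV[R]_n * 'rV[R]_n => z.2) z @[z --> ((x, a), b)] --> b.
    exact: cvg_snd.
  have ce (f : 'rV[R]_n * 'rV[R]_n * 'rV[R]_n -> 'rV[R]_n) (l : 'rV[R]_n) :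
      f z @[z --> ((x, a), b)] --> l -> (enorm (f z) ^+ 2 @[z --> ((x, a), b)] --> enorm l ^+ 2).
    move=> fl; rewrite !expr2 (_ : (fun z => enorm (f z) ^+ 2) = fun z => enorm (f z) * enorm (f z)) //.
    by apply: cvgM; apply: continuous_cvg => //; exact: enorm_continuous.
  rewrite /continuous_at /G /penalized /=; apply: cvgB; [apply: cvgB; [apply: cvgB; [apply: cvgB|]|]|].
  - by apply: cvgM; [exact: cvg_cst|apply: continuous_cvg => //; exact: cv].
  - apply: continuous_cvg; first exact: cv.
    by apply: cvgD => //; apply: cvgD => //; exact: cvg_cst.
  - apply: continuous_cvg; first exact: cv.
    by apply: cvgD => //; apply: cvgD => //; exact: cvg_cst.
  - apply: cvgM; first exact: cvg_cst.
    by apply: ce; apply: cvgB => //; exact: cvg_cst.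
  - apply: cvgM; first exact: cvg_cst.
    by apply: cvgD; exact: ce.
have [[[x a] b] /set_mem[[/= xr a8] b8] Gmax] := compact_EVT_max (ex_intro _ _ S0) cS cG.
rewrite !subr0 in a8 b8.
have {}Gmax x' a' b' : enorm (x' - x0) <= r -> enorm a' <= 1 / 8 -> enorm b' <= 1 / 8 ->
    penalized x0 h A eps x' a' b' <= penalized x0 h A eps x a b.
  move=> xr' a8' b8'; apply: (Gmax ((x', a'), b')); apply: mem_set.
  by split=> /=; [split|]; rewrite ?subr0.
(* Comparison with the point x0 and a = b = 0, where the penalties vanish. *)
have G0 : D0 <= penalized x0 h A eps x a b.
  have := Gmax x0 0 0; rewrite /penalized subrr enorm0 !addr0 expr0n/= addr0 !mulr0 !subr0 -D0E.
  by apply => //; rewrite ltW.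
have e0 : 0 <= eps^-1 by rewrite invr_ge0 ltW.
have p1 : 0 <= A * enorm (x - x0) ^+ 2 by rewrite mulr_ge0 ?sqr_ge0.
have p2 : 0 <= eps^-1 * (enorm a ^+ 2 + enorm b ^+ 2) by rewrite mulr_ge0 ?addr_ge0 ?sqr_ge0.
have := vM x; have := vM (x + (h + a)); have := vM (x + (- h + b)).
rewrite !ler_norml => /andP[m1 m2] /andP[m3 m4] /andP[m5 m6].
rewrite /penalized in G0.
have ab : enorm a ^+ 2 + enorm b ^+ 2 <= g ^+ 2.
  have : eps^-1 * (enorm a ^+ 2 + enorm b ^+ 2) <= 4 * M + 1 by lra.
  by rewrite mulrC ler_pdivrMr// /eps mulrCA divff ?gt_eqF// mulr1.
have ag : enorm a <= g by rewrite -(@ler_pXn2r _ 2) ?nnegrE ?(ltW g0)//; have := sqr_ge0 (enorm b); lra.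
have bg : enorm b <= g by rewrite -(@ler_pXn2r _ 2) ?nnegrE ?(ltW g0)//; have := sqr_ge0 (enorm a); lra.
move: ag bg; rewrite /g !le_min => /andP[a1 a2] /andP[b1 b2].
have hh : enorm (x + h) <= 5 / 8 /\ enorm (x - h) <= 5 / 8.
  have h1 := ler_enormD (x - x0) x0; rewrite subrK in h1.
  have h2 := ler_enormD x h; have h3 := ler_enormB x h; split; lra.
have [hh1 hh2] := hh.
have u1 := etaP a (x + h) a2; have u2 := etaP b (x - h) b2.
rewrite /= !subr0 -!addrA in u1 u2.
have := u1 hh1; have := u2 hh2; rewrite !ler_norml => /andP[q1 q2] /andP[q3 q4].
have Dx := Dle xr.
exists x, a, b, eps; split=> //; split=> //; lra.
Qed.

End doubling_variables.

(** * Second differences of functions of class C^{1,1} *)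

Section C11_bounds.
Context (R : realType) (n : nat) (c : 'rV[R]_n -> R) (m : R).
Hypotheses (n0 : (0 < n)%N) (dc : forall x, eball 1 x -> differentiable c x).
Hypothesis cm : (C11_norm (eball 1) c <= m%:E)%E.

Let S1 := ereal_sup [set `|c x|%:E | x in eball 1].
Let S2 := ereal_sup [set (enorm (grad c x))%:E | x in eball 1].
Let S3 := ereal_sup [set (enorm (grad c z.1 - grad c z.2) / enorm (z.1 - z.2))%:E
             | z in [set z | eball 1 z.1 /\ eball 1 z.2 /\ z.1 != z.2]].

Let eball10 : eball 1 (0 : 'rV[R]_n).
Proof. by rewrite /eball /= enorm0. Qed.

Let S1_ge0 : (0 <= S1)%E.
Proof. by apply: ereal_sup_ge => /=; exists `|c 0|%:E; [exists 0|rewrite lee_fin]. Qed.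

Let S2_ge0 : (0 <= S2)%E.
Proof. by apply: ereal_sup_ge => /=; exists (enorm (grad c 0))%:E; [exists 0|rewrite lee_fin]. Qed.

(** The supremum of the empty set is -oo, hence two distinct points of the unit ball are exhibited:
    0 and the vector with all coordinates 1/(2n), of norm at most 1/2. *)
Let S3_ge0 : (0 <= S3)%E.
Proof.
pose d := (2 * n%:R)^-1 : R; pose e : 'rV[R]_n := const_mx d.
have n0' : 0 < n%:R :> R by rewrite ltr0n.
have d0 : 0 < d by rewrite invr_gt0 mulr_gt0.
have e1 : enorm e <= n%:R * d.
  by apply: enorm_le_coord => [i|]; rewrite ?mxE ?ger0_norm// ltW.
have e2 : eball 1 e.
  rewrite /eball /= (le_lt_trans e1)// /d invfM mulrCA divff ?gt_eqF// mulr1.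
  by rewrite invf_lt1// ltr1n.
apply: ereal_sup_ge => /=.
exists (enorm (grad c e - grad c 0) / enorm (e - 0))%:E; last by rewrite lee_fin divr_ge0.
exists (e, 0) => //=; split=> //; split=> //.
apply/eqP => /rowP /(_ (Ordinal n0)); rewrite !mxE => h.
by move: d0; rewrite h ltxx.
Qed.

Let sum_le : (S1 + S2 + S3 <= m%:E)%E. Proof. exact: cm. Qed.

Lemma C11_norm_ge0 : (0 <= C11_norm (eball 1) c)%E.
Proof. by rewrite /C11_norm adde_ge0// adde_ge0. Qed.

Lemma C11_grad_le x : eball 1 x -> enorm (grad c x) <= m.
Proof.
move=> x1; rewrite -lee_fin; apply: le_trans sum_le.
apply: (@le_trans _ _ S2); first by apply: ereal_sup_ubound; exists x.
by rewrite -addeA (addeCA S1) leeDl// adde_ge0.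
Qed.

Lemma C11_grad_lip x y : eball 1 x -> eball 1 y -> enorm (grad c x - grad c y) <= m * enorm (x - y).
Proof.
move=> x1 y1; have [->|xy] := eqVneq x y; first by rewrite !subrr enorm0 mulr0.
rewrite -ler_pdivrMr ?enorm_gt0 ?subr_eq0// -lee_fin; apply: le_trans sum_le.
apply: (@le_trans _ _ S3); first by apply: ereal_sup_ubound; exists (x, y).
by rewrite leeDr// adde_ge0.
Qed.

Let seg (x p : 'rV[R]_n) (t : R) : eball 1 x -> eball 1 (x + p) -> 0 <= t <= 1 -> eball 1 (x + t *: p).
Proof.
rewrite /eball /= => x1 p1 /andP[t0 t1].
have -> : x + t *: p = (1 - t) *: x + t *: (x + p).
  by rewrite scalerDr addrA -scalerDl subrK scale1r.
have t1' : 0 <= 1 - t by rewrite subr_ge0.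
rewrite (le_lt_trans (ler_enormD _ _))// !enormZ !ger0_norm//.
have [->|t0'] := eqVneq t 0; first by rewrite subr0 mul0r addr0 mul1r.
have tp : 0 < t by rewrite lt_neqAle eq_sym t0'.
have h1 : (1 - t) * enorm x <= (1 - t) * 1 by rewrite ler_wpM2l// ltW.
have h2 : t * enorm (x + p) < t * 1 by rewrite ltr_pM2l.
lra.
Qed.

Lemma C11_taylor (x p : 'rV[R]_n) : eball 1 x -> eball 1 (x + p) ->
  `|c (x + p) - c x - dot (grad c x) p| <= m * enorm p ^+ 2.
Proof.
move=> x1 p1; have m0 : 0 <= m := le_trans (enorm_ge0 _) (C11_grad_le x1).
apply: taylor_line => t t01; have xt := seg x1 p1 t01; first exact: dc.
apply: (le_trans (C11_grad_lip xt x1)); rewrite ler_wpM2l// addrC addKr enormZ.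
by have /andP[t0 t1] := t01; rewrite ger0_norm// ler_piMl.
Qed.

(** The shifts need not be opposite: the first-order terms leave the gradient against p + q. *)
Lemma C11_second_diff (x p q : 'rV[R]_n) : eball 1 x -> eball 1 (x + p) -> eball 1 (x + q) ->
  2 * c x - c (x + p) - c (x + q) <= m * (enorm (p + q) + enorm p ^+ 2 + enorm q ^+ 2).
Proof.
move=> x1 p1 q1; have := C11_taylor x1 p1; have := C11_taylor x1 q1.
have := dot_le (grad c x) (p + q); rewrite dotDr.
have g : enorm (grad c x) * enorm (p + q) <= m * enorm (p + q).
  by rewrite ler_wpM2r// C11_grad_le.
rewrite !ler_norml => /andP[h1 h2] /andP[h3 h4] /andP[h5 h6].
lra.
Qed.

End C11_bounds.

(** Both d^(2-2s) and d^n tend to 0. The radius runs through the powers of 1/2, along which the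
    former is geometric; a positive exponent k gives 2 d <= 1, hence (2 d)^n <= 2 d. *)
Lemma small_radius (R : realType) (n : nat) (s B N rho eta : R) : (0 < n)%N -> 0 < s -> s < 1 ->
  0 <= B -> 0 <= N -> 0 < rho -> 0 < eta ->
  exists2 d : R, 0 < d < rho & B * (d ^+ n.+2 * kpow n s d) + N * (2 * d) ^+ n <= eta.
Proof.
move=> n0 s0 s1 B0 N0 r0 e0; have /andP[q0 q1] := core_ratio n s1.
have h0 : 0 < 2^-1 :> R by rewrite invr_gt0.
have h1 : `|2^-1 : R| < 1 by rewrite gtr0_norm// invf_lt1// ltr1n.
have c1 := cvg_expr h1.
have c2 : (fun k => (2^-1 ^+ n.+2 * kpow n s 2^-1) ^+ k) @ \oo --> (0 : R).
  by apply: cvg_expr; rewrite ger0_norm.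
have c3 : (fun k => B * (2^-1 ^+ n.+2 * kpow n s 2^-1) ^+ k + N * (2 * 2^-1 ^+ k)) @ \oo --> (0 : R).
  rewrite (_ : (0 : R) = B * 0 + N * (2 * 0)); last by rewrite !mulr0 addr0.
  by apply: cvgD; apply: cvgM; [exact: cvg_cst|exact: c2|exact: cvg_cst|apply: cvgM; [exact: cvg_cst|exact: c1]].
have [k [k1 [k2 k3]]] : exists k : nat, (0 < k)%N /\ (2^-1 ^+ k < rho) /\
    B * (2^-1 ^+ n.+2 * kpow n s 2^-1) ^+ k + N * (2 * 2^-1 ^+ k) <= eta.
  have /cvgrPdist_lt /(_ _ r0) n1 := c1.
  have /cvgrPdist_le /(_ _ e0) n2 := c3.
  have : \forall k \near \oo, (0 < k)%N /\ (2^-1 ^+ k < rho) /\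
    B * (2^-1 ^+ n.+2 * kpow n s 2^-1) ^+ k + N * (2 * 2^-1 ^+ k) <= eta.
    near=> k; split; first by near: k; exact: nbhs_infty_gt.
    split.
      have : `|0 - 2^-1 ^+ k| < rho by near: k.
      by rewrite sub0r normrN; apply: le_lt_trans; exact: ler_norm.
    have : `|0 - (B * (2^-1 ^+ n.+2 * kpow n s 2^-1) ^+ k + N * (2 * 2^-1 ^+ k))| <= eta by near: k.
    by rewrite sub0r normrN; apply: le_trans; exact: ler_norm.
  by move=> [k _ /(_ k (leqnn _))] H; exists k.
exists (2^-1 ^+ k); first by rewrite exprn_gt0.
apply: le_trans k3; apply: lerD.
  rewrite ler_wpM2l// kpowX ?(ltW h0)// exprMn.
  by rewrite -exprM mulnC exprM.
rewrite ler_wpM2l//.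
have t0 : 0 <= 2 * 2^-1 ^+ k :> R by rewrite mulr_ge0// exprn_ge0// ltW.
have t1 : 2 * 2^-1 ^+ k <= 1 :> R.
  rewrite -(prednK k1) exprS mulrA divff// mul1r exprn_ile1 ?(ltW h0)//.
  by rewrite invf_le1// ler1n.
by rewrite -[leRHS]expr1; apply: ler_wiXn2l; rewrite ?t0.
Unshelve. all: by end_near. Qed.

Section configuration.
Context (R : realType) (n : nat) (s lam Lam : R).
Context (Gam : Type) (K : Gam -> 'rV[R]_n -> \bar R) (c : Gam -> 'rV[R]_n -> R).
Hypotheses (n0 : (0 < n)%N) (s0 : 0 < s) (s1 : s < 1) (lam0 : 0 < lam) (lamLam : lam <= Lam).
Hypothesis hK : forall g, kernel_Ls2 s lam Lam (K g).
Local Notation P := (kpow n s).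
Variables (v : 'rV[R]_n -> R) (M m : R).
Hypotheses (mv : mfunRn setT v) (vM : forall x, `|v x| <= M).
Hypotheses (dc : forall g x, eball 1 x -> differentiable (c g) x)
  (cm : forall g, (C11_norm (eball 1) (c g) <= m%:E)%E).
Hypothesis vsub : forall (x0 p : 'rV[R]_n) (b d e : R),
  eball 1 x0 -> 0 < d -> eball_at x0 d `<=` eball 1 -> 0 < e ->
  (forall w, enorm w < d -> v (w + x0) <= v x0 + dot p w + b * enorm w ^+ 2) ->
  exists g, intRn (ext d) (fun w => (v x0 - v (w + x0)) * kfun (K g) w) <=
    c g x0 + e + `|b| * (Cc n s Lam * (d ^+ n.+2 * P d)).
Hypothesis vsup : forall (x0 p : 'rV[R]_n) (b d : R) g,
  eball 1 x0 -> 0 < d -> eball_at x0 d `<=` eball 1 ->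
  (forall w, enorm w < d -> v x0 + dot p w + b * enorm w ^+ 2 <= v (w + x0)) ->
  c g x0 - `|b| * (Cc n s Lam * (d ^+ n.+2 * P d)) <=
  intRn (ext d) (fun w => (v x0 - v (w + x0)) * kfun (K g) w).

Variables (c1 : R) (c10 : 0 < c1) (c1P : 3 * Lam <= lam * P c1).
Variables (x0 h x a b : 'rV[R]_n) (r A eps : R).
Hypotheses (r0 : 0 < r) (A0 : 0 <= A).
Hypotheses (x0r : enorm x0 + r <= 1 / 2) (h8 : enorm h <= 1 / 8).
Hypotheses (xr : enorm (x - x0) <= r / 2) (a16 : enorm a <= 1 / 16) (b16 : enorm b <= 1 / 16).
Hypothesis pmax : forall x' a' b', enorm (x' - x0) <= r -> enorm a' <= 1 / 8 -> enorm b' <= 1 / 8 ->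
        penalized v x0 h A eps x' a' b' <= penalized v x0 h A eps x a b.
Local Notation p := (h + a).
Local Notation q := (- h + b).
Local Notation rho := (r / 2).
Hypotheses (pr : enorm p <= c1 * rho / 4) (qr : enorm q <= c1 * rho / 4).
Hypothesis D20 : 0 <= 2 * v x - v (x + p) - v (x + q).

Let facts : [/\ 0 < r, enorm (x - x0) <= r / 2, enorm a <= 1 / 16, enorm b <= 1 / 16 &
  enorm x0 + r <= 1 / 2 /\ enorm h <= 1 / 8].
Proof. by []. Qed.

(** Along this direction x + p and x + q stay fixed. The curvature is half of A + 2/eps, since v x
    has the factor 2. *)
Let pen_x w : enorm w < rho -> enorm w < 1 / 16 ->
  v (w + x) <= v x + dot (A *: (x - x0) - eps^-1 *: (a + b)) w + (A / 2 + eps^-1) * enorm w ^+ 2.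
Proof.
move=> wr w16; have [f1 f2 f3 f4 f5] := facts.
have := @pmax (x + w) (a - w) (b - w).
have -> : x + w - x0 = x - x0 + w by rewrite addrAC.
rewrite (le_trans (ler_enormD _ _)); last by lra.
rewrite (le_trans (ler_enormB _ _)); last by lra.
rewrite (le_trans (ler_enormB _ _)); last by lra.
move=> /(_ isT isT isT); rewrite /penalized.
have -> : x + w + (h + (a - w)) = x + p by apply/rowP => i; rewrite !mxE; ring.
have -> : x + w + (- h + (b - w)) = x + q by apply/rowP => i; rewrite !mxE; ring.
have -> : x + w - x0 = x - x0 + w by rewrite addrAC.
rewrite (enormD_sqr (x - x0) w) (enormD_sqr a) (enormD_sqr b) enormN !dotNr.
rewrite [dot (_ *: _ - _) w]dotDl dotNl !dotZl (dotDl a b w) (addrC w x); lra.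
Qed.

Let pen_y w : enorm w < 1 / 16 ->
  v (x + p) + dot ((- 2 * eps^-1) *: a) w + (- eps^-1) * enorm w ^+ 2 <= v (w + (x + p)).
Proof.
move=> w16; have [f1 f2 f3 f4 f5] := facts; have := @pmax x (a + w) b.
rewrite (le_trans f2); last by lra.
rewrite (le_trans (ler_enormD _ _)); last by lra.
rewrite (le_trans f4); last by lra.
move=> /(_ isT isT isT); rewrite /penalized (enormD_sqr a w) dotZl.
have -> : x + (h + (a + w)) = w + (x + p) by apply/rowP => i; rewrite !mxE; ring.
lra.
Qed.

Let pen_z w : enorm w < 1 / 16 ->
  v (x + q) + dot ((- 2 * eps^-1) *: b) w + (- eps^-1) * enorm w ^+ 2 <= v (w + (x + q)).
Proof.
move=> w16; have [f1 f2 f3 f4 f5] := facts; have := @pmax x a (b + w).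
rewrite (le_trans f2); last by lra.
rewrite (le_trans f3); last by lra.
rewrite (le_trans (ler_enormD _ _)); last by lra.
move=> /(_ isT isT isT); rewrite /penalized (enormD_sqr b w) dotZl.
have -> : x + (- h + (b + w)) = w + (x + q) by apply/rowP => i; rewrite !mxE; ring.
lra.
Qed.

(** Moving x alone translates the three points together and leaves a and b unchanged, so that 1/eps
    does not enter. This is the bound used at the scale rho, the others only at the scale d. *)
Let pen_D w : enorm w < rho -> three_point v x p q w - three_point v x p q 0 <= dot ((2 * A) *: (x - x0)) w + A * enorm w ^+ 2.
Proof.
move=> wr; have [f1 f2 f3 f4 f5] := facts; have := @pmax (x + w) a b.
have -> : x + w - x0 = x - x0 + w by rewrite addrAC.
rewrite (le_trans (ler_enormD _ _)); last by lra.
rewrite (le_trans f3); last by lra.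
rewrite (le_trans f4); last by lra.
move=> /(_ isT isT isT); rewrite /penalized.
have -> : x + w - x0 = x - x0 + w by rewrite addrAC.
rewrite (enormD_sqr (x - x0) w) /three_point !add0r dotZl.
have -> : x + w + p = w + (x + p) by apply/rowP => i; rewrite !mxE; ring.
have -> : x + w + q = w + (x + q) by apply/rowP => i; rewrite !mxE; ring.
rewrite (addrC x w); lra.
Qed.

Let inB : [/\ enorm x <= 3 / 4, enorm (x + p) <= 3 / 4 & enorm (x + q) <= 3 / 4].
Proof.
have [f1 f2 f3 f4 [f5 f6]] := facts.
have h1 := ler_enormD (x - x0) x0; rewrite subrK in h1.
have h2 := ler_enormD x p; have h3 := ler_enormD h a.
have h4 := ler_enormD x q; have h5 := ler_enormD (- h) b; rewrite enormN in h5.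
by split; lra.
Qed.

Let inBB (y : 'rV[R]_n) d : enorm y <= 3 / 4 -> d <= 1 / 16 -> eball_at y d `<=` eball 1.
Proof.
move=> y1 d1 z; rewrite /eball_at /eball /= => zd.
by have h1 := ler_enormD (z - y) y; rewrite subrK in h1; lra.
Qed.

Let in1 (y : 'rV[R]_n) : enorm y <= 3 / 4 -> eball 1 y.
Proof. by rewrite /eball /= => h1; lra. Qed.

Let E := enorm (p + q) / (c1 * rho) + (enorm p ^+ 2 + enorm q ^+ 2) / (c1 * rho) ^+ 2.
Let Lam0 : 0 < Lam. Proof. exact: lt_le_trans lam0 lamLam. Qed.

(** All that vanishes with d for fixed eps goes into eta: the paraboloid terms of the three
    viscosity inequalities, the small ball, and the error in the selection of the operator. *)
Lemma configuration_le eta : 0 < eta ->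
  (2 * v x - v (x + p) - v (x + q)) * (lam * P (2 * n%:R)) * (rho ^+ n * P rho) <=
  m * (enorm (p + q) + enorm p ^+ 2 + enorm q ^+ 2) +
  CD2c n s Lam c1 * (M * E) * (rho ^+ n * P rho) +
  A * (Cc n s Lam * (rho ^+ n.+2 * P rho)) + eta.
Proof.
move=> eta0; have [f1 f2 f3 f4 f5] := facts; have [x1 y1 z1] := inB.
have rho0 : 0 < rho by lra.
have M0 : 0 <= M := le_trans (normr_ge0 _) (vM 0).
have Cc0 := ltW (Cc_gt0 n s1 lam0 lamLam).
pose bx := A / 2 + eps^-1; pose by_ := - eps^-1.
pose B := (2 * `|bx| + `|by_| + `|by_|) * Cc n s Lam.
have B0 : 0 <= B by apply: mulr_ge0 => //; have := normr_ge0 bx; have := normr_ge0 by_; lra.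
have N0 : 0 <= 16 * M * (Lam * P rho).
  by rewrite mulr_ge0 ?mulr_ge0 ?kpow_ge0// ltW.
have m0 : 0 < Num.min rho (1 / 16) by rewrite lt_min rho0 divr_gt0.
have eta20 : 0 < eta / 2 by rewrite divr_gt0.
have [d /andP[d0 dmin] dle] := small_radius n0 s0 s1 B0 N0 m0 eta20.
move: dmin; rewrite lt_min => /andP[dr d16].
(* The inequality at x is used twice, so this error contributes eta / 2; the choice of d provides
   the other half. *)
have eta40 : 0 < eta / 4 by rewrite divr_gt0.
have [g gx] := vsub (in1 x1) d0 (inBB x1 (ltW d16)) eta40
  (fun w wd => pen_x (lt_trans wd dr) (lt_trans wd d16)).
(* The operator selected at x is imposed at the two other points. *)
have gy := vsup g (in1 y1) d0 (inBB y1 (ltW d16)) (fun w wd => pen_y (lt_trans wd d16)).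
have gz := vsup g (in1 z1) d0 (inBB z1 (ltW d16)) (fun w wd => pen_z (lt_trans wd d16)).
have D20' : 0 <= three_point v x p q 0 by rewrite /three_point !add0r.
have := touching_ineq n0 s0 s1 lam0 lamLam (hK g) c10 c1P rho0 mv vM pr qr A0 d0 dr D20' pen_D.
have me := @measurable_ext R n d.
have it (y : 'rV[R]_n) : intgRn (ext d) (fun w => (v y - v (w + y)) * kfun (K g) w).
  apply: (bounded_kfun s0 (hK g) (M := 2 * M) d0).
    by apply: measurable_funB; [exact: measurable_cst|exact: mfunRn_translation].
  move=> w _; rewrite (le_trans (ler_normB _ _))//; have := vM y; have := vM (w + y); lra.
have -> : intRn (ext d) (fun w => (three_point v x p q 0 - three_point v x p q w) * kfun (K g) w) =
   2 * intRn (ext d) (fun w => (v x - v (w + x)) * kfun (K g) w) -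
   intRn (ext d) (fun w => (v (x + p) - v (w + (x + p))) * kfun (K g) w) -
   intRn (ext d) (fun w => (v (x + q) - v (w + (x + q))) * kfun (K g) w).
  rewrite -(intRnZ 2 me (it x)) -(intRnB me (intgRnZ 2 me (it x)) (it (x + p))).
  rewrite -(intRnB me (intgRnB me (intgRnZ 2 me (it x)) (it (x + p))) (it (x + q))).
  by apply: eq_intRn => w _; rewrite /three_point !add0r; ring.
have := C11_second_diff n0 (dc g) (cm g) (in1 x1) (in1 y1) (in1 z1).
have -> : three_point v x p q 0 = 2 * v x - v (x + p) - v (x + q) by rewrite /three_point !add0r.
rewrite -/E => hc H; apply: (le_trans H).
move: gx gy gz dle; rewrite /B -/bx -/by_.
set Xd := d ^+ n.+2 * P d; set Ix := intRn _ _; set Iy := intRn _ _; set Iz := intRn _ _.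
set Nd := 16 * M * (Lam * P rho) * (2 * d) ^+ n => gx gy gz dle.
set W1 := CD2c _ _ _ _ * _ * _; set W2 := A * _.
have e4 : 2 * (`|bx| * (Cc n s Lam * Xd)) + `|by_| * (Cc n s Lam * Xd) + `|by_| * (Cc n s Lam * Xd) =
  (2 * `|bx| + `|by_| + `|by_|) * Cc n s Lam * Xd by ring.
lra.
Qed.

End configuration.

(** * The second difference estimate *)

Section second_difference.
Context (R : realType) (n : nat) (s lam Lam : R).
Hypotheses (n0 : (0 < n)%N) (s0 : 0 < s) (s1 : s < 1) (lam0 : 0 < lam) (lamLam : lam <= Lam).
Local Notation P := (kpow n s).

Let Lam0 : 0 < Lam. Proof. exact: lt_le_trans lam0 lamLam. Qed.

(* cnear * rho is the radius of a ball where kappa is constant; cmass bounds the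
   mass of kappa; cpen weighs the penalty in x - x0, small enough for its
   contribution to be absorbed by half of the mass term. *)
Definition cnear : R := lam / (3 * Lam).
Definition cmass : R := lam * P (2 * n%:R).
Definition cpen : R := Num.min 1 (2 * cmass / Cc n s Lam).
(** The denominator is L^2. The 80 is 10 * 2 * 4, from the bound at a maximum, the half of the mass
    term left there, and (L d0 / 2)^2; 1024 = 4 * 16^2 makes |h| at most L d0 / 16 when combined
    with D <= 4 M. *)
Definition csd : R :=
  (80 * (1 + CD2c n s Lam cnear) / cmass + 1024) / (cnear * (cpen / 20)) ^+ 2.

Lemma cnear_gt0 : 0 < cnear. Proof. by rewrite divr_gt0// mulr_gt0. Qed.

Lemma cnear_le1 : cnear <= 1.
Proof. by rewrite ler_pdivrMr ?mulr_gt0// mul1r (le_trans lamLam)// ler_peMl ?ler1n// ltW. Qed.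

(** Since cnear <= 1 and n + 2 s >= 1, P cnear is at least 1 / cnear = 3 Lam / lam. *)
Lemma cnearP : 3 * Lam <= lam * P cnear.
Proof.
have c0 := cnear_gt0.
have -> : 3 * Lam = lam * cnear^-1.
  by rewrite /cnear invf_div mulrCA divff ?gt_eqF// mulr1.
rewrite ler_wpM2l ?(ltW lam0)// /kpow -opprD powRN lef_pV2 ?posrE ?powR_gt0//.
rewrite -[leRHS]powRr1 ?(ltW c0)//; apply: ger_powR; first by rewrite c0 cnear_le1.
have : 1 <= n%:R :> R by rewrite ler1n.
have s0' := s0; lra.
Qed.

Lemma cmass_gt0 : 0 < cmass.
Proof. by rewrite mulr_gt0// kpow_gt0// mulr_gt0// ltr0n. Qed.

Lemma cpen_gt0 : 0 < cpen.
Proof.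
have C0 := Cc_gt0 n s1 lam0 lamLam; have c0 := cmass_gt0.
rewrite /cpen lt_min ltr01 /=; apply: divr_gt0; last exact: C0.
by apply: mulr_gt0; [exact: ltr0n|exact: c0].
Qed.

Lemma csd_gt0 : 0 < csd.
Proof.
have h := CD2c_ge0 n s0 lam0 lamLam cnear_gt0; have c0 := cmass_gt0.
rewrite /csd; apply: divr_gt0; last first.
  apply: exprn_gt0; apply: mulr_gt0; first exact: cnear_gt0.
  by apply: divr_gt0; [exact: cpen_gt0|rewrite ltr0n].
apply: ltr_wpDl; last by rewrite ltr0n.
apply: divr_ge0; last exact: ltW c0.
by apply: mulr_ge0; [exact: ler0n|exact: addr_ge0 ler01 h].
Qed.

Context (Gam : Type) (K : Gam -> 'rV[R]_n -> \bar R) (c : Gam -> 'rV[R]_n -> R).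
Hypothesis hK : forall g, kernel_Ls2 s lam Lam (K g).
Variables (v : 'rV[R]_n -> R) (M m : R).
Hypotheses (mv : mfunRn setT v) (vM : forall x, `|v x| <= M) (m0 : 0 <= m).
Hypothesis cv : forall y, enorm y < 1 -> {for y, continuous v}.
Hypotheses (dc : forall g x, eball 1 x -> differentiable (c g) x)
  (cm : forall g, (C11_norm (eball 1) (c g) <= m%:E)%E).
Hypothesis vsub : forall (x0 p : 'rV[R]_n) (b d e : R),
  eball 1 x0 -> 0 < d -> eball_at x0 d `<=` eball 1 -> 0 < e ->
  (forall w, enorm w < d -> v (w + x0) <= v x0 + dot p w + b * enorm w ^+ 2) ->
  exists g, intRn (ext d) (fun w => (v x0 - v (w + x0)) * kfun (K g) w) <=
    c g x0 + e + `|b| * (Cc n s Lam * (d ^+ n.+2 * P d)).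
Hypothesis vsup : forall (x0 p : 'rV[R]_n) (b d : R) g,
  eball 1 x0 -> 0 < d -> eball_at x0 d `<=` eball 1 ->
  (forall w, enorm w < d -> v x0 + dot p w + b * enorm w ^+ 2 <= v (w + x0)) ->
  c g x0 - `|b| * (Cc n s Lam * (d ^+ n.+2 * P d)) <=
  intRn (ext d) (fun w => (v x0 - v (w + x0)) * kfun (K g) w).

Variable h : 'rV[R]_n.
Hypothesis h8 : enorm h <= 1 / 8.
Let D x := 2 * v x - v (x + h) - v (x - h).
Let M0 : 0 <= M. Proof. exact: le_trans (normr_ge0 _) (vM 0). Qed.

Let DM x : D x <= 4 * M.
Proof.
have := vM x; have := vM (x + h); have := vM (x - h).
by rewrite /D !ler_norml => /andP[h1 h2] /andP[h3 h4] /andP[h5 h6]; lra.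
Qed.

Let tau := cpen.
(** The excess of D over D(x0) near x0, 3 theta D(x0), and the oscillation error 2 theta D(x0) then
    add up to tau D(x0) / 4. *)
Let theta := tau / 20.
Let L := cnear * theta.

Let tau01 : 0 < tau <= 1.
Proof. by rewrite cpen_gt0 ge_min lexx. Qed.

Section at_max.
Variable x0 : 'rV[R]_n.
Let d0 := 1 / 2 - enorm x0.
Hypotheses (d00 : 0 < d0) (D00 : 0 < D x0).
Hypothesis x0max : forall x, enorm x <= 1 / 2 -> (1 / 2 - enorm x) ^+ 2 * D x <= d0 ^+ 2 * D x0.
Let r := theta * d0.
Let rho := r / 2.

Let th : 0 < theta <= 1 / 20.
Proof. have /andP[t0 t1] := tau01; rewrite /theta divr_gt0//=; lra. Qed.

(** Within distance theta d0 the weight is at least (1 - theta)^2 times its value at x0, so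
    maximality allows D to grow by (1 - theta)^-2 at most, which is below 1 + 3 theta for theta <=
    1/20. *)
Let D_near x : enorm (x - x0) <= r -> D x <= (1 + 3 * theta) * D x0.
Proof.
move=> xr; have /andP[t0 t1] := th; have D00' := D00; have d00' := d00.
have [Dx|Dx] := leP (D x) 0; first by rewrite (le_trans Dx)// mulr_ge0 ?(ltW D00)//; lra.
have h1 := ler_enormD (x - x0) x0; rewrite subrK in h1.
have h2 : (1 - theta) * d0 <= 1 / 2 - enorm x by move: xr; rewrite /r /d0; lra.
have h3 : 0 <= (1 - theta) * d0 by rewrite mulr_ge0 ?(ltW d00)//; lra.
have x12 : enorm x <= 1 / 2 by lra.
have h4 : ((1 - theta) * d0) ^+ 2 * D x <= d0 ^+ 2 * D x0.
  apply: le_trans (x0max x12); rewrite ler_wpM2r ?(ltW Dx)// ler_pXn2r ?nnegrE//; lra.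
have h5 : (1 - theta) ^+ 2 * D x <= D x0.
  by rewrite -(@ler_pM2l _ (d0 ^+ 2)) ?exprn_gt0// (le_trans _ h4)// le_eqVlt; apply/orP; left; apply/eqP; ring.
have h6 : 1 <= (1 + 3 * theta) * (1 - theta) ^+ 2.
  have : 0 <= theta * (1 - 5 * theta + 3 * theta ^+ 2).
    by rewrite mulr_ge0 ?(ltW t0)//; have := sqr_ge0 theta; lra.
  nra.
apply: (@le_trans _ _ ((1 + 3 * theta) * (1 - theta) ^+ 2 * D x)); first by rewrite ler_peMl// ltW.
by rewrite -mulrA ler_wpM2l//; lra.
Qed.

Hypotheses (h0 : 0 < enorm h) (hrho : enorm h <= cnear * rho / 8).

Lemma at_max_le : D x0 * cmass / 2 <= 10 * enorm h ^+ 2 / (cnear * rho) ^+ 2 * ((1 + CD2c n s Lam cnear) * (M + m)).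
Proof.
have /andP[t0 t1] := th; have /andP[tau0 tau1] := tau01.
have D00' := D00; have d00' := d00; have h8' := h8; have hrho' := hrho.
have r0 : 0 < r by rewrite mulr_gt0.
have rho0 : 0 < rho by rewrite divr_gt0.
(* The penalty equals tau D(x0) / 4 at distance r / 2, which is all that maximality leaves: hence |x
   - x0| <= r / 2. *)
pose A := tau * D x0 / r ^+ 2; have A0 : 0 <= A by rewrite divr_ge0 ?mulr_ge0 ?sqr_ge0 ?ltW.
have x0r : enorm x0 + r <= 1 / 2.
  have : theta * d0 <= d0 by rewrite ler_piMl ?(ltW d00)//; lra.
  by rewrite /r /d0; lra.
(* |h|^2 makes p + q = a + b of second order; 1/16 leaves room to move a and b within the radius
   1/8. *)
pose sg := Num.min (1 / 16) (enorm h ^+ 2).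
have sg0 : 0 < sg by rewrite lt_min divr_gt0//= exprn_gt0.
have sg16 : sg <= 1 / 16 by rewrite ge_min lexx.
have w0 : 0 < theta * D x0 by rewrite mulr_gt0.
have [x [a [b [eps [eps0 [xr Axr [asg bsg] DD pmax]]]]]] :=
  doubling cv vM r0 x0r h8 A0 sg0 sg16 w0 (ltW D00) (erefl (D x0)) D_near.
have xr2 : enorm (x - x0) <= r / 2.
  rewrite -(@ler_pXn2r _ 2) ?nnegrE ?(ltW rho0)//.
  have e1 : (1 + 3 * theta) * D x0 - D x0 + 2 * (theta * D x0) = tau * D x0 / 4.
    by rewrite /theta; field.
  rewrite e1 in Axr.
  have e2 : (r / 2) ^+ 2 = A^-1 * (tau * D x0 / 4).
    by rewrite /A; field; rewrite !gt_eqF.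
  rewrite e2 ler_pdivlMl//; first by rewrite divr_gt0 ?mulr_gt0 ?exprn_gt0.
have [a16 ah] : enorm a <= 1 / 16 /\ enorm a <= enorm h ^+ 2.
  by move: asg; rewrite le_min => /andP[].
have [b16 bh] : enorm b <= 1 / 16 /\ enorm b <= enorm h ^+ 2.
  by move: bsg; rewrite le_min => /andP[].
have hh : enorm h ^+ 2 <= enorm h by rewrite expr2 ler_piMl//; lra.
have ph : enorm (h + a) <= 2 * enorm h by rewrite (le_trans (ler_enormD _ _))//; lra.
have qh : enorm (- h + b) <= 2 * enorm h by rewrite (le_trans (ler_enormD _ _))// enormN; lra.
have pr : enorm (h + a) <= cnear * (r / 2) / 4 by rewrite -/rho; lra.
have qr : enorm (- h + b) <= cnear * (r / 2) / 4 by rewrite -/rho; lra.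
have D20 := le_trans (ltW D00) DD.
have main := configuration_le n0 s0 s1 lam0 lamLam hK mv vM dc cm vsub vsup cnear_gt0 cnearP
  r0 A0 x0r h8 xr2 a16 b16 pmax pr qr D20.
(* Passage to the limit eta -> 0. *)
move/ler_addgt0Pr : main => main.
rewrite -/cmass -/rho in main.
set p := h + a in DD pr qr main ph *; set q := - h + b in DD pr qr main qh *.
set X := rho ^+ n * P rho in main.
have rho1 : rho <= 1 by have := enorm_ge0 x0; rewrite /rho; lra.
have X1 : 1 <= X by exact: kpow_scale_ge1.
have pq : enorm (p + q) <= 2 * enorm h ^+ 2.
  have -> : p + q = a + b by rewrite /p /q; apply/rowP => i; rewrite !mxE; ring.
  by rewrite (le_trans (ler_enormD _ _))//; lra.
have p2 : enorm p ^+ 2 <= 4 * enorm h ^+ 2.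
  have -> : 4 * enorm h ^+ 2 = (2 * enorm h) ^+ 2 by ring.
  by rewrite ler_pXn2r ?nnegrE ?mulr_ge0.
have q2 : enorm q ^+ 2 <= 4 * enorm h ^+ 2.
  have -> : 4 * enorm h ^+ 2 = (2 * enorm h) ^+ 2 by ring.
  by rewrite ler_pXn2r ?nnegrE ?mulr_ge0.
set y := cnear * rho in main *.
have y0 : 0 < y by rewrite mulr_gt0// cnear_gt0.
have y1 : y <= 1 by rewrite mulr_ile1 ?(ltW cnear_gt0) ?(ltW rho0) ?cnear_le1.
have y2 : 1 <= (y ^+ 2)^-1 by rewrite invf_ge1 ?exprn_gt0// exprn_ile1// ltW.
have yV : y^-1 <= (y ^+ 2)^-1.
  by rewrite lef_pV2 ?posrE ?exprn_gt0// expr2 ler_piMl// ltW.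
(* 10 = 2 + 4 + 4, from the bounds on p + q, p and q. *)
set Z := 10 * enorm h ^+ 2 / y ^+ 2.
have hZ : 10 * enorm h ^+ 2 <= Z by rewrite /Z ler_peMr// mulr_ge0 ?sqr_ge0.
have SZ : enorm (p + q) + enorm p ^+ 2 + enorm q ^+ 2 <= Z by lra.
have EZ : enorm (p + q) / y + (enorm p ^+ 2 + enorm q ^+ 2) / y ^+ 2 <= Z.
  have : enorm (p + q) / y <= 2 * enorm h ^+ 2 / y ^+ 2.
    by apply: ler_pM => //; rewrite invr_ge0 ltW.
  have : (enorm p ^+ 2 + enorm q ^+ 2) / y ^+ 2 <= 8 * enorm h ^+ 2 / y ^+ 2.
    by rewrite ler_wpM2r ?invr_ge0 ?sqr_ge0//; lra.
  by rewrite /Z; lra.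
(* A rho^2 = tau D(x0) / 4, and tau times the core constant is at most 2 cmass: half of the mass
   term remains. *)
have core : A * (Cc n s Lam * (rho ^+ n.+2 * P rho)) <= D x0 * cmass / 2 * X.
  have Cc0 := Cc_gt0 n s1 lam0 lamLam.
  have -> : A * (Cc n s Lam * (rho ^+ n.+2 * P rho)) = tau * D x0 / 4 * Cc n s Lam * X.
    rewrite /A /X /rho !exprS; field; by rewrite gt_eqF.
  rewrite ler_wpM2r//; first by lra.
  have : tau * Cc n s Lam <= 2 * cmass.
    by rewrite -ler_pdivlMr// /tau /cpen ge_min lexx orbT.
  nra.
have CD0 := CD2c_ge0 n s0 lam0 lamLam cnear_gt0.
have X0 : 0 < X by lra.
have Z0 : 0 <= Z by apply: le_trans hZ; rewrite mulr_ge0 ?sqr_ge0.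
have D2D : D x0 * cmass * X <= (2 * v x - v (x + p) - v (x + q)) * cmass * X.
  by rewrite !ler_wpM2r ?(ltW X0) ?(ltW cmass_gt0).
have t2 : m * (enorm (p + q) + enorm p ^+ 2 + enorm q ^+ 2) <= m * Z * X.
  apply: (@le_trans _ _ (m * Z)); first by rewrite ler_wpM2l.
  by rewrite ler_peMr// mulr_ge0.
have t3 : CD2c n s Lam cnear * (M * (enorm (p + q) / y + (enorm p ^+ 2 + enorm q ^+ 2) / y ^+ 2)) * X <=
   CD2c n s Lam cnear * (M * Z) * X.
  by rewrite ler_wpM2r ?(ltW X0)// ler_wpM2l// ler_wpM2l.
rewrite -(ler_pM2r X0).
have t4 : 0 <= Z * M * X := mulr_ge0 (mulr_ge0 Z0 M0) (ltW X0).
have t5 : 0 <= CD2c n s Lam cnear * (Z * m * X) := mulr_ge0 CD0 (mulr_ge0 (mulr_ge0 Z0 m0) (ltW X0)).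
lra.
Qed.

End at_max.

(** A maximum above the bound is used twice: with D <= 4 M it makes |h| small compared with d0, as
    [at_max_le] requires, and then it contradicts the estimate obtained there. *)
Lemma second_difference_le x : enorm x <= 1 / 2 ->
  (1 / 2 - enorm x) ^+ 2 * D x <= csd * (M + m) * enorm h ^+ 2.
Proof.
move=> x12; have h8' := h8.
have N0 : 0 <= csd * (M + m) * enorm h ^+ 2.
  by rewrite mulr_ge0 ?sqr_ge0// mulr_ge0 ?addr_ge0// ltW// csd_gt0.
pose F y := (1 / 2 - enorm y) ^+ 2 * D y.
pose S : set 'rV[R]_n := [set y | enorm (y - 0) <= 1 / 2].
have cF : {within S, continuous F}.
  apply: continuous_in_subspaceT => y /set_mem; rewrite /S /= subr0 => y12.
  have c0 : {for y, continuous v} by apply: cv; lra.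
  have c1 : {for y + h, continuous v}.
    by apply: cv; rewrite (le_lt_trans (ler_enormD _ _))//; lra.
  have c2 : {for y - h, continuous v}.
    by apply: cv; rewrite (le_lt_trans (ler_enormB _ _))//; lra.
  have cc (V : normedModType R) (l : V) : {for y, continuous (fun=> l : V)} by exact: cst_continuous.
  have ce : {for y, continuous (fun z => 1 / 2 - enorm z : R^o)}.
    by apply: continuousB; [exact: (cc R^o)|exact: enorm_continuous].
  have cp1 : {for y, continuous (v \o (fun z => z + h))}.
    by apply: continuous_comp; [apply: continuousD; [exact: cvg_id|exact: cc]|exact: c1].
  have cp2 : {for y, continuous (v \o (fun z => z - h))}.
    by apply: continuous_comp; [apply: continuousB; [exact: cvg_id|exact: cc]|exact: c2].
  have cd : {for y, continuous (fun z => D z : R^o)}.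
    apply: continuousB; [apply: continuousB|].
    - by apply: (@continuousM _ _ (fun=> 2) v); [exact: (cc R^o)|exact: c0].
    - exact: cp1.
    - exact: cp2.
  rewrite (_ : F = fun z => (1 / 2 - enorm z) * (1 / 2 - enorm z) * D z); last by apply/funext => z; rewrite /F expr2.
  exact: (continuousM (continuousM ce ce) cd).
have Sx : S x by rewrite /S /= subr0.
have [x0 /set_mem x0S x0max] := compact_EVT_max (ex_intro _ _ Sx) (@compact_enorm_le R n 0 (1 / 2)) cF.
rewrite /S /= subr0 in x0S.
have {}x0max y : enorm y <= 1 / 2 -> (1 / 2 - enorm y) ^+ 2 * D y <= (1 / 2 - enorm x0) ^+ 2 * D x0.
  by move=> y12; apply: x0max; apply: mem_set; rewrite /S /= subr0.
apply: (le_trans (x0max x x12)); rewrite leNgt; apply/negP => lt0.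
set d0 := 1 / 2 - enorm x0 in lt0 x0max.
have d0ge : 0 <= d0 by rewrite /d0; lra.
have F0 : 0 < d0 ^+ 2 * D x0 by apply: le_lt_trans lt0.
have d00 : 0 < d0.
  rewrite lt_neqAle d0ge andbT; apply/eqP => e; move: F0; rewrite -e expr0n/= mul0r ltxx//.
have D00 : 0 < D x0 by move: F0; rewrite pmulr_rgt0// exprn_gt0.
have h0 : 0 < enorm h.
  rewrite lt_neqAle enorm_ge0 andbT; apply/eqP => e; move: D00.
  have hz : h = 0 by apply/eqP; rewrite -enorm_eq0 -e.
  by rewrite /D hz addr0 subr0 => ?; lra.
have /andP[t0 t1] := tau01.
have L0 : 0 < L by rewrite mulr_gt0 ?cnear_gt0// divr_gt0.
have C0 := cmass_gt0; have CD0 := CD2c_ge0 n s0 lam0 lamLam cnear_gt0.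
have csdL : csd * L ^+ 2 = 80 * (1 + CD2c n s Lam cnear) / cmass + 1024.
  by rewrite /csd -/tau -/theta -/L divfK// gt_eqF// exprn_gt0.
have lt1 : (csd * L ^+ 2) * ((M + m) * enorm h ^+ 2) < L ^+ 2 * (d0 ^+ 2 * D x0).
  have -> : csd * L ^+ 2 * ((M + m) * enorm h ^+ 2) = L ^+ 2 * (csd * (M + m) * enorm h ^+ 2) by ring.
  by rewrite ltr_pM2l// exprn_gt0.
rewrite csdL mulrDl in lt1.
have q0 : 0 <= (M + m) * enorm h ^+ 2 by rewrite mulr_ge0 ?addr_ge0 ?sqr_ge0.
have q1 : 0 <= 80 * (1 + CD2c n s Lam cnear) / cmass by rewrite divr_ge0 ?(ltW C0)// mulr_ge0//; lra.
have q2 := mulr_ge0 q1 q0.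
have hrho : enorm h <= cnear * (theta * d0 / 2) / 8.
  have -> : cnear * (theta * d0 / 2) / 8 = L * d0 / 16 by rewrite /L; field.
  have Ld0 : 0 <= L * d0 / 16 by apply: divr_ge0 => //; apply: mulr_ge0; apply: ltW.
  rewrite -(@ler_pXn2r _ 2) ?nnegrE//.
  have DM0 := DM x0; have Mgt0 : 0 < M by lra.
  have l2 : 1024 * (M * enorm h ^+ 2) <= L ^+ 2 * (d0 ^+ 2 * (4 * M)).
    have : L ^+ 2 * (d0 ^+ 2 * D x0) <= L ^+ 2 * (d0 ^+ 2 * (4 * M)).
      by rewrite ler_wpM2l ?sqr_ge0// ler_wpM2l ?sqr_ge0.
    have : 0 <= m * enorm h ^+ 2 by rewrite mulr_ge0 ?sqr_ge0.
    lra.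
  rewrite -(ler_pM2r Mgt0); lra.
have := at_max_le d00 D00 x0max h0 hrho.
have -> : cnear * (theta * d0 / 2) = L * d0 / 2 by rewrite /L; field.
have y0 : 0 < (L * d0 / 2) ^+ 2 by rewrite exprn_gt0// divr_gt0// mulr_gt0.
rewrite -(ler_pM2r y0).
rewrite [leRHS]mulrAC (divfK (lt0r_neq0 y0)) => H.
have : L ^+ 2 * (d0 ^+ 2 * D x0) <= 80 * (1 + CD2c n s Lam cnear) / cmass * ((M + m) * enorm h ^+ 2).
  by rewrite [leRHS]mulrAC ler_pdivlMr//; lra.
lra.
Qed.

End second_difference.

(** * Semiconvexity *)

(* If the difference with the chord had a positive maximum at t0, then t0 would
   be the midpoint of an endpoint, where the difference vanishes, and of another
   point of the interval. *)
Lemma midpoint_convex_line (R : realType) (g : R -> R) :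
  (forall t, 0 <= t <= 1 -> {for t, continuous g}) ->
  (forall t1 t2, 0 <= t1 <= 1 -> 0 <= t2 <= 1 -> 2 * g ((t1 + t2) / 2) <= g t1 + g t2) ->
  forall t, 0 <= t <= 1 -> g t <= t * g 1 + (1 - t) * g 0.
Proof.
move=> cg mg; pose f t := g t - (t * g 1 + (1 - t) * g 0).
have cf : {within `[0, 1], continuous f}.
  apply: continuous_in_subspaceT => t; rewrite inE /= in_itv /= => t01.
  have ct : {for t, continuous (fun z : R => z * g 1 + (1 - z) * g 0 : R^o)}.
    apply: continuousD; first exact: (continuousM (@cvg_id _ _) (@cst_continuous _ _ _ _)).
    apply: (@continuousM _ _ (fun z : R => 1 - z) (fun=> g 0)); last exact: cst_continuous.
    by apply: continuousB; [exact: cst_continuous|exact: cvg_id].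
  exact: (continuousB (cg t t01) ct).
have f0 : f 0 = 0 by rewrite /f; ring.
have f1 : f 1 = 0 by rewrite /f; ring.
have fm t1 t2 : 0 <= t1 <= 1 -> 0 <= t2 <= 1 -> 2 * f ((t1 + t2) / 2) <= f t1 + f t2.
  by move=> h1 h2; have := mg _ _ h1 h2; rewrite /f; lra.
have [t0] := EVT_max ler01 cf; rewrite in_itv /= => /andP[t00 t01] tmax.
suff ft0 : f t0 <= 0.
  by move=> t ht; have := tmax t; rewrite in_itv /= ht => /(_ isT); rewrite /f in ft0 *; lra.
have [h|h] := leP t0 (1 / 2).
  have e : (0 + 2 * t0) / 2 = t0 by field.
  have i1 : 0 <= (0 : R) <= 1 by rewrite lexx ler01.
  have i2 : 0 <= 2 * t0 <= 1 by apply/andP; split; lra.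
  have := fm _ _ i1 i2; rewrite e f0; have := tmax (2 * t0); rewrite in_itv /= i2 => /(_ isT); lra.
have e : (1 + (2 * t0 - 1)) / 2 = t0 by field.
have i1 : 0 <= (1 : R) <= 1 by rewrite lexx ler01.
have i2 : 0 <= 2 * t0 - 1 <= 1 by apply/andP; split; lra.
have := fm _ _ i1 i2; rewrite e f1; have := tmax (2 * t0 - 1); rewrite in_itv /= i2 => /(_ isT); lra.
Qed.

(** By the parallelogram identity the added paraboloid lowers the second difference by exactly 2 kap
    |h|^2, so that the sum is midpoint convex on every segment of the ball. *)
Lemma dee_ge_opp_of_second_difference (R : realType) (n : nat) (u : 'rV[R]_n -> R) (rad kap C : R) e :
  0 < rad -> C / (2 * n%:R) = kap ->
  (forall x, enorm x < rad -> {for x, continuous u}) ->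
  (forall x h, enorm x < rad -> enorm h < rad -> 2 * u x - u (x + h) - u (x - h) <= 2 * kap * enorm h ^+ 2) ->
  dee_ge_opp e u (eball rad) C.
Proof.
move=> rad0 Ckap cu du; rewrite /dee_ge_opp Ckap.
pose f (z : 'rV[R]_n) := u z + kap * enorm z ^+ 2.
suff key (t : R) (x y : 'rV[R]_n) : 0 <= t <= 1 -> enorm x < rad -> enorm y < rad ->
    f (t *: x + (1 - t) *: y) <= t * f x + (1 - t) * f y.
  move=> t x y /set_mem x1 /set_mem y1; apply: key => //.
  by apply/andP; split; [exact: ge0|exact: le1].
move=> t01 x1 y1.
pose ga (z : R) : 'rV[R]_n := y + z *: (x - y).
have gaE z : ga z = z *: x + (1 - z) *: y.
  by rewrite /ga; apply/rowP => i; rewrite !mxE; ring.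
have gain z : 0 <= z <= 1 -> enorm (ga z) < rad.
  move=> /andP[z0 z1]; have z1' : 0 <= 1 - z by rewrite subr_ge0.
  rewrite gaE (le_lt_trans (ler_enormD _ _))// !enormZ !ger0_norm//.
  have [->|z0'] := eqVneq z 0; first by rewrite mul0r add0r subr0 mul1r.
  have zp : 0 < z by rewrite lt_neqAle eq_sym z0'.
  have h1 : (1 - z) * enorm y <= (1 - z) * rad by rewrite ler_wpM2l// ltW.
  have h2 : z * enorm x < z * rad by rewrite ltr_pM2l.
  lra.
have cga z : {for z, continuous ga}.
  apply: continuousD; first exact: cst_continuous.
  exact: scalel_continuous.
have cf z : 0 <= z <= 1 -> {for z, continuous (f \o ga)}.
  move=> z01; apply: continuous_comp; first exact: cga.
  apply: continuousD; first exact: cu (gain z z01).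
  have ce : {for ga z, continuous (fun w : 'rV[R]_n => enorm w : R^o)} by exact: enorm_continuous.
  rewrite (_ : (fun w => kap * enorm w ^+ 2) = fun w => kap * (enorm w * enorm w)); last first.
    by apply/funext => w; rewrite expr2.
  exact: (continuousM (@cst_continuous _ _ kap _) (continuousM ce ce)).
have mf z1 z2 : 0 <= z1 <= 1 -> 0 <= z2 <= 1 ->
    2 * (f \o ga) ((z1 + z2) / 2) <= (f \o ga) z1 + (f \o ga) z2.
  move=> i1 i2; pose h := 2^-1 *: (ga z1 - ga z2); pose w := ga ((z1 + z2) / 2).
  have e1 : w + h = ga z1 by rewrite /w /h /ga; apply/rowP => i; rewrite !mxE; field.
  have e2 : w - h = ga z2 by rewrite /w /h /ga; apply/rowP => i; rewrite !mxE; field.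
  have i3 : 0 <= (z1 + z2) / 2 <= 1.
    by move/andP : i1 => [? ?]; move/andP : i2 => [? ?]; apply/andP; split; lra.
  have hr : enorm h < rad.
    rewrite /h enormZ ger0_norm ?invr_ge0// mulrC ltr_pdivrMr//.
    by rewrite (le_lt_trans (ler_enormB _ _))//; have := gain _ i1; have := gain _ i2; lra.
  have := du _ h (gain _ i3) hr; rewrite -/w e1 e2 /= /f -/w.
  have : enorm (ga z1) ^+ 2 + enorm (ga z2) ^+ 2 = 2 * enorm w ^+ 2 + 2 * enorm h ^+ 2.
    by rewrite -e1 -e2 !enormD_sqr enormN dotNr; ring.
  move=> E1 E2; have : kap * (enorm (ga z1) ^+ 2 + enorm (ga z2) ^+ 2) = kap * (2 * enorm w ^+ 2 + 2 * enorm h ^+ 2) by rewrite E1.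
  lra.
have := midpoint_convex_line cf mf t01.
by rewrite /= !gaE !scale1r !scale0r subrr subr0 !scale0r !scale1r addr0 add0r.
Qed.

Theorem theorem4p2 (R : realType) (n : nat) (s lam Lam : R) :
  (0 < n)%N -> 0 < s -> s < 1 -> 0 < lam -> lam <= Lam ->
  exists C : R, 0 < C /\
    forall (Gam : Type) (K : Gam -> 'rV[R]_n -> \bar R)
      (c : Gam -> 'rV[R]_n -> R) (u : 'rV[R]_n -> R),
      Js s lam Lam K c ->
      (forall x : 'rV[R]_n, eball 1 x -> {for x, continuous u}) ->
      (u : lebesgueRn R n -> R) \in Lfun (lebesgue_measureRn R n) +oo%E ->
      viscosity_solution (Iop K c) (eball 1) u ->
      forall e : 'rV[R]_n, enorm e = 1 ->
        dee_ge_opp e u (eball (1 / 8))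
          (C * (fine (ereal_sup [set C11_norm (eball 1) (c g)
                                | g in [set: Gam]]) +
                fine ('N[lebesgue_measureRn R n]_(+oo%E)[EFin \o u])%E)).
Proof.
move=> n0 s0 s1 lam0 lamLam.
have C0 := csd_gt0 n0 s0 s1 lam0 lamLam.
have nR : 0 < n%:R :> R by rewrite ltr0n.
(* In the ball of radius 1/8 the weight is at least (3/8)^2, and 64/9 <= 8; the factor n compensates
   the normalization C / (2 n). *)
exists (8 * n%:R * csd n s lam Lam); split; first exact: mulr_gt0 (mulr_gt0 (ltr0n _ 8) nR) C0.
move=> Gam K c u [hK hc hsup] cu uL visc e _.
set m := fine (ereal_sup _).
have [M0 mu_ uM] := ess_bound uL.
set M := fine ('N[_]_(_)[_])%E in M0 uM *.
have cm g : (C11_norm (eball 1) (c g) <= m%:E)%E.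
  have cs : (C11_norm (eball 1) (c g) <= ereal_sup [set C11_norm (eball 1) (c g) | g in [set: Gam]])%E.
    by apply: ereal_sup_ubound; exists g.
  have [_ cfin] := hc g.
  have c0 := C11_norm_ge0 (c g) n0.
  rewrite /m fineK// ge0_fin_numE; first by rewrite (le_lt_trans hsup)// ltry.
  exact: le_trans cs.
have m0 : 0 <= m.
  (* For an empty family the supremum is -oo, and [fine] sends it to 0. *)
  have [[g]|noG] := pselect (inhabited Gam).
    by rewrite -lee_fin; apply: le_trans (cm g); exact: C11_norm_ge0.
  rewrite /m (_ : [set _ | _ in _] = set0) ?ereal_sup0//.
  by apply/seteqP; split => // y [g _ _]; apply: noG; exists.
pose v x := clip M (u x).
have vM x : `|v x| <= M by exact: clip_bound.
have mv : mfunRn setT v by exact: mfun_clip.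
have uMB x : eball 1 x -> `|u x| <= M.
  apply: (ae_le_open (D := eball 1)) => //.
  rewrite (_ : eball 1 = [set y : 'rV[R]_n | enorm (y - 0) < 1]); first exact: open_enorm_lt.
  by apply/funext => y; rewrite /eball /= subr0.
have uvB x : eball 1 x -> u x = v x by move=> x1; rewrite /v clip_id// uMB.
have uv : {ae lebesgue_measureRn R n, forall x, u x = v x}.
  by apply: (negligibleS _ uM) => x /= h H; apply: h; rewrite /v clip_id.
have dc g x : eball 1 x -> differentiable (c g) x by have [+ _] := hc g; exact.
have cv y : enorm y < 1 -> {for y, continuous v}.
  move=> y1; have cy := cu y y1.
  suff : v @ y --> u y by rewrite (uvB y y1).
  have ny : nbhs y [set z : 'rV[R]_n | enorm (z - 0) < 1].
    by apply: open_nbhs_nbhs; split; [exact: open_enorm_lt|rewrite /= subr0].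
  have nuv : nbhs y [set z | u z = v z].
    by apply: (@filterS _ (nbhs y) (nbhs_filter y) _ _ _ ny) => z /=; rewrite subr0 => /uvB.
  apply: cvg_trans cy.
  by apply: near_eq_cvg; [exact: (nbhs_filter y)|exact: nuv].
move: (csd n s lam Lam) C0 (second_difference_le n0 s0 s1 lam0 lamLam hK mv vM m0 cv dc cm) => csd0 C0 sd.
have vsub := visc_sub s0 s1 lam0 lamLam hK mu_ mv vM uv uvB visc.
have vsup := visc_super s0 s1 lam0 lamLam hK mu_ mv vM uv uvB visc.
have N0 : 0 <= csd0 * (M + m) by apply: mulr_ge0; [exact: ltW C0|exact: addr_ge0 M0 m0].
apply: (@dee_ge_opp_of_second_difference _ _ _ _ (4 * (csd0 * (M + m)))).
- by rewrite divr_gt0.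
- by field; rewrite gt_eqF.
- by move=> x x8; apply: cu; rewrite /eball /=; lra.
move=> x h x8 h8.
have [x1 [xh1 xh2]] : enorm x < 1 /\ enorm (x + h) < 1 /\ enorm (x - h) < 1.
  have e1 := ler_enormD x h; have e2 := ler_enormB x h.
  by split; [|split]; lra.
rewrite (uvB x x1) (uvB _ xh1) (uvB _ xh2).
have x12 : enorm x <= 1 / 2 by lra.
have := sd vsub vsup h (ltW h8) x x12.
set Dx := 2 * v x - _ - _; set Y := csd0 * (M + m) in N0 *.
have YH : 0 <= Y * enorm h ^+ 2 by rewrite mulr_ge0 ?sqr_ge0.
have [Dx0 _|Dx0 H] := leP Dx 0; first by lra.
have h38 : (3 / 8) ^+ 2 <= (1 / 2 - enorm x) ^+ 2 :> R.
  by rewrite ler_pXn2r ?nnegrE//; lra.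
have : (3 / 8) ^+ 2 * Dx <= (1 / 2 - enorm x) ^+ 2 * Dx by rewrite ler_wpM2r// ltW.
lra.
Qed.
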